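(* Let $K\subseteq\mathbb{C}^d$ be a polyhedron with at least $3$ vertices, one of which is $0$, and fix a separable infinite-dimensional Hilbert space $H$. Then there are uncountably many pairwise unitarily inequivalent $d$-tuples $T$ of compact operators on $H$ such that $\mathcal{W}(T)=\mathcal{W}^{\min}(K)$ and $T$ is minimal for its matrix range.
   Context: Polyhedron means the convex hull of finitely many points. Let $\mathcal{M}^d=\bigcup_{n\ge1}M_n^d$, where $M_n^d$ is the set of $d$-tuples of complex $n\times n$ matrices. UCP means unital completely positive. For $T\in\mathcal{B}(H)^d$, the matrix range is $\mathcal{W}(T)=\bigcup_n\mathcal{W}_n(T)$, where $\mathcal{W}_n(T)=\{(\psi(T_1),\ldots,\psi(T_d)):\psi:\mathcal{B}(H)\to M_n\text{ UCP}\}$. A tuple of operators is normal if its members are normal and commute with each other; $\sigma(N)$ denotes the joint spectrum of a normal tuple. $Y\in\mathcal{B}(L)^d$ is a dilation of $X\in\mathcal{B}(H)^d$ if there is an isometry $V:H\to L$ with $X_i=V^*Y_iV$ for all $i$. For a compact convex set $K\subseteq\mathbb{C}^d$, $\mathcal{W}^{\min}(K)$ is the set of $X\in\mathcal{M}^d$ having a normal dilation $N$ with $\sigma(N)\subseteq K$. A tuple $T\in\mathcal{B}(H)^d$ is minimal (for its matrix range) if the restriction of $T$ to any proper reducing subspace has strictly smaller matrix range. Tuples $S,T$ are unitarily equivalent if there is a single unitary $U$ with $S_i=U^*T_iU$ for all $i$. *)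

(* Defs.v *)
From HB Require Import structures.
From mathcomp Require Import all_boot all_order all_algebra.
From mathcomp Require Import complex.
From mathcomp Require Import all_classical all_reals all_analysis.

Set Implicit Arguments.
Unset Strict Implicit.
Unset Printing Implicit Defensive.

Import Order.TTheory GRing.Theory Num.Theory.
Import numFieldNormedType.Exports.

Local Open Scope classical_set_scope.
Local Open Scope ring_scope.
Local Open Scope convex_scope.

(* The inner product is linear in its first argument. *)
HB.mixin Record isHilbert (R : realType) (H : Type)
    & CompleteNormedModule R[i] H := {
  inner : {dot H for @Num.conj R[i]};
  inner_norm : forall x : H, inner x x = `|x| ^+ 2
}.

#[short(type="hilbertType")]
HB.structure Definition Hilbert (R : realType) :=
  {H of CompleteNormedModule R[i] H & isHilbert R H}.

Section BoundedOperators.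
Variables (R : realType) (H : hilbertType R).

Definition bounded_op : {pred H -> H} :=
  mem [set f : H -> H | linear f /\ continuous f].

(* B(H), as a linear subspace of the space of all functions from H to H. *)
Record bop := Bop { bop_fun :> H -> H; bop_funP : bop_fun \in bounded_op }.

HB.instance Definition _ := [isSub for bop_fun].
HB.instance Definition _ := [Choice of bop by <:].

Lemma bounded_op_submod : submod_closed bounded_op.
Proof.
split.
  apply/mem_set; split; last exact: cst_continuous.
  by move=> a x y; rewrite /= scaler0 addr0.
move=> a f g /set_mem[lf cf] /set_mem[lg cg]; apply/mem_set; split.
  have E z : (a *: f + g) z = a *: f z + g z :> H by [].
  by move=> b x y; rewrite !E lf lg !scalerDr !scalerA [b * a]mulrC addrACA.
move=> x.
apply: (@cvgD _ _ _ _ _ (fun x => a *: f x) g); last exact: cg.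
by apply: cvgZr; exact: cf.
Qed.

HB.instance Definition _ :=
  GRing.isSubmodClosed.Build _ _ bounded_op bounded_op_submod.
HB.instance Definition _ := [SubChoice_isSubLmodule of bop by <:].

Lemma bop_linear (A : bop) : linear A.
Proof. by have /set_mem[] := bop_funP A. Qed.

Lemma bop_continuous (A : bop) : continuous A.
Proof. by have /set_mem[] := bop_funP A. Qed.

Lemma bop1_subproof : (idfun : H -> H) \in bounded_op.
Proof. by apply/mem_set; split => // x; exact: cvg_id. Qed.

Definition bop1 : bop := Bop bop1_subproof.

Lemma bopM_subproof (A B : bop) : A \o B \in bounded_op.
Proof.
apply/mem_set; split.
  by move=> a x y; rewrite /= (bop_linear B) (bop_linear A).
by move=> x; apply: continuous_comp; exact: bop_continuous.
Qed.

Definition bopM (A B : bop) : bop := Bop (bopM_subproof A B).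

(* B = A^*, stated as a relation. *)
Definition is_adjoint (A B : bop) : Prop :=
  forall x y : H, inner (A x) y = inner x (B y).

Definition normal_op (A : bop) : Prop :=
  exists2 B, is_adjoint A B & bopM A B = bopM B A.

Definition compact_op (A : bop) : Prop :=
  precompact (A @` [set x : H | `|x| <= 1]).

Definition normal_tuple d (N : 'I_d -> bop) : Prop :=
  (forall i, normal_op (N i)) /\
  (forall i j, bopM (N i) (N j) = bopM (N j) (N i)).

(* Unital C*-subalgebras of B(H); the last clause is closedness in operator
   norm. *)
Definition cstar_subalgebra (S : set bop) : Prop :=
  [/\ S bop1,
      (forall (a : R[i]) A B, S A -> S B -> S (a *: A + B)),
      (forall A B, S A -> S B -> S (bopM A B)),
      (forall A B, S A -> is_adjoint A B -> S B) &
      (forall A : bop, (forall e : R[i], 0 < e ->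
          exists2 B, S B & forall x, `|A x - B x| <= e * `|x|) -> S A)].

Definition cstar_generated d (N : 'I_d -> bop) : set bop :=
  smallest cstar_subalgebra (range N).

(* Only the values of chi on S matter. *)
Definition is_character (S : set bop) (chi : bop -> R[i]) : Prop :=
  [/\ chi bop1 = 1,
      (forall (a : R[i]) A B, S A -> S B ->
         chi (a *: A + B) = a * chi A + chi B) &
      (forall A B, S A -> S B -> chi (bopM A B) = chi A * chi B)].

(* Joint spectrum of a normal tuple: the Gelfand spectrum of the commutative
   unital C*-algebra it generates, seen in C^d through
   chi |-> (chi N_1, ..., chi N_d). *)
Definition joint_spectrum d (N : 'I_d -> bop) : set 'rV[R[i]]_d :=
  [set l | exists2 chi, is_character (cstar_generated N) chi &
           forall i, l 0 i = chi (N i)].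

Definition unitary_op (U Us : bop) : Prop :=
  [/\ is_adjoint U Us, bopM U Us = bop1 & bopM Us U = bop1].

Definition unitarily_equivalent d (S T : 'I_d -> bop) : Prop :=
  exists U Us : bop, unitary_op U Us /\
    forall i, S i = bopM Us (bopM (T i) U).

Definition separable_space : Prop :=
  exists2 D : set H, countable D & dense D.

Definition infinite_dimensional : Prop :=
  ~ exists n (e : 'I_n -> H),
      forall x, exists c : 'I_n -> R[i], x = \sum_i c i *: e i.

End BoundedOperators.

Section MatrixRange.
Variables (R : realType) (d : nat).

(* M^d, the disjoint union over n >= 1 of the d-tuples of n x n matrices; the
   first component is n - 1. *)
Definition matrix_tuple := {n : nat & 'I_d -> 'M[R[i]]_n.+1}.

Definition dotv n (x y : 'cV[R[i]]_n) : R[i] := \sum_i x i 0 * (y i 0)^*.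

(* Positivity in M_k(B(H)) = B(H^k) and in M_k(M_n) = B((C^n)^k). *)
Definition positive_opmx (H : hilbertType R) k (A : 'M[bop H]_k) : Prop :=
  forall x : 'I_k -> H, 0 <= \sum_i \sum_j inner (A i j (x j)) (x i).

Definition positive_mxmx n k (A : 'M['M[R[i]]_n]_k) : Prop :=
  forall x : 'I_k -> 'cV[R[i]]_n,
    0 <= \sum_i \sum_j dotv (A i j *m x j) (x i).

Definition ucp (H : hilbertType R) n (psi : {linear bop H -> 'M[R[i]]_n}) :
    Prop :=
  psi (bop1 H) = 1%:M /\
  forall k (A : 'M[bop H]_k), positive_opmx A -> positive_mxmx (map_mx psi A).

Definition matrix_range (H : hilbertType R) (T : 'I_d -> bop H) :
    set matrix_tuple :=
  [set X : matrix_tuple |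
     exists2 psi : {linear bop H -> 'M[R[i]]_((projT1 X).+1)},
       ucp psi & projT2 X = fun i => psi (T i)].

(* X = V^* Y V for an isometry V : C^n -> L, with adjoint Vs. *)
Definition is_dilation (L : hilbertType R) (Y : 'I_d -> bop L) n
    (X : 'I_d -> 'M[R[i]]_n) : Prop :=
  exists (V : {linear 'cV[R[i]]_n -> L}) (Vs : L -> 'cV[R[i]]_n),
    [/\ forall x y, inner (V x) (V y) = dotv x y,
        forall x y, inner (V x) y = dotv x (Vs y) &
        forall i x, X i *m x = Vs (Y i (V x))].

Definition Wmin (K : set 'rV[R[i]]_d) : set matrix_tuple :=
  [set X : matrix_tuple |
     exists (L : hilbertType R) (N : 'I_d -> bop L),
       [/\ normal_tuple N, joint_spectrum N `<=` K & is_dilation N (projT2 X)]].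

(* Convexity in C^d is meant over the reals: t : {i01 R[i]} satisfies
   0 <= t <= 1 in R[i], which forces t to be real. *)
Definition polyhedron (K : set 'rV[R[i]]_d) : Prop :=
  exists2 P : set 'rV[R[i]]_d, finite_set P & K = smallest (@convex_set _ _) P.

Definition vertices (K : set 'rV[R[i]]_d) : set 'rV[R[i]]_d :=
  [set v | K v /\
    forall (x y : convex_lmodType 'rV[R[i]]_d) (t : {i01 R[i]}), K x -> K y ->
      0 < t%:num -> t%:num < 1 -> v = x <| t |> y -> x = v /\ y = v].

End MatrixRange.

Section ClosedSubspace.
Variables (R : realType) (H : hilbertType R).

Record closed_subspace := ClosedSubspace {
  csub_set : set H;
  csub_submod : submod_closed (mem csub_set : {pred H});
  csub_closed : closed csub_set
}.

Variable M : closed_subspace.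

Definition csub_mem : {pred H} := mem (csub_set M).

(* M as a Hilbert space, with the norm and inner product inherited from H. *)
Record csub_type := CSub { csub_val :> H; csub_valP : csub_val \in csub_mem }.

HB.instance Definition _ := [isSub for csub_val].
HB.instance Definition _ := [Choice of csub_type by <:].
HB.instance Definition _ :=
  GRing.isSubmodClosed.Build _ _ csub_mem (csub_submod M).
HB.instance Definition _ := [SubChoice_isSubLmodule of csub_type by <:].

Let csub_norm (x : csub_type) : R[i] := `|csub_val x|.

Let csub_normD x y : csub_norm (x + y) <= csub_norm x + csub_norm y.
Proof. exact: ler_normD. Qed.

Let csub_normZ (a : R[i]) x : csub_norm (a *: x) = `|a| * csub_norm x.
Proof. exact: normrZ. Qed.

Let csub_norm0 x : csub_norm x = 0 -> x = 0.
Proof. by move=> /normr0_eq0 x0; exact: val_inj. Qed.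

HB.instance Definition _ :=
  Lmodule_isNormed.Build R[i] csub_type csub_normD csub_normZ csub_norm0.

Lemma csub_complete (F : set_system csub_type) :
  ProperFilter F -> cauchy F -> cvg F.
Proof.
move=> FF /cauchy_ballP Fc.
have Gc : cauchy (csub_val @ F).
  apply/cauchy_ballP => e e0.
  have [[A B] /= [FA FB] AB] := Fc e e0.
  exists (csub_val @` A, csub_val @` B).
    by split; [apply: filterS FA|apply: filterS FB] => x Ax; exists x.
  move=> [_ _] /= [[x Ax <-] [y By <-]].
  by have := AB (x, y) (conj Ax By); rewrite -!ball_normE.
have /cvg_ex[l Fl] : cvg (csub_val @ F) by exact: cauchy_cvg.
have Ml : csub_set M l.
  refine (@closed_cvg _ _ F FF csub_val (csub_set M) (@csub_closed M) _ _ Fl).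
  by apply: nearW => x; exact: (set_mem (csub_valP x)).
apply/cvg_ex; exists (CSub (mem_set Ml)).
apply/cvgrPdist_lt => e e0.
by move/cvgrPdist_lt : Fl => /(_ e e0).
Qed.

HB.instance Definition _ := Uniform_isComplete.Build csub_type csub_complete.

Lemma csub_val_continuous : continuous csub_val.
Proof.
move=> x; apply/(@cvgrPdist_lt _ _ _ _ (nbhs_filter x)) => e e0.
by have := @nbhsx_ballx _ csub_type x e e0; rewrite -ball_normE.
Qed.

Definition csub_inner (x y : csub_type) : R[i] :=
  inner (csub_val x) (csub_val y).

Lemma csub_inner_bilinear :
  bilinear_for *%R (@Num.conj R[i] \; *%R) csub_inner.
Proof.
split=> z a x y; rewrite /csub_inner.
  by rewrite linearPl.
by rewrite linearPr.
Qed.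

HB.instance Definition _ :=
  bilinear_isBilinear.Build R[i] csub_type csub_type R[i] *%R
    (@Num.conj R[i] \; *%R) csub_inner csub_inner_bilinear.

Lemma csub_inner_hermitian (x y : csub_type) :
  csub_inner x y = (-1) ^+ false * (csub_inner y x)^*.
Proof. exact: hermitian_subproof. Qed.

HB.instance Definition _ :=
  isHermitianSesquilinear.Build R[i] csub_type false (@Num.conj R[i])
    csub_inner csub_inner_hermitian.

Lemma csub_inner_gt0 (x : csub_type) : x != 0 -> 0 < csub_inner x x.
Proof. by move=> x0; apply: neq0_dnorm_gt0. Qed.

HB.instance Definition _ :=
  isDotProduct.Build R[i] csub_type csub_inner csub_inner_gt0.

Lemma csub_inner_norm (x : csub_type) : csub_inner x x = `|x| ^+ 2.
Proof. exact: inner_norm. Qed.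

HB.instance Definition _ := isHilbert.Build R csub_type csub_inner_norm.

Section Restriction.
Variables (A : bop H) (MA : forall x, csub_set M x -> csub_set M (A x)).

Definition restr_fun (x : csub_type) : csub_type :=
  CSub (mem_set (MA (set_mem (csub_valP x)))).

Lemma restr_subproof : restr_fun \in @bounded_op R csub_type.
Proof.
apply/mem_set; split.
  by move=> a x y; apply: val_inj; rewrite /= (bop_linear A).
move=> x; apply/(@cvgrPdist_lt _ _ _ _ (nbhs_filter x)) => e e0.
have Ac : A (csub_val y) @[y --> x] --> A (csub_val x).
  apply: (@continuous_comp _ _ _ csub_val A); last exact: bop_continuous.
  exact: csub_val_continuous.
by move/(@cvgrPdist_lt _ _ _ _ (nbhs_filter x)) : Ac => /(_ e e0).
Qed.

Definition restr : bop csub_type := Bop restr_subproof.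
End Restriction.

End ClosedSubspace.

Section Minimality.
Variables (R : realType) (d : nat) (H : hilbertType R).

Definition invariant (S : set H) (A : bop H) : Prop :=
  forall x, S x -> S (A x).

Definition orthogonal_complement (S : set H) : set H :=
  [set x | forall y, S y -> inner x y = 0].

Record reducing (T : 'I_d -> bop H) (M : closed_subspace H) : Prop := {
  reducing_inv : forall i, invariant (csub_set M) (T i);
  reducing_orth :
    forall i, invariant (orthogonal_complement (csub_set M)) (T i)
}.

Definition minimal (T : 'I_d -> bop H) : Prop :=
  forall (M : closed_subspace H) (red : reducing T M),
    csub_set M <> setT ->
    matrix_range (fun i => restr (reducing_inv red i)) `<` matrix_range T.

End Minimality.

(* Main.v *)
(* Let v_0 = 0, v_1, ..., v_q be the vertices of K.  The tuples are
   T = sum_j v_j P_j with positive operators P_j summing to 1.  For j >= 1, P_j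
   fixes a unit vector e_(j-1) and kills the other e_(l-1); in addition P_1
   carries a compact diagonal operator B^2 and P_2 a rank one operator
   <., xi> xi, both supported on the span of the remaining basis vectors, and
   P_0 = 1 - P_1 - ... - P_q.

   The range of T consists of the tuples X = sum_j v_j F_j with positive
   semidefinite matrices F_j summing to 1: a UCP map sends P_j to such an F_j,
   and conversely each v_j is a joint eigenvalue of T, or, for v_0 = 0, a limit
   of joint states along the basis.  By Naimark such an X dilates to
   a diagonal tuple with joint spectrum in K, so it lies in W^min(K).  Conversely, if
   N is normal with joint spectrum in K, an affine matrix function
   Z + sum_i z_i Y_i positive on K stays positive when N is substituted for z:
   the bottom of the numerical range of the resulting operator matrix is attained
   asymptotically on joint eigenvectors of N, whose eigenvalues lie in the joint
   spectrum.  Separation from a closed cone then produces the F_j.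

   A projection commuting with T commutes with the real parts of all linear
   functionals of T; as B^2 has simple spectrum and <xi, e_k> <> 0, it is
   diagonal and contains all or none of the remaining basis vectors.  A proper
   reducing subspace therefore makes some P_j small, and its matrix range misses
   the extreme point v_j.  Finally one eigenvalue of B^2 is a free parameter that
   can be read off T. *)

Require Import Defs.
From HB Require Import structures.
From mathcomp Require Import all_boot all_order all_algebra.
From mathcomp Require Import cyclic separable cyclotomic perm.
From mathcomp Require Import complex.
From mathcomp Require Import all_classical all_reals all_analysis.
From mathcomp Require Import ring lra zify.

Set Implicit Arguments.
Unset Strict Implicit.
Unset Printing Implicit Defensive.

Import Order.TTheory GRing.Theory Num.Theory.
Import numFieldNormedType.Exports.

Local Open Scope classical_set_scope.
Local Open Scope ring_scope.

(** * Complex numbers and inner products *)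

(** Having three vertices, one of them the origin, matters twice. The coefficient v_0 = 0 makes T
    compact although P_0 is not, and it lets a finite diagonal dilation be padded by zeros on H. The
    vertices v_1, v_2 are not real multiples of each other, so real functionals can isolate B^2 and
    the rank one operator inside T. Without the latter every remaining basis vector would span a
    reducing line, and dropping one such line would not change the range. Both operators are at most
    1/4: this leaves P_0 at least 1/2 on the remaining basis vectors, and it keeps a P_j that has
    become small below the value 1 demanded by v_j. On the normal side only commutation of the N_i
    among themselves is assumed; Fuglede's theorem makes their real and imaginary parts commute.
    Joint eigenvectors need not exist, so approximate ones are turned into characters along a fixed
    free ultrafilter, which also supplies the limits of states and the minimizer needed to separate
    from the cone. *)

Section ComplexFacts.
Variable R : realType.
Implicit Types a b : R[i].

Definition cabs a : R := complex.Re `|a|.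

Lemma ReD a b : complex.Re (a + b) = complex.Re a + complex.Re b.
Proof. by case: a b => x y [z t]. Qed.
Lemma ReN a : complex.Re (- a) = - complex.Re a.
Proof. by case: a. Qed.
Lemma ReB a b : complex.Re (a - b) = complex.Re a - complex.Re b.
Proof. by rewrite ReD ReN. Qed.
Lemma ReC a : complex.Re (a^* : R[i]) = complex.Re a.
Proof. by case: a. Qed.
Lemma ReM a b :
  complex.Re (a * b) = complex.Re a * complex.Re b - complex.Im a * complex.Im b.
Proof. by case: a b => x y [z t]. Qed.
Lemma ReZ (x : R) b : complex.Re (x%:C%C * b) = x * complex.Re b.
Proof. by rewrite ReM /= mul0r subr0. Qed.
Lemma Re_sum I (r : seq I) (P : pred I) (F : I -> R[i]) :
  complex.Re (\sum_(i <- r | P i) F i) = \sum_(i <- r | P i) complex.Re (F i).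
Proof. by elim/big_rec2: _ => //= i x y _ <-; rewrite ReD. Qed.

Lemma cabsE a : `|a| = (cabs a)%:C%C.
Proof. by rewrite /cabs normc_def. Qed.
Lemma cabs_ge0 a : 0 <= cabs a.
Proof. by rewrite -ler0c -cabsE. Qed.
Lemma cabsM a b : cabs (a * b) = cabs a * cabs b.
Proof. by apply: complexI; rewrite -cabsE normrM !cabsE rmorphM. Qed.
Lemma cabsN a : cabs (- a) = cabs a.
Proof. by rewrite /cabs normrN. Qed.
Lemma cabsC a : cabs (a^*) = cabs a.
Proof. by rewrite /cabs norm_conjC. Qed.
Lemma cabsD a b : cabs (a + b) <= cabs a + cabs b.
Proof. by rewrite -lecR rmorphD /= -!cabsE ler_normD. Qed.
Lemma cabs_eq0 a : (cabs a == 0) = (a == 0).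
Proof. by rewrite -(inj_eq (@complexI R)) -cabsE normr_eq0. Qed.
Lemma cabs0 : cabs 0 = 0. Proof. by apply/eqP; rewrite cabs_eq0. Qed.
Lemma cabsR (x : R) : cabs x%:C%C = `|x|.
Proof. by rewrite /cabs normc_def /= expr0n addr0 sqrtr_sqr. Qed.
Lemma cabs1 : cabs 1 = 1. Proof. by rewrite /cabs normr1. Qed.
Lemma cabsX a n : cabs (a ^+ n) = cabs a ^+ n.
Proof. by elim: n => [|n IH]; rewrite ?expr0 ?cabs1// !exprS cabsM IH. Qed.
Lemma mul_conjE a : a * a^* = (cabs a ^+ 2)%:C%C.
Proof. by rewrite -normCK cabsE rmorphXn. Qed.
Lemma cabs2E a : cabs a ^+ 2 = complex.Re a ^+ 2 + complex.Im a ^+ 2.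
Proof. by apply: complexI; rewrite add_Re2_Im2 cabsE rmorphXn. Qed.
Lemma Re_le_cabs a : `|complex.Re a| <= cabs a.
Proof. by rewrite -lecR -cabsE normc_ge_Re. Qed.
Lemma Im_le_cabs a : `|complex.Im a| <= cabs a.
Proof.
rewrite -(@ler_pXn2r _ 2) ?nnegrE ?cabs_ge0// cabs2E real_normK ?num_real//.
by rewrite lerDr sqr_ge0.
Qed.
Lemma cabs_sum I (r : seq I) (P : pred I) (F : I -> R[i]) :
  cabs (\sum_(i <- r | P i) F i) <= \sum_(i <- r | P i) cabs (F i).
Proof.
elim/big_rec2: _ => [|i x y _ le]; first by rewrite cabs0.
by apply: le_trans (cabsD _ _) _; rewrite lerD2l.
Qed.
Lemma ge0_ReE a : 0 <= a -> a = (complex.Re a)%:C%C.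
Proof. by move=> a0; rewrite RRe_real // ger0_real. Qed.
Lemma ge0_Re a : 0 <= a -> 0 <= complex.Re a.
Proof. by move=> a0; rewrite -ler0c -ge0_ReE. Qed.

End ComplexFacts.

Section HilbertFacts.
Variables (R : realType) (H : hilbertType R).
Implicit Types (x y z : H) (a : R[i]).

Definition hsq x : R := complex.Re (inner x x).
Definition hnm x : R := Num.sqrt (hsq x).

Lemma ipDl x y z : inner (x + y) z = inner x z + inner y z.
Proof. exact: linearDl. Qed.
Lemma ipDr x y z : inner x (y + z) = inner x y + inner x z.
Proof. exact: linearDr. Qed.
Lemma ipNr x y : inner x (- y) = - inner x y. Proof. exact: linearNr. Qed.
Lemma ipBl x y z : inner (x - y) z = inner x z - inner y z.
Proof. exact: linearBl. Qed.
Lemma ipBr x y z : inner x (y - z) = inner x y - inner x z.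
Proof. exact: linearBr. Qed.
Lemma ipZl a x y : inner (a *: x) y = a * inner x y.
Proof. by rewrite linearZl_LR. Qed.
Lemma ipZr a x y : inner x (a *: y) = a^* * inner x y.
Proof. by rewrite linearZr_LR. Qed.
Lemma ip0l x : inner 0 x = 0. Proof. exact: linear0l. Qed.
Lemma ip0r x : inner x 0 = 0. Proof. exact: linear0r. Qed.
Lemma ipC x y : inner x y = (inner y x)^*.
Proof. by rewrite hermC expr0 mul1r. Qed.
Lemma ip_suml I (r : seq I) (P : pred I) (F : I -> H) y :
  inner (\sum_(i <- r | P i) F i) y = \sum_(i <- r | P i) inner (F i) y.
Proof. by rewrite linear_sumlz. Qed.
Lemma ip_sumr I (r : seq I) (P : pred I) (F : I -> H) y :
  inner y (\sum_(i <- r | P i) F i) = \sum_(i <- r | P i) inner y (F i).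
Proof. by rewrite linear_sumr. Qed.

Lemma ip_ge0 x : 0 <= inner x x.
Proof. by rewrite inner_norm exprn_ge0. Qed.
Lemma hsqE x : inner x x = (hsq x)%:C%C.
Proof. by rewrite {1}(ge0_ReE (ip_ge0 x)). Qed.
Lemma hsq_ge0 x : 0 <= hsq x.
Proof. exact: ge0_Re (ip_ge0 x). Qed.
Lemma hnm_ge0 x : 0 <= hnm x. Proof. exact: sqrtr_ge0. Qed.
Lemma hnm2 x : hnm x ^+ 2 = hsq x.
Proof. by rewrite sqr_sqrtr // hsq_ge0. Qed.
Lemma normhE x : `|x| = (hnm x)%:C%C.
Proof.
apply/eqP; rewrite -(@eqrXn2 _ 2) // ?ler0c ?hnm_ge0 //.
by rewrite -inner_norm hsqE -hnm2 rmorphXn.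
Qed.
Lemma hnm_eq0 x : (hnm x == 0) = (x == 0).
Proof. by rewrite -(inj_eq (@complexI R)) -normhE normr_eq0. Qed.
Lemma hsq_eq0 x : (hsq x == 0) = (x == 0).
Proof. by rewrite -hnm2 expf_eq0 /= hnm_eq0. Qed.
Lemma hnm0 : hnm (0 : H) = 0. Proof. by apply/eqP; rewrite hnm_eq0. Qed.
Lemma hnmD x y : hnm (x + y) <= hnm x + hnm y.
Proof. by rewrite -lecR rmorphD /= -!normhE ler_normD. Qed.
Lemma hnmZ a x : hnm (a *: x) = cabs a * hnm x.
Proof. by apply: complexI; rewrite rmorphM /= -normhE -cabsE -normhE normrZ. Qed.
Lemma hnmN x : hnm (- x) = hnm x.
Proof. by apply: complexI; rewrite -!normhE normrN. Qed.
Lemma hnmB x y : hnm (x - y) <= hnm x + hnm y.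
Proof. by apply: le_trans (hnmD _ _) _; rewrite hnmN. Qed.
Lemma hdistC x y : hnm (x - y) = hnm (y - x).
Proof. by rewrite -hnmN opprB. Qed.
Lemma hnm_sum I (r : seq I) (P : pred I) (F : I -> H) :
  hnm (\sum_(i <- r | P i) F i) <= \sum_(i <- r | P i) hnm (F i).
Proof.
elim/big_rec2: _ => [|i x y _ le]; first by rewrite hnm0.
by apply: le_trans (hnmD _ _) _; rewrite lerD2l.
Qed.
Lemma hsqZ a x : hsq (a *: x) = cabs a ^+ 2 * hsq x.
Proof. by rewrite -!hnm2 hnmZ exprMn. Qed.
Lemma hsqN x : hsq (- x) = hsq x. Proof. by rewrite -!hnm2 hnmN. Qed.
Lemma hsqD x y : hsq (x + y) = hsq x + hsq y + 2 * complex.Re (inner x y).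
Proof.
by rewrite /hsq ipDl !ipDr !ReD [inner y x]ipC ReC; ring.
Qed.
Lemma hsqB x y : hsq (x - y) = hsq x + hsq y - 2 * complex.Re (inner x y).
Proof. by rewrite hsqD hsqN ipNr ReN mulrN. Qed.

Lemma re_cauchy_schwarz x y : complex.Re (inner x y) <= hnm x * hnm y.
Proof.
have [->|y0] := eqVneq y 0; first by rewrite ip0r hnm0 mulr0.
have hy : 0 < hnm y by rewrite lt_neqAle hnm_ge0 andbT eq_sym hnm_eq0.
have [->|x0] := eqVneq x 0; first by rewrite ip0l hnm0 mul0r.
have hx : 0 < hnm x by rewrite lt_neqAle hnm_ge0 andbT eq_sym hnm_eq0.
have := hsq_ge0 ((hnm y)%:C%C *: x - (hnm x)%:C%C *: y).
rewrite hsqB !hsqZ !cabsR !ger0_norm ?hnm_ge0// -!hnm2 ipZl ipZr.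
rewrite (_ : _^* = (hnm x)%:C%C); last exact: conjc_real.
rewrite !ReZ => h.
have /(mulr_gt0 hx) hxy := hy.
rewrite -(ler_pM2l hxy); nra.
Qed.

Lemma cauchy_schwarz x y : cabs (inner x y) <= hnm x * hnm y.
Proof.
have [->|a0] := eqVneq (inner x y) 0; first by rewrite cabs0 mulr_ge0 ?hnm_ge0.
have ca : 0 < cabs (inner x y) by rewrite lt_neqAle cabs_ge0 andbT eq_sym cabs_eq0.
have := re_cauchy_schwarz x (inner x y *: y).
by rewrite ipZr mulrC mul_conjE hnmZ /= expr2 mulrCA ler_pM2l.
Qed.

Lemma ip_eq0 x : (forall y, inner x y = 0) -> x = 0.
Proof.
by move=> /(_ x) h; apply/eqP; rewrite -hsq_eq0 /hsq h.
Qed.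

End HilbertFacts.

(** * Bounded operators and projections *)

Section Interface.
Variables (R : realType) (H : hilbertType R).
Implicit Types (x y z : H) (a : R[i]) (A B : bop H).

Definition hlim (u : nat -> H) (l : H) : Prop :=
  forall e : R, 0 < e -> exists N, forall n, (N <= n)%N -> hnm (u n - l) < e.

Lemma hlimP (u : nat -> H) (l : H) : hlim u l <-> (u @ \oo --> l).
Proof.
split=> [ul|/cvgrPdist_lt ul e e0].
  apply/cvgrPdist_lt => e e0.
  have eE : e = (complex.Re e)%:C%C by apply: ge0_ReE; exact: ltW.
  have [|N hN] := ul (complex.Re e); first by rewrite -(ltcR 0) -eE.
  exists N => // n /= Nn; rewrite normhE eE ltcR -hnmN opprB; exact: hN.
have [N _ hN] := ul e%:C%C (etrans (ltcR 0 e) e0).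
exists N => n Nn; have := hN n Nn.
by rewrite /= normhE ltcR -hnmN opprB.
Qed.

Lemma hilbert_complete (u : nat -> H) :
  (forall e : R, 0 < e -> exists N, forall n m, (N <= n)%N -> (N <= m)%N ->
     hnm (u n - u m) < e) -> exists l, hlim u l.
Proof.
move=> uc; have : cvg (u @ \oo).
  apply/cauchy_cvgP/cauchy_ballP => e e0.
  have eE : e = (complex.Re e)%:C%C by apply: ge0_ReE; exact: ltW.
  have [|N hN] := uc (complex.Re e); first by rewrite -(ltcR 0) -eE.
  exists ([set x | exists2 n, (N <= n)%N & x = u n],
          [set x | exists2 n, (N <= n)%N & x = u n]).
    by split; exists N => // n Nn; exists n.
  move=> [_ _] /= [[n Nn ->] [m Nm ->]].
  by rewrite -ball_normE /= normhE eE ltcR hN.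
by move=> /cvg_ex[l /hlimP ul]; exists l.
Qed.

Lemma closed_hlim (M : set H) (u : nat -> H) l :
  closed M -> (forall n, M (u n)) -> hlim u l -> M l.
Proof.
move=> Mc Mu /hlimP ul.
by refine (@closed_cvg _ _ _ _ u M Mc _ _ ul); apply: nearW.
Qed.

Lemma hlim_le (u : nat -> H) l x (c : R) :
  hlim u l -> (forall n, hnm (u n - x) <= c) -> hnm (l - x) <= c.
Proof.
move=> ul uc; apply/ler_addgt0Pr => e e0.
have [N hN] := ul e e0.
rewrite (_ : l - x = (u N - x) - (u N - l)); last by rewrite opprB [RHS]addrC addrA subrK.
by apply: le_trans (hnmB _ _) _; rewrite lerD // ltW // hN.
Qed.

Lemma hlim_ip (u : nat -> H) l x (e : R) : hlim u l -> 0 < e ->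
  exists N, forall n, (N <= n)%N -> cabs (inner (u n) x - inner l x) < e.
Proof.
move=> ul e0; have h1 : 0 < hnm x + 1 by rewrite ltr_wpDl ?hnm_ge0.
have [|N hN] := ul (e / (hnm x + 1)); first by rewrite divr_gt0.
exists N => n Nn; rewrite -ipBl; apply: le_lt_trans (cauchy_schwarz _ _) _.
have := hN n Nn; rewrite ltr_pdivlMr // => h; apply: le_lt_trans h.
by rewrite ler_wpM2l ?hnm_ge0// lerDl.
Qed.

Lemma bopD A x y : A (x + y) = A x + A y.
Proof. by have := bop_linear A 1 x y; rewrite !scale1r. Qed.
Lemma bop0 A : A 0 = 0.
Proof.
have := bopD A 0 0; rewrite addr0 => /eqP.
by rewrite -subr_eq0 opprD addNKr oppr_eq0 => /eqP.
Qed.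
Lemma bopZ A a x : A (a *: x) = a *: A x.
Proof. by have := bop_linear A a x 0; rewrite addr0 bop0 addr0. Qed.
Lemma bopN A x : A (- x) = - A x.
Proof. by rewrite -scaleN1r bopZ scaleN1r. Qed.
Lemma bopB A x y : A (x - y) = A x - A y.
Proof. by rewrite bopD bopN. Qed.
Lemma bop_sum A I (r : seq I) (P : pred I) (F : I -> H) :
  A (\sum_(i <- r | P i) F i) = \sum_(i <- r | P i) A (F i).
Proof. by elim/big_rec2: _ => [|i x y _ <-]; rewrite ?bop0 ?bopD. Qed.
Lemma add_bopE A B x : (A + B) x = A x + B x. Proof. by []. Qed.
Lemma sub_bopE A B x : (A - B) x = A x - B x. Proof. by []. Qed.
Lemma scale_bopE a A x : (a *: A) x = a *: A x. Proof. by []. Qed.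
Lemma zero_bopE x : (0 : bop H) x = 0. Proof. by []. Qed.
Lemma sum_bopE I (r : seq I) (P : pred I) (F : I -> bop H) x :
  (\sum_(i <- r | P i) F i) x = \sum_(i <- r | P i) F i x.
Proof. by elim/big_rec2: _ => [|i y B _ <-]. Qed.
Lemma bop1E x : bop1 H x = x. Proof. by []. Qed.
Lemma bopME A B x : bopM A B x = A (B x). Proof. by []. Qed.

Lemma bopP A B : A =1 B -> A = B.
Proof. by move=> AB; apply: val_inj; apply/funext => x; exact: AB. Qed.

Lemma bop_bounded A : exists2 c : R, 0 <= c & forall x, hnm (A x) <= c * hnm x.
Proof.
have lA := bop_linear A.
pose LA := @GRing.isLinear.Build _ _ _ _ _ lA.
pose f : {linear H -> H} := HB.pack (A : H -> H) LA.
have : continuous f by exact: bop_continuous.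
move=> /linear_bounded_continuous /linear_boundedP [M [Mr hM]].
pose c := `|complex.Re M| + 1.
exists c => [|x]; first by rewrite addr_ge0.
have Mc : M < c%:C%C.
  have /complex_realP [m mE] := Mr; rewrite /c mE ltcR /=.
  by rewrite (le_lt_trans (ler_norm m)) // ltrDl.
by have := hM _ Mc x; rewrite !normhE -rmorphM lecR.
Qed.

Lemma bounded_op_intro (f : H -> H) (c : R) : linear f ->
  (forall x, hnm (f x) <= c * hnm x) -> f \in @bounded_op R H.
Proof.
move=> lf fc; apply/mem_set; split => // x.
pose LA := @GRing.isLinear.Build _ _ _ _ _ lf.
pose g : {linear H -> H} := HB.pack f LA.
suff : continuous g by exact.
apply/linear_bounded_continuous/linear_boundedP.
exists c%:C%C; split; first by apply/complex_realP; exists c.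
move=> M cM y; rewrite normhE (le_trans (y := (c * hnm y)%:C%C)) ?lecR ?fc//.
by rewrite rmorphM /= -normhE ler_wpM2r // ltW.
Qed.

Definition mk_bop (f : H -> H) (c : R) (lf : linear f)
  (fc : forall x, hnm (f x) <= c * hnm x) : bop H := Bop (bounded_op_intro lf fc).

Lemma is_adjoint_sym A B : is_adjoint A B -> is_adjoint B A.
Proof. by move=> h x y; rewrite ipC -h -ipC. Qed.

Lemma is_adjoint_unique A B C : is_adjoint A B -> is_adjoint A C -> B = C.
Proof.
move=> hB hC; apply: bopP => y; apply/eqP; rewrite -subr_eq0; apply/eqP.
by apply: ip_eq0 => x; rewrite ipC ipBr -hB -hC subrr conjC0.
Qed.

End Interface.

Section Projection.
Variables (R : realType) (H : hilbertType R) (M : closed_subspace H).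
Implicit Types (x y z : H).

Lemma csub0 : csub_set M 0.
Proof. by have [/set_mem] := csub_submod M. Qed.
Lemma csubP (a : R[i]) x y : csub_set M x -> csub_set M y -> csub_set M (a *: x + y).
Proof.
by have [_ h] := csub_submod M; move=> Mx My; apply/set_mem/h; apply/mem_set.
Qed.
Lemma csubZ (a : R[i]) x : csub_set M x -> csub_set M (a *: x).
Proof. by move=> Mx; rewrite -[_ *: _]addr0; apply: csubP => //; exact: csub0. Qed.
Lemma csubD x y : csub_set M x -> csub_set M y -> csub_set M (x + y).
Proof. by move=> Mx My; rewrite -[x]scale1r; apply: csubP. Qed.
Lemma csubB x y : csub_set M x -> csub_set M y -> csub_set M (x - y).
Proof. by move=> Mx My; rewrite addrC -scaleN1r; apply: csubP. Qed.

Let dists x : set R := [set hsq (x - y) | y in csub_set M].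

Let dists_inf x : has_inf (dists x).
Proof.
split; first by exists (hsq (x - 0)); exists 0 => //; exact: csub0.
by exists 0 => _ [y _ <-]; exact: hsq_ge0.
Qed.

Lemma parallelogram x y : hsq (x + y) + hsq (x - y) = 2 * hsq x + 2 * hsq y.
Proof. rewrite hsqB hsqD; ring. Qed.

(** The parallelogram law makes a minimizing sequence for the distance Cauchy, and at its limit the
    first variation in each direction y vanishes. *)
Lemma projection_exists x :
  exists2 p, csub_set M p & forall y, csub_set M y -> inner (x - p) y = 0.
Proof.
pose dlt := inf (dists x).
have dltP y : csub_set M y -> dlt <= hsq (x - y).
  by move=> My; apply: ge_inf; [have [] := dists_inf x|exists y].
have /choice [u uP] : forall n, exists y, csub_set M y /\
    hsq (x - y) < dlt + n.+1%:R^-1.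
  move=> n; have [|_ [y My <-] h] := @inf_adherent _ (dists x) n.+1%:R^-1 _ (dists_inf x).
    by rewrite invr_gt0.
  by exists y.
have uD n m : hsq (u n - u m) <= 2 * n.+1%:R^-1 + 2 * m.+1%:R^-1.
  have [[Mn hn] [Mm hm]] := (uP n, uP m).
  have := parallelogram (x - u m) (x - u n).
  rewrite (_ : x - u m - _ = u n - u m); last first.
    by rewrite opprB addrC addrA subrK.
  rewrite (_ : x - u m + _ = (2%:R : R)%:C%C *: (x - (2^-1 : R)%:C%C *: (u m + u n))); last first.
    rewrite scalerBr scalerA -rmorphM /= divff ?pnatr_eq0// scale1r.
    by rewrite rmorph_nat scaler_nat mulr2n addrACA opprD.
  rewrite hsqZ cabsR ger0_norm //.
  have := dltP ((2^-1 : R)%:C%C *: (u m + u n)) (csubZ _ (csubD Mm Mn)).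
  move: (n.+1%:R^-1) (m.+1%:R^-1) hn hm => i j hn hm.
  by set q := hsq (x - _ *: _); lra.
have [e e0|p up] := @hilbert_complete _ _ u.
  have [N hN] : exists N : nat, N.+1%:R^-1 * 4 < e ^+ 2.
    have [N] := @ltr_add_invr R 0 (e ^+ 2 / 4) (divr_gt0 (exprn_gt0 2 e0) (ltr0n _ 4)).
    by rewrite add0r ltr_pdivlMr // => h; exists N.
  exists N => n m Nn Nm.
  rewrite -(@ltr_pXn2r _ 2) ?nnegrE ?hnm_ge0 ?(ltW e0)// hnm2.
  apply: le_lt_trans (uD _ _) (le_lt_trans _ hN).
  have hi k : (N <= k)%N -> k.+1%:R^-1 <= N.+1%:R^-1 :> R.
    by move=> Nk; rewrite lef_pV2 ?posrE// ler_nat ltnS.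
  move: (hi _ Nn) (hi _ Nm).
  by move: (N.+1%:R^-1) (n.+1%:R^-1) (m.+1%:R^-1) => i j k; lra.
have Mp : csub_set M p.
  by apply: closed_hlim up => [|n]; [exact: csub_closed|have [] := uP n].
exists p => // y My.
have xp : hsq (x - p) <= dlt.
  have hd : hnm (x - p) <= Num.sqrt dlt.
    apply/ler_addgt0Pr => e e0.
    have s0 := sqrtr_ge0 dlt.
    have d0 : 0 <= dlt.
      by apply: lb_le_inf; [have [] := dists_inf x|move=> _ [z _ <-]; exact: hsq_ge0].
    have [N1 hN1] := up _ (divr_gt0 e0 (ltr0n _ 2)).
    have e4 : 0 < (e / 2) ^+ 2 by rewrite exprn_gt0 // divr_gt0.
    have [N2] := @ltr_add_invr R 0 ((e / 2) ^+ 2) e4; rewrite add0r => hN2.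
    pose n := maxn N1 N2.
    have h1 := hN1 n (leq_maxl _ _).
    have h2 : hnm (x - u n) < Num.sqrt dlt + e / 2.
      rewrite -(@ltr_pXn2r _ 2) ?nnegrE ?hnm_ge0 ?addr_ge0 ?(ltW (divr_gt0 e0 _))//.
      rewrite hnm2; apply: lt_trans (proj2 (uP n)) _.
      have : n.+1%:R^-1 <= N2.+1%:R^-1 :> R.
        by rewrite lef_pV2 ?posrE// ler_nat ltnS leq_maxr.
      have := sqr_sqrtr d0; rewrite sqrrD.
      by move: hN2; move: (N2.+1%:R^-1) (n.+1%:R^-1) => i j; nra.
    rewrite (_ : x - p = (x - u n) + (u n - p)); last by rewrite addrA subrK.
    apply: le_trans (hnmD _ _) _; lra.
  rewrite -hnm2; have d0 : 0 <= dlt.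
    by apply: lb_le_inf; [have [] := dists_inf x|move=> _ [z _ <-]; exact: hsq_ge0].
  by rewrite -(sqr_sqrtr d0) ler_pXn2r ?nnegrE ?hnm_ge0 ?sqrtr_ge0.
set w := inner (x - p) y.
have key (t : R) : 0 <= - 2 * t * cabs w ^+ 2 + t ^+ 2 * cabs w ^+ 2 * hsq y.
  have := dltP (p + (t%:C%C * w) *: y) (csubD Mp (csubZ _ My)).
  rewrite opprD addrA hsqB hsqZ cabsM cabsR exprMn real_normK ?num_real//.
  rewrite ipZr -/w rmorphM /=.
  rewrite (_ : (_ ^* : R[i]) = t%:C%C); last exact: conjc_real.
  rewrite -mulrA ReZ [_ * w]mulrC mul_conjE /=.
  lra.
have hy := hsq_ge0 y; have cw := cabs_ge0 w.
apply/eqP; rewrite -cabs_eq0; apply/eqP.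
(* With this [t] one has t |y|^2 = 1 - t, and the variation becomes - |w|^2 t (1 + t), which is
   nonnegative only if w = 0. *)
have := key (1 + hsq y)^-1.
set t := (1 + hsq y)^-1.
have t0 : 0 < t by rewrite invr_gt0 ltr_wpDr.
have tE : t * (1 + hsq y) = 1 by rewrite mulVf // lt0r_neq0 // ltr_wpDr.
rewrite (_ : _ + _ = - (cabs w ^+ 2 * t * (1 + t))); last first.
  have tE' : t * hsq y = 1 - t by lra.
  rewrite (_ : t ^+ 2 * _ * _ = cabs w ^+ 2 * t * (t * hsq y)); last by ring.
  by rewrite tE'; ring.
move=> h; have : cabs w ^+ 2 * t * (1 + t) <= 0 by rewrite -oppr_ge0.
rewrite pmulr_lle0 ?ltr_wpDl ?(ltW t0)// pmulr_lle0 // => h2.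
by apply/eqP; rewrite -sqrf_eq0; apply/eqP/le_anti; rewrite h2 sqr_ge0.
Qed.

End Projection.

(** * Limits along ultrafilters *)

Section UltraLimits.
Variables (R : realType) (T : Type) (F : set_system T).
Hypothesis FU : UltraFilter F.
Implicit Types (f g : T -> R[i]) (l m : R[i]).

Let FF : ProperFilter F := @ultra_proper _ _ FU.
#[local] Existing Instance FF.

Definition uconv f l : Prop := forall e : R, 0 < e -> F [set t | cabs (f t - l) < e].

(** Real and imaginary parts stay in the compact segment [-c, c], where an ultrafilter converges as
    soon as it clusters. *)
Lemma uconv_bounded f (c : R) : F [set t | cabs (f t) <= c] -> exists l, uconv f l.
Proof.
move=> fc.
have real_case (h : T -> R) : F [set t | `|h t| <= c] ->
    exists p : R, forall e, 0 < e -> F [set t | `|h t - p| < e].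
  move=> hc.
  have [|p [_ hp]] := @segment_compact R (- c) c (h @ F) _.
    suff : F (h @^-1` `[- c, c]) by [].
    by apply: filterS hc => t ht; rewrite /= in_itv /= -ler_norml.
  exists p => e e0.
  have [//|nF] := in_ultra_setVsetC [set t | `|h t - p| < e] FU.
  have [|x [/= xn]] := hp (~` ball p e) _ _ (nbhsx_ballx p e e0); last by [].
  apply: filterS nF => t /=; rewrite -ball_normE /= distrC.
  exact.
have [|p hp] := real_case (fun t => complex.Re (f t)).
  by apply: filterS fc => t; apply: le_trans; exact: Re_le_cabs.
have [|q hq] := real_case (fun t => complex.Im (f t)).
  by apply: filterS fc => t; apply: le_trans; exact: Im_le_cabs.
exists (p +i* q)%C => e e0.
have e2 : 0 < e / 2 by rewrite divr_gt0.
apply: filterS (filterI (hp _ e2) (hq _ e2)) => t /= [h1 h2].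
rewrite -(@ltr_pXn2r _ 2) ?nnegrE ?cabs_ge0 ?(ltW e0)// cabs2E.
have -> : complex.Re (f t - (p +i* q)%C) = complex.Re (f t) - p.
  by rewrite ReB.
have -> : complex.Im (f t - (p +i* q)%C) = complex.Im (f t) - q.
  by case: (f t).
rewrite -(@ltr_pXn2r _ 2) ?nnegrE ?normr_ge0 ?(ltW e2)// real_normK ?num_real// in h1.
rewrite -(@ltr_pXn2r _ 2) ?nnegrE ?normr_ge0 ?(ltW e2)// real_normK ?num_real// in h2.
have := sqr_ge0 e.
rewrite !exprMn in h1 h2; lra.
Qed.

Lemma uconv_unique f l m : uconv f l -> uconv f m -> l = m.
Proof.
move=> fl fm; apply/eqP; rewrite -subr_eq0 -cabs_eq0; apply: contraT => lm.
have d0 : 0 < cabs (l - m) / 2 by rewrite divr_gt0 // lt_neqAle eq_sym lm cabs_ge0.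
have [t /= [h1 h2]] := filter_ex (filterI (fl _ d0) (fm _ d0)).
have := cabsD (f t - m) (- (f t - l)); rewrite cabsN.
rewrite (_ : f t - m - _ = l - m); last by rewrite opprB [LHS]addrC addrA subrK.
lra.
Qed.

Lemma uconv_le f l (b : R) : uconv f l -> F [set t | cabs (f t) <= b] -> cabs l <= b.
Proof.
move=> fl fb; apply/ler_addgt0Pr => e e0.
have [t /= [h1 h2]] := filter_ex (filterI (fl _ e0) fb).
have := cabsD (f t) (- (f t - l)); rewrite cabsN opprB addrC subrK; lra.
Qed.

Lemma uconv_cst l : uconv (fun=> l) l.
Proof. by move=> e e0; apply: filterE => t; rewrite /= subrr cabs0. Qed.

Lemma uconvD f g l m : uconv f l -> uconv g m -> uconv (fun t => f t + g t) (l + m).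
Proof.
move=> fl gm e e0; have e2 : 0 < e / 2 by rewrite divr_gt0.
apply: filterS (filterI (fl _ e2) (gm _ e2)) => t /= [h1 h2].
by rewrite opprD addrACA; apply: le_lt_trans (cabsD _ _) _; lra.
Qed.

Lemma uconvM f g l m : uconv f l -> uconv g m -> uconv (fun t => f t * g t) (l * m).
Proof.
move=> fl gm e e0.
have h1 : 0 < 1 + cabs l + cabs m by have := cabs_ge0 l; have := cabs_ge0 m; lra.
pose d := Num.min 1 (e / (1 + cabs l + cabs m)).
have d0 : 0 < d by rewrite /d lt_min ltr01 divr_gt0.
have d1 : d <= 1 by rewrite /d ge_min lexx.
have de : d * (1 + cabs l + cabs m) <= e.
  by rewrite -ler_pdivlMr // /d ge_min lexx orbT.
apply: filterS (filterI (fl _ d0) (gm _ d0)) => t /= [hf hg].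
rewrite (_ : _ - _ = (f t - l) * (g t - m) + l * (g t - m) + (f t - l) * m); last by ring.
apply: le_lt_trans (cabsD _ _) _.
apply: le_lt_trans (lerD (cabsD _ _) (lexx _)) _; rewrite !cabsM.
apply: lt_le_trans de.
have a0 := cabs_ge0 (f t - l); have b0 := cabs_ge0 (g t - m).
have := cabs_ge0 l; have := cabs_ge0 m.
set x := cabs (f t - l) in hf a0 *; set y := cabs (g t - m) in hg b0 *.
set p := cabs l; set q := cabs m => q0 p0.
have : x * y < d by apply: le_lt_trans hf; rewrite -[leRHS]mulr1 ler_wpM2l//; lra.
have : p * y <= p * d by rewrite ler_wpM2l // ltW.
have : x * q <= d * q by rewrite ler_wpM2r // ltW.
lra.
Qed.

Lemma uconvZ f l m : uconv f l -> uconv (fun t => m * f t) (m * l).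
Proof. by move=> fl; apply: uconvM => //; exact: uconv_cst. Qed.

Lemma uconvB f g l m : uconv f l -> uconv g m -> uconv (fun t => f t - g t) (l - m).
Proof.
move=> fl gm; apply: uconvD => // e e0; apply: filterS (gm _ e0) => t /=.
by rewrite -opprD cabsN.
Qed.

Lemma uconvC f l : uconv f l -> uconv (fun t => (f t)^*) l^*.
Proof.
by move=> fl e e0; apply: filterS (fl _ e0) => t /=; rewrite -rmorphB cabsC.
Qed.



Lemma uconv_sum (I : Type) (r : seq I) (f : I -> T -> R[i]) (l : I -> R[i]) :
  (forall i, uconv (f i) (l i)) ->
  uconv (fun t => \sum_(i <- r) f i t) (\sum_(i <- r) l i).
Proof.
move=> h; elim: r => [|i r IH].
  rewrite big_nil (_ : (fun t => _) = fun=> 0); first exact: uconv_cst.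
  by apply/funext => t; rewrite big_nil.
rewrite big_cons (_ : (fun t => _) = fun t => f i t + \sum_(j <- r) f j t).
  exact: uconvD.
by apply/funext => t; rewrite big_cons.
Qed.

Lemma uconv_ge0 f l : uconv f l -> (forall t, 0 <= f t) -> 0 <= l.
Proof.
move=> fl f0; rewrite lecE /=; apply/andP; split; last first.
  rewrite leNgt; apply/negP => rl.
  have [t /=] := filter_ex (fl _ (etrans (oppr_gt0 _) rl)).
  rewrite ltNge => /negP; apply; apply: le_trans (Re_le_cabs _).
  rewrite ReB ger0_norm ?lerDr ?ge0_Re//.
  by have := ge0_Re (f0 t); lra.
apply/eqP/eqP; rewrite -normr_le0; apply/ler_addgt0Pr => e e0; rewrite add0r.
have [t /=] := filter_ex (fl _ e0); move=> /ltW; apply: le_trans.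
apply: le_trans (Im_le_cabs _); rewrite (ge0_ReE (f0 t)).
by case: l {fl} => x y /=; rewrite sub0r normrN.
Qed.

(** The default 0 is taken only when there is no limit; [ulimP] excludes this for bounded functions,
    so limits of vector states are defined on all of B(H) at once. *)
Definition ulim f : R[i] := xget 0 [set l | uconv f l].

Lemma ulimP f (c : R) : (forall t, cabs (f t) <= c) -> uconv f (ulim f).
Proof.
move=> fc; have [|l fl] := @uconv_bounded f c; first exact: filterE.
by rewrite /ulim; case: xgetP => [m -> //|/(_ l)].
Qed.

Lemma ulimE f l : uconv f l -> ulim f = l.
Proof.
move=> fl; rewrite /ulim; case: xgetP => [m _ fm|/(_ l)//].
exact: uconv_unique fm fl.
Qed.

End UltraLimits.

Section NatUltra.
Lemma nat_ultra_exists : exists F : set_system nat, UltraFilter F /\ \oo `<=` F.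
Proof.
by have [G [GU sFG]] := @ultraFilterLemma _ (\oo : set_system nat) _; exists G.
Qed.
(** One free ultrafilter serves for all limits of sequences: ordinary limits pass to it by
    [uconv_lim], and every bounded scalar sequence converges along it. *)
Definition nat_ultra : set_system nat := sval (cid nat_ultra_exists).
Lemma nat_ultraP : UltraFilter nat_ultra.
Proof. by rewrite /nat_ultra; case: cid => F []. Qed.
Lemma nat_ultra_oo : \oo `<=` nat_ultra.
Proof. by rewrite /nat_ultra; case: cid => F []. Qed.

Lemma uconv_lim (R : realType) (f : nat -> R[i]) l :
  (forall e : R, 0 < e -> exists N, forall n, (N <= n)%N -> cabs (f n - l) < e) ->
  uconv nat_ultra f l.
Proof.
by move=> h e /h [N hN]; apply: nat_ultra_oo; exists N.
Qed.
End NatUltra.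

(** * Adjoints *)

Section Riesz.
Variables (R : realType) (H : hilbertType R).
Implicit Types (x y z : H) (a : R[i]) (A B : bop H).

Lemma hlim_closed (M : set H) :
  (forall u l, (forall n, M (u n)) -> hlim u l -> M l) -> closed M.
Proof.
move=> h l Ml.
have /choice [u uP] : forall n, exists y, M y /\ hnm (y - l) < n.+1%:R^-1.
  move=> n; have n0 : 0 < (n.+1%:R^-1 : R)%:C%C by rewrite ltcR invr_gt0.
  have [y [My]] := Ml _ (nbhsx_ballx l _ n0).
  by rewrite -ball_normE /= normhE ltcR hdistC; exists y.
apply: (h u) => [n|e e0]; first by have [] := uP n.
have [N] := @ltr_add_invr R 0 e e0; rewrite add0r => hN.
exists N => n Nn; apply: lt_trans (proj2 (uP n)) (le_lt_trans _ hN).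
by rewrite lef_pV2 ?posrE// ler_nat ltnS.
Qed.

(** The bound makes the kernel closed. A vector off the kernel has a nonzero component [w]
    orthogonal to it, and x - (phi x / phi w) w lies in the kernel, so phi is a multiple of the
    pairing with [w]. *)
Lemma riesz (phi : H -> R[i]) (c : R) :
  (forall a x y, phi (a *: x + y) = a * phi x + phi y) ->
  (forall x, cabs (phi x) <= c * hnm x) -> exists z, forall x, phi x = inner x z.
Proof.
move=> lphi bphi.
have phi0 : phi 0 = 0.
  have := bphi 0; rewrite hnm0 mulr0 => h; apply/eqP.
  by rewrite -cabs_eq0; apply/eqP/le_anti; rewrite h cabs_ge0.
have phiB x y : phi (x - y) = phi x - phi y.
  by rewrite addrC -scaleN1r lphi mulN1r addrC.
have phiZ a x : phi (a *: x) = a * phi x.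
  by rewrite -[_ *: _]addr0 lphi phi0 addr0.
pose K := [set x | phi x = 0].
have Ks : submod_closed (mem K : {pred H}).
  split; first by apply/mem_set.
  move=> a x y /set_mem Kx /set_mem Ky; apply/mem_set.
  by rewrite /K /= lphi Kx Ky mulr0 addr0.
have Kc : closed K.
  apply: hlim_closed => u l Ku ul; apply/eqP; rewrite -cabs_eq0; apply/eqP.
  apply/le_anti; rewrite cabs_ge0 andbT.
  have c1 : 0 < `|c| + 1 by rewrite ltr_wpDl.
  apply/ler_addgt0Pr => e e0; rewrite add0r.
  have [N hN] := ul _ (divr_gt0 e0 c1).
  have := bphi (u N - l); rewrite phiB (Ku N) sub0r cabsN => h.
  apply: le_trans h _; have := hN N (leqnn _); rewrite ltr_pdivlMr // => h.
  apply: le_trans (ltW h); rewrite mulrC ler_wpM2l ?hnm_ge0//.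
  by have := ler_norm c; lra.
pose M := ClosedSubspace Ks Kc.
have [hK|hK] := pselect (forall x, phi x = 0).
  by exists 0 => x; rewrite ip0r hK.
have [x0 x0P] : exists x0, phi x0 <> 0 by exact/existsNP.
have [p Mp pP] := projection_exists M x0.
set w := x0 - p in pP.
have phiw : phi w != 0 by rewrite phiB (Mp : phi p = 0) subr0; apply/eqP.
have w0 : hsq w != 0.
  by rewrite hsq_eq0; apply: contraNneq phiw => ->; rewrite phi0.
exists (((phi w)^* / (hsq w)%:C%C) *: w) => x.
have Kx : csub_set M (x - (phi x / phi w) *: w).
  by rewrite /= /K /= phiB phiZ divfK // subrr.
have := pP _ Kx; rewrite ipBr ipZr => /eqP; rewrite subr_eq0 => /eqP h.
rewrite ipZr [inner x w]ipC h !rmorphM /= !conjCK.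
rewrite [inner w w]hsqE (_ : (((hsq w)%:C%C)^* : R[i]) = (hsq w)%:C%C); last exact: conjc_real.
have -> : (((hsq w)%:C%C)^-1^* : R[i]) = ((hsq w)%:C%C)^-1.
  by rewrite fmorphV; congr (_^-1); exact: conjc_real.
have hw : (hsq w)%:C%C != 0 :> R[i] by rewrite -(rmorph0 (real_complex R)) (inj_eq (@complexI R)).
by field; rewrite hw phiw.
Qed.

Lemma adjoint_exists A : exists B, is_adjoint A B.
Proof.
have [c c0 Ac] := bop_bounded A.
have /choice [f fP] : forall y, exists z, forall x, inner (A x) y = inner x z.
  move=> y; apply: (@riesz (fun x => inner (A x) y) (c * hnm y)).
    by move=> a x z; rewrite bopD bopZ ipDl ipZl.
  move=> x; apply: le_trans (cauchy_schwarz _ _) _.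
  by rewrite mulrAC ler_wpM2r ?hnm_ge0.
have lf : linear f.
  move=> a x y; apply/eqP; rewrite -subr_eq0; apply/eqP/ip_eq0 => z.
  rewrite ipC !ipBr ipDr ipZr -!fP ipDr ipZr.
  by rewrite subrr conjC0.
have bf x : hnm (f x) <= c * hnm x.
  have [->|fx] := eqVneq (hnm (f x)) 0; first by rewrite mulr_ge0 ?hnm_ge0.
  have fx0 : 0 < hnm (f x) by rewrite lt_neqAle eq_sym fx hnm_ge0.
  rewrite -(ler_pM2l fx0) -expr2 hnm2 /hsq -fP.
  apply: le_trans (re_cauchy_schwarz _ _) _.
  by rewrite mulrA [hnm (f x) * c]mulrC ler_wpM2r ?hnm_ge0.
by exists (mk_bop lf bf) => x y; exact: fP.
Qed.

Definition adj A : bop H := sval (cid (adjoint_exists A)).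
Lemma adjP A : is_adjoint A (adj A).
Proof. by rewrite /adj; case: cid. Qed.
Lemma adjl A x y : inner (A x) y = inner x (adj A y).
Proof. exact: adjP. Qed.
Lemma adjr A x y : inner x (A y) = inner (adj A x) y.
Proof. by rewrite ipC adjl -ipC. Qed.

Lemma adj_bounded A (c : R) : (forall x, hnm (A x) <= c * hnm x) ->
  forall x, hnm (adj A x) <= c * hnm x.
Proof.
move=> Ac x; have [->|fx] := eqVneq (hnm (adj A x)) 0.
  by apply: le_trans (Ac x); exact: hnm_ge0.
have fx0 : 0 < hnm (adj A x) by rewrite lt_neqAle eq_sym fx hnm_ge0.
rewrite -(ler_pM2l fx0) -expr2 hnm2 /hsq -adjl.
apply: le_trans (re_cauchy_schwarz _ _) _.
by rewrite mulrA [_ * c]mulrC ler_wpM2r ?hnm_ge0.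
Qed.

Lemma adjK A : adj (adj A) = A.
Proof. exact: is_adjoint_unique (adjP _) (is_adjoint_sym (adjP A)). Qed.
Lemma adjM A B : adj (bopM A B) = bopM (adj B) (adj A).
Proof.
by apply: is_adjoint_unique (adjP _) _ => x y; rewrite /= !adjl.
Qed.
Lemma adjD A B : adj (A + B) = adj A + adj B.
Proof.
by apply: is_adjoint_unique (adjP _) _ => x y; rewrite !add_bopE ipDl ipDr !adjl.
Qed.
Lemma adjZ a A : adj (a *: A) = a^* *: adj A.
Proof.
apply: is_adjoint_unique (adjP _) _ => x y; rewrite !scale_bopE ipZl ipZr adjl.
by rewrite conjCK.
Qed.
Lemma adj1 : adj (bop1 H) = bop1 H.
Proof. by apply: is_adjoint_unique (adjP _) _ => x y. Qed.

End Riesz.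

(** * Fuglede's theorem *)

Section CauchyEstimate.
Variable R : realType.

Lemma prim_root_exists (n : nat) : (0 < n)%N -> exists z : R[i], n.-primitive_root z.
Proof.
pose p : {poly R[i]} := 'X^n - 1; have [r Dp] := closed_field_poly_normal p.
move=> n_gt0; rewrite (monicP _) ?monicXnsubC // scale1r in Dp.
have rn1: all n.-unity_root r by apply/allP=> z; rewrite -root_prod_XsubC -Dp.
have sz_r: (n < (size r).+1)%N.
  by rewrite -(size_prod_XsubC r id) -Dp size_XnsubC.
have [|z] := hasP (has_prim_root n_gt0 rn1 _ sz_r); last by exists z.
by rewrite -separable_prod_XsubC -Dp separable_Xn_sub_1 // pnatr_eq0 -lt0n.
Qed.

(* Averaging [z^-1 p(rho z)] over the [q]-th roots of unity extracts the linear
   coefficient once [q] exceeds the degree. *)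
Lemma cauchy_estimate (p : {poly R[i]}) (rho M : R) : 0 < rho ->
  (forall s, cabs s = rho -> cabs p.[s] <= M) -> rho * cabs p`_1 <= M.
Proof.
move=> rho0 pM; pose q := (size p).+2.
have q0 : (0 < q)%N by [].
have [w wP] := prim_root_exists q0.
have cw : cabs w = 1.
  apply/eqP; rewrite -(@pexpr_eq1 _ _ q) ?cabs_ge0// -cabsX.
  by rewrite (prim_expr_order wP) cabs1.
have cwt t : cabs (w ^+ t) = 1 by rewrite cabsX cw expr1n.
(* As [w ^+ q.-1] is the inverse of w, this sums the powers of w^(j - 1). For j < q that number is 1
   only if j = 1; otherwise the geometric sum vanishes. *)
have geo (j : nat) : (j < q)%N ->
    \sum_(t < q) (w ^+ t) ^+ (q.-1 + j) = if j == 1%N then q%:R else 0.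
  move=> jq; have e t : (w ^+ t) ^+ (q.-1 + j) = (w ^+ (q.-1 + j)) ^+ t.
    by rewrite -!exprM mulnC.
  case: eqP => [j1|j1].
    rewrite (eq_bigr (fun=> 1)) ?sumr_const ?card_ord// => t _.
    by rewrite e j1 addn1 prednK // (prim_expr_order wP) expr1n.
  set x := w ^+ (q.-1 + j).
  have x1 : x != 1.
    rewrite /x -(prim_order_dvd wP); apply/negP => /dvdnP [k hk].
    move: hk jq; rewrite /q /=; case: k => [|[|k]] hk jq; lia.
  have xq : x ^+ q = 1 by rewrite /x -exprM mulnC exprM (prim_expr_order wP) expr1n.
  have := subrX1 x q; rewrite xq subrr => /esym/eqP.
  rewrite mulf_eq0 subr_eq0 (negPf x1) /= => /eqP s0.
  by rewrite -[RHS]s0; apply: eq_bigr => t _; rewrite e.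
have main : \sum_(t < q) (w ^+ t) ^+ q.-1 * p.[rho%:C%C * w ^+ t] =
    q%:R * (rho%:C%C * p`_1).
  under eq_bigr => t _.
    rewrite (horner_coef_wide _ (leqW (leqW (leqnn (size p))))) mulr_sumr.
    under eq_bigr => j _ do rewrite exprMn mulrCA [_ ^+ q.-1 * _]mulrCA -exprD.
    over.
  rewrite exchange_big /=.
  under eq_bigr => j _.
    under eq_bigr => t _ do rewrite mulrA.
    rewrite -mulr_sumr geo //.
    over.
  rewrite (bigD1 (inord 1)) //= inordK // eqxx big1 => [|j /negPf jn]; last first.
    case: eqP => [j1|]; last by rewrite mulr0.
    by move/eqP: jn; case; apply: val_inj; rewrite /= inordK.
  by rewrite addr0 expr1 mulrC; congr (_ * _); rewrite mulrC.
have : cabs (q%:R * (rho%:C%C * p`_1)) <= q%:R * M.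
  rewrite -main; apply: le_trans (cabs_sum _ _ _) _.
  rewrite -[q in q%:R * M]card_ord -sum1_card natr_sum mulr_suml ler_sum // => t _.
  by rewrite mul1r cabsM cabsX cwt expr1n mul1r pM // cabsM cwt mulr1 cabsR gtr0_norm.
rewrite !cabsM cabsR (gtr0_norm rho0).
have -> : cabs (q%:R : R[i]) = q%:R.
  by rewrite -(rmorph_nat (real_complex R)) cabsR ger0_norm.
by rewrite ler_pM2l // ltr0n.
Qed.

End CauchyEstimate.

Section BopRing.
Variables (R : realType) (H : hilbertType R).
Implicit Types (A B : bop H).

Let bopMA : associative (@bopM R H). Proof. by move=> A B C; exact: bopP. Qed.
Let bop1M : left_id (bop1 H) (@bopM R H). Proof. by move=> A; exact: bopP. Qed.
Let bopM1 : right_id (bop1 H) (@bopM R H). Proof. by move=> A; exact: bopP. Qed.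
Let bopMDl : left_distributive (@bopM R H) +%R.
Proof. by move=> A B C; exact: bopP. Qed.
Let bopMDr : right_distributive (@bopM R H) +%R.
Proof. by move=> A B C; apply: bopP => x; rewrite bopME add_bopE bopD. Qed.

(** The ring structure gives binomial expansions for Fuglede's theorem and finite products for the
    spectrum of a dilation. *)
HB.instance Definition _ := GRing.Zmodule_isPzRing.Build (bop H)
  bopMA bop1M bopM1 bopMDl bopMDr.

Lemma mul_bopE A B x : (A * B) x = A (B x). Proof. by []. Qed.
Lemma one_bopE x : (1 : bop H) x = x. Proof. by []. Qed.
Lemma bopM_mul A B : bopM A B = A * B. Proof. by []. Qed.
Lemma bop1_one : bop1 H = 1. Proof. by []. Qed.
Lemma scale_bopAl (a : R[i]) A B : a *: (A * B) = (a *: A) * B.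
Proof. exact: bopP. Qed.
Lemma scale_bopAr (a : R[i]) A B : a *: (A * B) = A * (a *: B).
Proof. by apply: bopP => x; rewrite mul_bopE scale_bopE bopZ. Qed.
Lemma exp_scale_bop (a : R[i]) A k : (a *: A) ^+ k = a ^+ k *: A ^+ k.
Proof.
elim: k => [|k IH]; first by rewrite !expr0 scale1r.
by rewrite !exprS IH -scale_bopAl -scale_bopAr scalerA.
Qed.
Lemma mul_adj A B : adj (A * B) = adj B * adj A. Proof. exact: adjM. Qed.
Lemma one_adj : adj (1 : bop H) = 1. Proof. exact: adj1. Qed.
Lemma exp_adj A k : adj (A ^+ k) = adj A ^+ k.
Proof.
by elim: k => [|k IH]; rewrite ?expr0 ?one_adj// exprS mul_adj IH exprSr.
Qed.

Definition opbd (c : R) A : Prop := forall x, hnm (A x) <= c * hnm x.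

Lemma opbdM c1 c2 A B : 0 <= c1 -> opbd c1 A -> opbd c2 B -> opbd (c1 * c2) (A * B).
Proof.
by move=> c0 hA hB x; apply: le_trans (hA _) _; rewrite -mulrA ler_wpM2l.
Qed.
Lemma opbdD c1 c2 A B : opbd c1 A -> opbd c2 B -> opbd (c1 + c2) (A + B).
Proof.
by move=> hA hB x; apply: le_trans (hnmD _ _) _; rewrite mulrDl; apply: lerD; [exact: hA|exact: hB].
Qed.
Lemma opbd1 : opbd 1 1. Proof. by move=> x; rewrite mul1r. Qed.
Lemma opbdZ c (a : R[i]) A : opbd c A -> opbd (cabs a * c) (a *: A).
Proof. by move=> hA x; rewrite scale_bopE hnmZ -mulrA ler_wpM2l ?cabs_ge0. Qed.
Lemma opbdX c A k : 0 <= c -> opbd c A -> opbd (c ^+ k) (A ^+ k).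
Proof.
move=> c0 hA; elim: k => [|k IH]; first by rewrite !expr0; exact: opbd1.
by rewrite !exprS; apply: opbdM.
Qed.

Lemma normal_hnm A x : A * adj A = adj A * A -> hnm (A x) = hnm (adj A x).
Proof.
move=> h; rewrite /hnm /hsq [in LHS]adjl [in RHS]adjl adjK.
by have := congr1 (fun C : bop H => C x) h; rewrite !mul_bopE => ->.
Qed.

Variables (N B : bop H).
Hypothesis Nnormal : N * adj N = adj N * N.
Hypothesis NB : B * N = N * B.

Let Ns := adj N.

(* Rosenblum's argument with exponentials replaced by powers.  Put [U = (1 + s Ns) ^ m],
   where [Ns] is the adjoint of [N].  As [U] is normal and [B] commutes with
   [adj U], [|U B y| = |adj U B y| = |B adj U y|], which is at most [b |U y|].  The
   first order coefficient [m (Ns B - B Ns)] in [s] is then bounded through the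
   Cauchy estimate on the circle of radius [1 / sqrt m]. *)
Let fug (m : nat) (s : R[i]) : bop H := (1 + s *: Ns) ^+ m * B * (1 - s *: Ns) ^+ m.

Let fug_bound m (s : R[i]) (b c : R) : 0 <= b -> 0 <= c -> opbd b B -> opbd c N ->
  opbd (b * (1 + cabs s ^+ 2 * c ^+ 2) ^+ m) (fug m s).
Proof.
move=> b0 c0 hB hN z.
set y := ((1 - s *: Ns) ^+ m) z.
set U := (1 + s *: Ns) ^+ m.
have adjU : adj U = (1 + s^* *: N) ^+ m.
  by rewrite /U exp_adj adjD one_adj adjZ adjK.
have cU : U * adj U = adj U * U.
  rewrite adjU; apply: commrX; apply: commr_sym; apply: commrX.
  apply: commrD; first exact: commr1.
  apply: commr_sym; apply: commrD; first exact: commr1.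
  by rewrite /GRing.comm -!scale_bopAl -!scale_bopAr -Nnormal scalerA mulrC -scalerA.
have BU : B * adj U = adj U * B.
  rewrite adjU; apply: commrX; apply: commrD; first exact: commr1.
  by rewrite /GRing.comm -scale_bopAl -scale_bopAr NB.
rewrite (_ : fug m s z = U (B y)) // (normal_hnm _ cU) -mul_bopE -BU mul_bopE.
apply: le_trans (hB _) _; rewrite -(normal_hnm _ cU) -mulrA ler_wpM2l //.
rewrite /y /U -mul_bopE.
have -> : (1 + s *: Ns) ^+ m * (1 - s *: Ns) ^+ m =
    ((1 + s *: Ns) * (1 - s *: Ns)) ^+ m.
  rewrite exprMn_comm //; apply: commrB; first exact: commr1.
  by apply: commr_sym; apply: commrD => //; exact: commr1.
have -> : (1 + s *: Ns) * (1 - s *: Ns) = 1 - s ^+ 2 *: Ns ^+ 2.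
  by rewrite mulrBr mulr1 mulrDl mul1r opprD addrA addrK -expr2 exp_scale_bop.
apply: opbdX.
  by rewrite addr_ge0 // mulr_ge0 ?sqr_ge0.
rewrite -scaleNr; apply: opbdD; first exact: opbd1.
have -> : cabs s ^+ 2 = cabs (- s ^+ 2) by rewrite cabsN cabsX.
by apply: opbdZ; apply: opbdX => //; exact: adj_bounded.
Qed.

(** Both powers expand because 1 commutes with [Ns]; in degree one only (k, l) = (1, 0) and (0, 1)
    contribute, with coefficients m and - m. *)
Let fug_poly m z y : exists p : {poly R[i]},
  (forall s, p.[s] = inner (fug m s z) y) /\
  p`_1 = m%:R * inner ((Ns * B - B * Ns) z) y.
Proof.
pose t (k l : nat) : R[i] := inner ((Ns ^+ k * B * Ns ^+ l) z) y *
  ('C(m, k)%:R * ('C(m, l)%:R * (-1) ^+ l)).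
exists (\sum_(k < m.+1) \sum_(l < m.+1) t k l *: 'X^(k + l)); split.
  move=> s; rewrite /fug exprDn_comm; last exact/commr_sym/commr1.
  rewrite exprDn_comm; last exact/commr_sym/commr1.
  rewrite mulr_suml mulr_suml sum_bopE ip_suml horner_sum.
  apply: eq_bigr => k _; rewrite mulr_sumr sum_bopE ip_suml horner_sum.
  apply: eq_bigr => l _; rewrite hornerZ hornerXn !expr1n !mul1r.
  rewrite -scaleNr !exp_scale_bop -[_ *+ 'C(m, k)]scaler_nat.
  rewrite -[_ *+ 'C(m, l)]scaler_nat !scalerA.
  rewrite -!scale_bopAl -!scale_bopAr !scale_bopE !ipZl.
  by rewrite /t [(- s) ^+ l]exprNn exprD; ring.
rewrite sub_bopE ipBl coef_sum; under eq_bigr do rewrite coef_sum.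
under eq_bigr do under eq_bigr do rewrite coefZ coefXn.
case: m @t => [|m] t.
  by rewrite mul0r !big_ord_recl !big_ord0 /= mulr0 !addr0.
rewrite 2!big_ord_recl [X in _ + (_ + X)]big1 => [|k _]; last first.
  by apply: big1 => l _; rewrite mulr0.
rewrite 2!big_ord_recl [X in _ + (_ + X) + _]big1 => [|k _]; last first.
  by rewrite /bump /= mulr0.
rewrite big_ord_recl [X in _ + (_ + X + _)]big1 => [|k _]; last first.
  by rewrite /bump /= mulr0.
rewrite /t /bump /= !mulr0 !mulr1 !addr0 add0r !bin1 !bin0 ?expr0 ?expr1.
by rewrite ?mulr1 ?mul1r; ring.
Qed.

Theorem fuglede : B * adj N = adj N * B.
Proof.
have [b b0 hB] := bop_bounded B; have [c c0 hN] := bop_bounded N.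
apply/esym/eqP; rewrite -subr_eq0; apply/eqP/bopP => z; rewrite zero_bopE.
apply: ip_eq0 => y; set w := inner _ y.
pose C := b * expR (c ^+ 2) * hnm z * hnm y.
have C0 : 0 <= C by rewrite !mulr_ge0 ?expR_ge0 ?hnm_ge0.
have key (k : nat) : k.+1%:R * cabs w <= C.
  (* On the circle of radius 1/(k+1) the bound (1 + c^2/m)^m stays below exp(c^2), while the radius
     times the linear coefficient has modulus (k+1)|w|. A bound uniform in k forces w = 0. *)
  pose m := (k.+1 ^ 2)%N; have [p [pE p1]] := fug_poly m z y.
  have k0 : 0 < k.+1%:R^-1 :> R by rewrite invr_gt0.
  have := @cauchy_estimate R p k.+1%:R^-1 C k0.
  rewrite p1 -/w cabsM.
  have -> : cabs (m%:R : R[i]) = m%:R.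
    by rewrite -(rmorph_nat (real_complex R)) cabsR ger0_norm.
  rewrite mulrA /m natrX expr2 mulrA mulVf ?mul1r ?pnatr_eq0 //; apply.
  move=> s sk; rewrite pE; apply: le_trans (cauchy_schwarz _ _) _.
  rewrite /C ler_wpM2r ?hnm_ge0//.
  apply: le_trans (fug_bound m s b0 c0 hB hN z) _.
  rewrite ler_wpM2r ?hnm_ge0// ler_wpM2l //.
  rewrite sk.
  have -> : expR (c ^+ 2) = expR (k.+1%:R^-1 ^+ 2 * c ^+ 2) ^+ m.
    rewrite -expRM_natl; congr expR.
    by rewrite /m natrX mulrA -exprMn divff ?pnatr_eq0// expr1n mul1r.
  rewrite lerXn2r ?nnegrE ?expR_ge0 ?addr_ge0 ?mulr_ge0 ?sqr_ge0//.
  exact: expR_ge1Dx.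
apply/eqP; rewrite -cabs_eq0; apply: contraT => w0.
have w1 : 0 < cabs w by rewrite lt_neqAle eq_sym w0 cabs_ge0.
have := key (Num.bound (C / cabs w)).
have := archi_boundP (divr_ge0 C0 (ltW w1)); rewrite ltr_pdivrMr // => h1 h2.
have : (Num.bound (C / cabs w)).+1%:R * cabs w < (Num.bound (C / cabs w))%:R * cabs w.
  exact: le_lt_trans h2 h1.
by rewrite ltr_pM2r // ltr_nat ltnNge leqnSn.
Qed.

End BopRing.

(** * Joint approximate eigenvectors *)

Section JointApproximateEigenvectors.
Variables (R : realType) (V : lmodType R[i]) (ip : V -> V -> R[i]).
Hypothesis ip_Dl : forall x y z, ip (x + y) z = ip x z + ip y z.
Hypothesis ip_Zl : forall a x y, ip (a *: x) y = a * ip x y.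
Hypothesis ip_C : forall x y, ip x y = (ip y x)^*.
Hypothesis ip_pos : forall x, 0 <= ip x x.

Let sq x : R := complex.Re (ip x x).
Let re x y : R := complex.Re (ip x y).

Let reC x y : re x y = re y x.
Proof. by rewrite /re ip_C ReC. Qed.
Let reDl x y z : re (x + y) z = re x z + re y z.
Proof. by rewrite /re ip_Dl ReD. Qed.
Let reDr x y z : re x (y + z) = re x y + re x z.
Proof. by rewrite ![re x _]reC reDl. Qed.
Let reZl (s : R) x y : re (s%:C%C *: x) y = s * re x y.
Proof. by rewrite /re ip_Zl ReZ. Qed.
Let reZr (s : R) x y : re x (s%:C%C *: y) = s * re x y.
Proof. by rewrite ![re x _]reC reZl. Qed.
Let sq_ge0 x : 0 <= sq x. Proof. exact: ge0_Re (ip_pos x). Qed.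
Let sqZ (s : R) x : sq (s%:C%C *: x) = s ^+ 2 * sq x.
Proof. by rewrite /sq -/(re _ _) reZl reZr mulrA. Qed.
Let sqD x y : sq (x + y) = sq x + sq y + 2 * re x y.
Proof. by rewrite /sq -!/(re _ _) !reDl !reDr [re y x]reC; ring. Qed.
Let sqDle x y : sq (x + y) <= 2 * sq x + 2 * sq y.
Proof.
have := sq_ge0 (x + (-1 : R)%:C%C *: y).
rewrite !sqD sqZ reZr; lra.
Qed.
Let re_le x y : 2 * re x y <= sq x + sq y.
Proof.
have := sq_ge0 (x + (-1 : R)%:C%C *: y).
rewrite sqD sqZ reZr; lra.
Qed.

Let selfadj (A : V -> V) := forall x y, ip (A x) y = ip x (A y).
Let sqbounded (A : V -> V) := exists2 C : R, 0 <= C & forall x, sq (A x) <= C * sq x.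
Let shift (A : V -> V) (t : R) x : V := A x - t%:C%C *: x.

Let shift_linear A t : linear A -> linear (shift A t).
Proof.
move=> lA a x y; rewrite /shift lA scalerDr !scalerA [_ * a]mulrC -scalerA.
by rewrite scalerBr opprD addrACA.
Qed.

Let shift_bounded A t : sqbounded A -> sqbounded (shift A t).
Proof.
move=> [C C0 AC]; exists (2 * C + 2 * t ^+ 2) => [|x].
  by have := sqr_ge0 t; lra.
rewrite /shift -scaleNr -rmorphN; apply: le_trans (sqDle _ _) _.
by rewrite sqZ sqrrN; have := AC x; lra.
Qed.

Let shift_selfadj A t : selfadj A -> selfadj (shift A t).
Proof.
move=> sA x y; rewrite /shift ip_Dl [RHS]ip_C ip_Dl rmorphD /= -ip_C -sA; congr (_ + _).
rewrite -!scaleNr !ip_Zl rmorphM /= -ip_C rmorphN /=; congr (- _ * _).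
exact/esym/conjc_real.
Qed.

Variable A : nat -> V -> V.
Hypothesis Alin : forall k, linear (A k).
Hypothesis Asa : forall k, selfadj (A k).
Hypothesis Abd : forall k, sqbounded (A k).
Hypothesis Acomm : forall j k x, A j (A k x) = A k (A j x).

(** Exact eigenvectors need not exist, so the errors are only required to become arbitrarily small;
    [k] counts the operators covered. The ambient space is any vector space with a nonnegative
    hermitian form, so that it can be ['I_n -> L] under [sum_ip]. *)
Definition joint_approx_eigen (k : nat) (a : nat -> R) : Prop :=
  forall e : R, 0 < e -> exists x, complex.Re (ip x x) = 1 /\
    forall j, (j < k)%N -> complex.Re (ip (A j x - (a j)%:C%C *: x)
                                          (A j x - (a j)%:C%C *: x)) <= e.

Let S k a (e : R) : set V :=
  [set x | sq x = 1 /\ forall j, (j < k)%N -> sq (shift (A j) (a j) x) <= e].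

(* [t] is the limit as [e -> 0] of the infimum of the quadratic form of [A k] over
   [S k a e].  For a near minimizer [x], a gradient step along [- (A k - t) x]
   could lower the form further unless [(A k - t) x] is small. *)
Lemma joint_approx_eigen_step k a : joint_approx_eigen k a ->
  exists t : R, (forall e : R, 0 < e -> exists2 x, S k a e x &
                   sq (shift (A k) t x) <= e) /\
    (k = 0%N -> forall x, sq x = 1 -> t <= re (A 0%N x) x).
Proof.
move=> app.
have Sne e : 0 < e -> exists x, S k a e x.
  by move=> /app [x [x1 xa]]; exists x; split.
have [C C0 AC] := Abd k.
pose rayl e : set R := [set re (A k x) x | x in S k a e].
have rayl_lb e : lbound (rayl e) (- ((C + 1) / 2)).
  move=> _ [x [x1 _] <-].
  have := re_le (A k x) ((-1 : R)%:C%C *: x).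
  by rewrite reZr sqZ; have := AC x; rewrite x1; lra.
have rayl_ub e r : rayl e r -> r <= (C + 1) / 2.
  move=> [x [x1 _] <-]; have := re_le (A k x) x.
  by have := AC x; rewrite x1; lra.
have rayl_inf e : 0 < e -> has_inf (rayl e).
  move=> e0; split; last by exists (- ((C + 1) / 2)); exact: rayl_lb.
  by have [x Sx] := Sne e e0; exists (re (A k x) x); exists x.
pose m e := inf (rayl e).
have m_le e r : 0 < e -> rayl e r -> m e <= r.
  by move=> e0 er; apply: ge_inf => //; have [] := rayl_inf e e0.
have m_mono e e' : 0 < e -> e <= e' -> m e' <= m e.
  move=> e0 ee'; apply: lb_le_inf; first by have [] := rayl_inf e e0.
  move=> _ [x [x1 xa] <-]; apply: m_le; first exact: lt_le_trans ee'.
  by exists x => //; split => // j jk; apply: le_trans (xa j jk) ee'.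
pose ms : set R := [set m e | e in [set e | 0 < e]].
have ms_sup : has_sup ms.
  split; first by exists (m 1); exists 1 => //=.
  exists ((C + 1) / 2) => _ [e /= e0 <-].
  have [x Sx] := Sne e e0.
  by apply: le_trans (m_le e (re (A k x) x) e0 _) (rayl_ub e _ _); exists x.
pose t := sup ms.
have m_t e : 0 < e -> m e <= t.
  by move=> e0; apply: ub_le_sup; [have [] := ms_sup|exists e].
(* For k = 0 the set [S] is the whole unit sphere whatever e is, so each m e, and hence [t], is a
   lower bound of the form. *)
exists t; split; last first.
  move=> k0 x x1; apply: ge_sup; first by have [] := ms_sup.
  move=> _ [e /= e0 <-]; apply: m_le => //; exists x; last by rewrite k0.
  by split => // j; rewrite k0.
move=> e e0.
have [C' C'0 DC] := shift_bounded t (Abd k).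
have Dlin := shift_linear t (Alin k).
have Dsa := shift_selfadj t (Asa k).
set D := shift (A k) t in DC Dlin Dsa.
(* The step length is tuned to [C'], which bounds the square norm of [D]: s^2 C' is at most 1/4, so
   x - s D x has square norm between 1/4 and 5/2. *)
pose s := (2 * (1 + C'))^-1.
have s0 : 0 < s by rewrite invr_gt0 mulr_gt0 // ltr_wpDr.
have sC : s * (1 + C') = 2^-1.
  by rewrite /s invfM mulfVK // gt_eqF // ltr_wpDr.
have s2C : s ^+ 2 * C' <= 4^-1.
  have : s * C' <= 2^-1 by lra.
  have : s <= 2^-1 by have : 0 <= s * C' by [rewrite mulr_ge0 // ltW]; lra.
  rewrite expr2 -mulrA => h1 h2.
  have : s * (s * C') <= 2^-1 * 2^-1.
    by apply: ler_pM => //; [exact: ltW|rewrite mulr_ge0 // ltW].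
  lra.
pose dl := e * s / 4.
have dl0 : 0 < dl by rewrite divr_gt0 // mulr_gt0.
have [_ [e1 /= e10 <-] me1] := sup_adherent dl0 ms_sup.
pose e2 := Num.min e1 e.
have e20 : 0 < e2 by rewrite lt_min e10.
have e2e : e2 <= e by rewrite ge_min lexx orbT.
have me2 : t - dl < m e2.
  apply: lt_le_trans me1 (m_mono _ _ e20 _).
  by rewrite ge_min lexx.
(* The factor 10 pays for the step, which enlarges the earlier square errors by at most 5/2, and for
   the normalization, which enlarges them by at most 4. *)
have e30 : 0 < e2 / 10 by rewrite divr_gt0.
have [_ [x Sx <-] xm] := inf_adherent dl0 (rayl_inf _ e30).
have [x1 xa] := Sx.
exists x.
  split => // j jk; apply: le_trans (xa j jk) _; lra.
rewrite -/D.
pose w := D x; pose y := x + (- s)%:C%C *: w.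
have w0 := sq_ge0 w.
have wC : sq w <= C' by have := DC x; rewrite x1 mulr1.
have DE z : re (A k z) z = re (D z) z + t * sq z.
  by rewrite /D /shift -scaleNr -rmorphN reDl reZl -/(sq z) mulNr subrK.
have swC : s ^+ 2 * sq w <= 4^-1.
  by apply: le_trans s2C; rewrite ler_wpM2l // sqr_ge0.
have y_lo : 4^-1 <= sq y.
  have := sqDle y (s%:C%C *: w); rewrite sqZ /y -addrA -scalerDl -rmorphD.
  rewrite addNr scale0r addr0 x1 -/y; lra.
have y_hi : sq y <= 5 / 2.
  by have := sqDle x ((- s)%:C%C *: w); rewrite sqZ sqrrN x1 -/y; lra.
have y0 : 0 < sq y by lra.
pose r := (Num.sqrt (sq y))^-1.
have r2 : r ^+ 2 * sq y = 1.
  by rewrite /r exprVn sqr_sqrtr // mulVf // gt_eqF.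
have r24 : r ^+ 2 <= 4.
  rewrite -(ler_pM2r y0) r2; lra.
have Sy : S k a e2 (r%:C%C *: y).
  split; first by rewrite sqZ.
  move=> j jk; set Dj := shift (A j) (a j).
  have DjL : linear Dj by exact: shift_linear.
  have Djs z b : Dj (b *: z) = b *: Dj z.
    have Dj0 : Dj 0 = 0.
      by have := DjL 1 0 0; rewrite !scale1r addr0 -{1}[Dj 0]addr0 => /addrI.
    by have := DjL b z 0; rewrite !addr0 Dj0 addr0.
  rewrite Djs sqZ.
  (* Commutation moves the earlier shift [Dj] past [D], so a step made for [A k] worsens the errors
     of [A j] only by a bounded factor. *)
  have -> : Dj y = Dj x + (- s)%:C%C *: D (Dj x).
    have -> : Dj y = (- s)%:C%C *: Dj w + Dj x by rewrite -DjL addrC.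
    rewrite addrC; congr (_ + _ *: _); rewrite /w /Dj /D /shift.
    have AZ i b z : A i (b *: z) = b *: A i z.
      have A0 : A i 0 = 0.
        by have := Alin i 1 0 0; rewrite !scale1r addr0 -{1}[A i 0]addr0 => /addrI.
      by have := Alin i b z 0; rewrite !addr0 A0 addr0.
    have AB i z z' : A i (z - z') = A i z - A i z'.
      by rewrite addrC -scaleN1r Alin scaleN1r addrC.
    rewrite !AB !AZ Acomm !scalerBr !scalerA [(a j)%:C%C * _]mulrC !opprB -!addrA; congr (_ + _).
    by rewrite addrCA [RHS]addrCA; congr (_ + _); exact: addrC.
  have := sqDle (Dj x) ((- s)%:C%C *: D (Dj x)).
  rewrite sqZ sqrrN => h.
  have h1 := xa j jk; rewrite -/Dj in h1.
  have h2 := DC (Dj x); have hx := sq_ge0 (Dj x).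
  have h3 : s ^+ 2 * sq (D (Dj x)) <= 4^-1 * sq (Dj x).
    apply: le_trans (ler_wpM2l (sqr_ge0 s) h2) _.
    by rewrite mulrA ler_wpM2r.
  have h4 : sq (Dj x + (- s)%:C%C *: D (Dj x)) <= 5 / 2 * (e2 / 10) by lra.
  apply: le_trans (ler_wpM2l (sqr_ge0 r) h4) _.
  have : r ^+ 2 * e2 <= 4 * e2 by rewrite ler_wpM2r // ltW.
  lra.
have q_y : - dl * sq y <= re (D y) y.
  have : m e2 <= re (A k (r%:C%C *: y)) (r%:C%C *: y).
    by apply: m_le => //; exists (r%:C%C *: y).
  have AZ b z : A k (b *: z) = b *: A k z.
    have A0 : A k 0 = 0.
      by have := Alin k 1 0 0; rewrite !scale1r addr0 -{1}[A k 0]addr0 => /addrI.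
    by have := Alin k b z 0; rewrite !addr0 A0 addr0.
  rewrite AZ reZl reZr mulrA -expr2 DE mulrDr mulrCA r2 mulr1 => h.
  have h1 : - dl <= r ^+ 2 * re (D y) y by lra.
  have := ler_wpM2r (ltW y0) h1.
  by rewrite mulrAC r2 mul1r.
have q_x : re (D x) x <= dl.
  have := DE x; rewrite x1 mulr1; have := m_t _ e30; rewrite -/(m _) in xm; lra.
have DZ b z : D (b *: z) = b *: D z.
  have D0 : D 0 = 0.
    by have := Dlin 1 0 0; rewrite !scale1r addr0 -{1}[D 0]addr0 => /addrI.
  by have := Dlin b z 0; rewrite !addr0 D0 addr0.
have DD z z' : D (z + z') = D z + D z' by have := Dlin 1 z z'; rewrite !scale1r.
have q_exp : re (D y) y = re (D x) x - 2 * s * sq w + s ^+ 2 * re (D w) w.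
  rewrite /y DD DZ reDl reZl !(reDr _ x) !reZr.
  have -> : re (D w) x = sq w by rewrite /re Dsa.
  have -> : re (D x) w = sq w by [].
  by ring.
have q_w : 2 * re (D w) w <= (1 + C') * sq w.
  by have := re_le (D w) w; have := DC w; lra.
(* The step lowers the form of [D] from at most [dl] by at least 7/4 s |w|^2, while near minimality
   keeps it above - 5/2 dl; with dl = e s / 4 this gives s |w|^2 <= s e / 2. *)
have : s * sq w <= s * e.
  have h1 : s ^+ 2 * (2 * re (D w) w) <= s * (s * (1 + C')) * sq w.
    by rewrite mulrA -expr2 -mulrA ler_wpM2l // sqr_ge0.
  rewrite sC in h1.
  have h2 : dl * sq y <= dl * (5 / 2) by rewrite ler_wpM2l // ltW.
  have hs : 0 <= s * sq w by rewrite mulr_ge0 // ltW.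
  rewrite /dl in h2 q_y q_x dl0; lra.
by rewrite ler_pM2l.
Qed.

(** The later steps minimize only over vectors that are already almost eigen for the earlier
    operators, so the bottom of the numerical range is secured for index 0 alone. The operator whose
    sign matters is placed there. *)
Lemma joint_approx_eigen_exists k (x0 : V) : complex.Re (ip x0 x0) = 1 ->
  exists a : nat -> R, joint_approx_eigen k.+1 a /\
    forall x, complex.Re (ip x x) = 1 -> a 0%N <= complex.Re (ip (A 0%N x) x).
Proof.
move=> x01; elim: k => [|k [a [app alo]]].
  have [|t [tP t0]] := @joint_approx_eigen_step 0 (fun=> 0).
    by move=> e e0; exists x0.
  exists (fun=> t); split; last by move=> x; exact: t0.
  move=> e /tP [x [x1 _] xt]; exists x; split => // j.
  by rewrite ltnS leqn0 => /eqP ->.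
have [t [tP _]] := joint_approx_eigen_step app.
exists (fun j => if (j < k.+1)%N then a j else t); split => // e /tP [x [x1 xa] xt].
exists x; split => // j; rewrite ltnS leq_eqVlt => /predU1P [->|jk].
  by rewrite ltnn.
by rewrite jk; exact: xa.
Qed.

End JointApproximateEigenvectors.

(** * Positive semidefinite matrices *)

Section PsdMatrices.
Variable R : realType.
Local Notation C := R[i].

Definition mxadj m n (B : 'M[C]_(m, n)) : 'M[C]_(n, m) := \matrix_(i, j) (B j i)^*.

Lemma mxadjK m n (B : 'M[C]_(m, n)) : mxadj (mxadj B) = B.
Proof. by apply/matrixP => i j; rewrite !mxE conjCK. Qed.

Lemma mxadj_mul m n p (A : 'M[C]_(m, n)) (B : 'M[C]_(n, p)) :
  mxadj (A *m B) = mxadj B *m mxadj A.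
Proof.
apply/matrixP => i j; rewrite !mxE rmorph_sum; apply: eq_bigr => k _.
by rewrite !mxE rmorphM mulrC.
Qed.

Lemma dotvDl n (x y z : 'cV[C]_n) : dotv (x + y) z = dotv x z + dotv y z.
Proof. by rewrite /dotv -big_split; apply: eq_bigr => i _; rewrite mxE mulrDl. Qed.
Lemma dotvZl n (a : C) (x z : 'cV[C]_n) : dotv (a *: x) z = a * dotv x z.
Proof. by rewrite /dotv mulr_sumr; apply: eq_bigr => i _; rewrite mxE mulrA. Qed.
Lemma dotvC n (x y : 'cV[C]_n) : dotv x y = (dotv y x)^*.
Proof.
rewrite /dotv rmorph_sum; apply: eq_bigr => i _.
by rewrite rmorphM /= conjCK mulrC.
Qed.
Lemma dotvDr n (x y z : 'cV[C]_n) : dotv z (x + y) = dotv z x + dotv z y.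
Proof. by rewrite dotvC dotvDl rmorphD /= -!dotvC. Qed.
Lemma dotvZr n (a : C) (x z : 'cV[C]_n) : dotv z (a *: x) = a^* * dotv z x.
Proof. by rewrite dotvC dotvZl rmorphM /= -dotvC. Qed.
Lemma dotv_suml n I (r : seq I) (P : pred I) (F : I -> 'cV[C]_n) z :
  dotv (\sum_(i <- r | P i) F i) z = \sum_(i <- r | P i) dotv (F i) z.
Proof.
elim/big_rec2: _ => [|i x y _ <-]; last by rewrite dotvDl.
by rewrite /dotv big1 // => i _; rewrite mxE mul0r.
Qed.
Lemma dotv_adj m n (B : 'M[C]_(m, n)) x y : dotv (B *m x) y = dotv x (mxadj B *m y).
Proof.
rewrite /dotv; under eq_bigr do rewrite mxE mulr_suml.
rewrite exchange_big; apply: eq_bigr => j _; rewrite mxE rmorph_sum mulr_sumr.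
apply: eq_bigr => i _; rewrite !mxE rmorphM /= conjCK.
by rewrite mulrA [B i j * _]mulrC -!mulrA.
Qed.
Lemma dotv_ge0 n (x : 'cV[C]_n) : 0 <= dotv x x.
Proof. by apply: sumr_ge0 => i _; exact: mul_conjC_ge0. Qed.
Lemma dotv_delta n (x : 'cV[C]_n) i : dotv x (delta_mx i 0) = x i 0.
Proof.
rewrite /dotv (bigD1 i) //= mxE !eqxx conjC1 mulr1 big1 ?addr0 // => j /negPf ji.
by rewrite mxE ji conjC0 mulr0.
Qed.
Lemma mx_dotv_delta n (F : 'M[C]_n) i j :
  dotv (F *m delta_mx j 0) (delta_mx i 0) = F i j.
Proof. by rewrite dotv_delta -colE mxE. Qed.

Definition psd n (F : 'M[C]_n) : Prop := forall u, 0 <= dotv (F *m u) u.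

Lemma psd_adj_mul m n (B : 'M[C]_(m, n)) : psd (mxadj B *m B).
Proof. by move=> u; rewrite -mulmxA dotv_adj mxadjK; exact: dotv_ge0. Qed.

Lemma psd_hermitian n (F : 'M[C]_n) : psd F -> mxadj F = F.
Proof.
move=> F0; have Freal u : complex.Im (dotv (F *m u) u) = 0.
  exact: ger0_Im.
apply/matrixP => j i; rewrite mxE -!mx_dotv_delta.
set f := delta_mx j 0; set e := delta_mx i 0.
have h (a : C) : complex.Im (a^* * dotv (F *m f) e + a * dotv (F *m e) f) = 0.
  have := Freal (f + a *: e); rewrite mulmxDr -scalemxAr !dotvDl !dotvDr !dotvZl !dotvZr.
  have ImD (x y : C) : complex.Im (x + y) = complex.Im x + complex.Im y.
    by case: x y => ? ? [].
  have im3 : complex.Im (a * (a^* * dotv (F *m e) e)) = 0.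
    have aa : 0 <= a * (a^* * dotv (F *m e) e).
      by rewrite mulrA mulr_ge0 ?mul_conjC_ge0.
    exact: ger0_Im aa.
  by rewrite !ImD Freal im3 add0r addr0 addrC.
have := h 1; rewrite conjC1 !mul1r; have := h (0 +i* 1)%C.
case: (dotv _ e) => p q; case: (dotv _ f) => r s /=.
move=> h1 h2.
by apply/eqP; rewrite eq_complex /=; apply/andP; split; apply/eqP; lra.
Qed.

(** Spectral theorem, with square roots of the eigenvalues. The factored form survives entrywise
    limits and turns weighted sums into sums of squares; the cone, range and dilation arguments all
    rest on it. *)
Lemma psd_factor n (F : 'M[C]_n) : psd F -> exists B : 'M[C]_n, F = mxadj B *m B.
Proof.
move=> F0; have adjE p q (B : 'M[C]_(p, q)) : mxadj B = map_mx Num.conj (B^T).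
  by apply/matrixP => i j; rewrite !mxE.
have Fh : F \is hermsymmx.
  by apply/is_hermitianmxP; rewrite expr0 scale1r -adjE psd_hermitian.
have /orthomx_spectralP := hermitian_normalmx Fh.
set P := spectralmx F; set D := spectral_diag F => FE.
have Pu : P \is unitarymx by exact: spectral_unitarymx.
have PP : P *m mxadj P = 1%:M by rewrite adjE; exact/unitarymxP.
have FE' : F = mxadj P *m diag_mx D *m P by rewrite [LHS]FE (invmx_unitary Pu) (@adjE _ _ P).
have D0 k : 0 <= D 0 k.
  have := F0 (mxadj P *m delta_mx k 0).
  rewrite FE' -!mulmxA [P *m (_ *m _)]mulmxA PP mul1mx dotv_adj mxadjK.
  rewrite mulmxA PP mul1mx mx_dotv_delta mxE eqxx mulr1n.
  exact.
exists (diag_mx (map_mx sqrtC D) *m P).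
rewrite [LHS]FE' mxadj_mul !mulmxA; congr (_ *m _).
rewrite -mulmxA; congr (_ *m _); apply/matrixP => i j.
rewrite mul_mx_diag !mxE; case: eqVneq => [->|ij].
  rewrite !mulr1n (_ : (_ ^*)  = sqrtC (D 0 j)); last first.
    by apply: geC0_conj; rewrite sqrtC_ge0.
  by rewrite -expr2 sqrtCK.
by rewrite !mulr0n conjC0 mul0r.
Qed.

(* The Schur product step: a psd matrix paired with a Gram matrix. *)
Lemma psd_gram n (H : hilbertType R) (F : 'M[C]_n) (x : 'I_n -> H) : psd F ->
  0 <= \sum_i \sum_j F i j * inner (x j) (x i).
Proof.
move=> /psd_factor [B ->].
rewrite (_ : \sum_i _ = \sum_k inner (\sum_j B k j *: x j) (\sum_j B k j *: x j)).
  by apply: sumr_ge0 => k _; exact: ip_ge0.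
under [RHS]eq_bigr => k _.
  rewrite ip_sumr; under eq_bigr => i _.
    rewrite ip_suml; under eq_bigr => j _ do rewrite ipZl ipZr.
    over.
  over.
rewrite [RHS]exchange_big; apply: eq_bigr => i _.
rewrite [RHS]exchange_big; apply: eq_bigr => j _.
rewrite mxE mulr_suml; apply: eq_bigr => k _; rewrite mxE.
by rewrite -!mulrA mulrCA.
Qed.

(** Adding the adjoint reduces this to [psd_gram]. Only real parts are controlled because the
    matrices Z + sum_i z_i Y_i need not be hermitian. *)
Lemma psd_gram_re n (H : hilbertType R) (F : 'M[C]_n) (x : 'I_n -> H) :
  (forall u, 0 <= complex.Re (dotv (F *m u) u)) ->
  0 <= complex.Re (\sum_i \sum_j F i j * inner (x j) (x i)).
Proof.
move=> F0.
have h0 : psd (F + mxadj F).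
  move=> u; rewrite mulmxDl dotvDl [X in _ + X]dotvC -[X in _ + X^*]dotv_adj.
  set z := dotv _ _; have := F0 u; rewrite -/z.
  case: z => p q /= p0; rewrite lecE /=; apply/andP; split; last by lra.
  by apply/eqP; lra.
have := ge0_Re (psd_gram x h0).
set s := \sum_i \sum_j F i j * _.
have sC : s^* = \sum_i \sum_j (F j i)^* * inner (x j) (x i).
  rewrite /s rmorph_sum exchange_big /=.
  rewrite [LHS](eq_bigr (fun i => \sum_j (F i j)^* * inner (x i) (x j))).
    by rewrite exchange_big.
  move=> i _; rewrite rmorph_sum; apply: eq_bigr => j _.
  by rewrite rmorphM /= -ipC.
rewrite (_ : \sum_i _ = s + s^*); first by rewrite ReD ReC; lra.
rewrite sC /s -big_split; apply: eq_bigr => i _ /=.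
by rewrite -big_split; apply: eq_bigr => j _ /=; rewrite !mxE mulrDl.
Qed.

End PsdMatrices.

(** * Points of the joint spectrum *)

Section Null.
Variables (R : realType) (L : hilbertType R).

Let FU := nat_ultraP.
Let FF : ProperFilter nat_ultra := @ultra_proper _ _ FU.
#[local] Existing Instance FF.

Definition unull (v : nat -> L) : Prop :=
  forall e : R, 0 < e -> nat_ultra [set t | hnm (v t) < e].

Lemma unullD v w : unull v -> unull w -> unull (fun t => v t + w t).
Proof.
move=> hv hw e e0; have e2 : 0 < e / 2 by rewrite divr_gt0.
apply: filterS (filterI (hv _ e2) (hw _ e2)) => t /= [h1 h2].
by apply: le_lt_trans (hnmD _ _) _; lra.
Qed.

Lemma unull_le v w (c : R) : (forall t, hnm (w t) <= c * hnm (v t)) -> unull v -> unull w.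
Proof.
move=> wv hv e e0; have c1 : 0 < `|c| + 1 by rewrite ltr_wpDl.
apply: filterS (hv _ (divr_gt0 e0 c1)) => t /=; rewrite ltr_pdivlMr // => h.
apply: le_lt_trans (wv t) (le_lt_trans _ h).
rewrite mulrC ler_wpM2l ?hnm_ge0//; have := ler_norm c; lra.
Qed.

Lemma unullZ v a : unull v -> unull (fun t => a *: v t).
Proof. by apply: (@unull_le _ _ (cabs a)) => t; rewrite hnmZ. Qed.

Lemma unullB v w : unull v -> unull w -> unull (fun t => v t - w t).
Proof.
move=> hv hw; apply: unullD => //.
by apply: (@unull_le w _ 1) => // t; rewrite hnmN mul1r.
Qed.

Lemma unull_bop (A : bop L) v : unull v -> unull (fun t => A (v t)).
Proof. by have [c _ Ac] := bop_bounded A; apply: unull_le => t; exact: Ac. Qed.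

Lemma unull_sum I (r : seq I) (v : I -> nat -> L) : (forall i, unull (v i)) ->
  unull (fun t => \sum_(i <- r) v i t).
Proof.
move=> hv; elim: r => [|i r IH].
  move=> e e0; apply: filterE => t /=; by rewrite big_nil hnm0.
have -> : (fun t => \sum_(j <- i :: r) v j t) = (fun t => v i t + \sum_(j <- r) v j t).
  by apply/funext => t; rewrite big_cons.
exact: unullD.
Qed.

Lemma unull_ip v w : unull v -> (forall t, hnm (w t) <= 1) ->
  uconv nat_ultra (fun t => inner (v t) (w t)) 0.
Proof.
move=> hv w1 e e0; apply: filterS (hv _ e0) => t /=; rewrite subr0.
apply: le_lt_trans; apply: le_trans (cauchy_schwarz _ _) _.
by rewrite -[leRHS]mulr1 ler_wpM2l ?hnm_ge0.
Qed.

End Null.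

Section Characters.
Variables (R : realType) (L : hilbertType R) (I : finType) (X : nat -> I -> L).
Hypothesis X1 : forall t, \sum_a hsq (X t a) = 1.

Let FU := nat_ultraP.
Let FF : ProperFilter nat_ultra := @ultra_proper _ _ FU.
#[local] Existing Instance FF.

Lemma unit_family_le1 t a : hnm (X t a) <= 1.
Proof.
rewrite -(@ler_pXn2r _ 2) ?nnegrE ?hnm_ge0// hnm2 expr1n -(X1 t) (bigD1 a) //=.
by rewrite lerDl; apply: sumr_ge0 => b _; exact: hsq_ge0.
Qed.

(** [X t] is a unit vector of L^I whose components are almost eigenvectors with a common eigenvalue.
    The condition on the adjoint makes the class of such operators stable under adjoints. *)
Definition asymptotic_eigen (A : bop L) (c : R[i]) : Prop :=
  (forall a, unull (fun t => A (X t a) - c *: X t a)) /\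
  (forall a, unull (fun t => adj A (X t a) - c^* *: X t a)).

Definition vector_character (A : bop L) : R[i] :=
  ulim nat_ultra (fun t => \sum_a inner (A (X t a)) (X t a)).

Lemma asymptotic_eigen_uconv A c : (forall a, unull (fun t => A (X t a) - c *: X t a)) ->
  uconv nat_ultra (fun t => \sum_a inner (A (X t a)) (X t a)) c.
Proof.
move=> h.
have := uconvD FU (uconv_sum FU (index_enum I) (fun a => unull_ip (h a) (unit_family_le1^~ a)))
  (uconv_cst FU c).
rewrite big1 // add0r; congr (uconv _ _ _); apply/funext => t.
rewrite -[X in _ + X]mulr1 -(rmorph1 (real_complex R)) -(X1 t) rmorph_sum mulr_sumr.
rewrite -big_split; apply: eq_bigr => a _ /=.
by rewrite -hsqE ipBl ipZl subrK.
Qed.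

Lemma vector_characterE A c : asymptotic_eigen A c -> vector_character A = c.
Proof. by move=> [h _]; apply: ulimE => //; exact: asymptotic_eigen_uconv. Qed.

Lemma asymptotic_eigen1 : asymptotic_eigen (bop1 L) 1.
Proof.
have h : unull (fun _ : nat => 0 : L).
  by move=> e e0; apply: filterE => t /=; rewrite hnm0.
split=> a.
  by move: h; congr (unull _); apply/funext => t; rewrite bop1E scale1r subrr.
move: h; congr (unull _); apply/funext => t.
by rewrite adj1 bop1E conjC1 scale1r subrr.
Qed.

Lemma asymptotic_eigenP (s : R[i]) A B c b : asymptotic_eigen A c ->
  asymptotic_eigen B b -> asymptotic_eigen (s *: A + B) (s * c + b).
Proof.
move=> [A1 A2] [B1 B2]; split => a.
  have := unullD (unullZ s (A1 a)) (B1 a); congr (unull _); apply/funext => t.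
  by rewrite add_bopE scale_bopE scalerBr scalerDl -scalerA opprD addrACA.
have := unullD (unullZ s^* (A2 a)) (B2 a); congr (unull _); apply/funext => t.
rewrite adjD adjZ add_bopE scale_bopE scalerBr rmorphD rmorphM /= scalerDl -scalerA.
by rewrite opprD addrACA.
Qed.

Lemma asymptotic_eigenM A B c b : asymptotic_eigen A c ->
  asymptotic_eigen B b -> asymptotic_eigen (bopM A B) (c * b).
Proof.
move=> [A1 A2] [B1 B2]; split => a.
  have := unullD (unull_bop A (B1 a)) (unullZ b (A1 a)).
  congr (unull _); apply/funext => t.
  by rewrite bopME bopB bopZ scalerBr scalerA [c * b]mulrC addrA subrK.
have := unullD (unull_bop (adj B) (A2 a)) (unullZ c^* (B2 a)).
congr (unull _); apply/funext => t.
by rewrite adjM bopME bopB bopZ scalerBr scalerA rmorphM /= addrA subrK.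
Qed.

Lemma asymptotic_eigen_adj A c : asymptotic_eigen A c -> asymptotic_eigen (adj A) c^*.
Proof. by move=> [A1 A2]; split=> //; rewrite adjK conjCK. Qed.

(** Sums, products and adjoints only transport null sequences. For norm limits an eigenvalue has to
    be found first: [vector_character] is defined on every operator, and its value at [A] is the
    candidate. *)
Lemma asymptotic_eigen_cstar :
  cstar_subalgebra [set A | exists c, asymptotic_eigen A c].
Proof.
split.
- by exists 1; exact: asymptotic_eigen1.
- by move=> s A B [c hA] [b hB]; exists (s * c + b); exact: asymptotic_eigenP.
- by move=> A B [c hA] [b hB]; exists (c * b); exact: asymptotic_eigenM.
- move=> A B [c hA] AB; exists c^*.
  rewrite (is_adjoint_unique AB (adjP A)); exact: asymptotic_eigen_adj.
move=> A hA; have [K K0 AK] := bop_bounded A.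
pose c := vector_character A.
have bd (B : bop L) (e : R) : 0 <= e -> (forall x, hnm (B x) <= e * hnm x) -> forall t,
    cabs (\sum_a inner (B (X t a)) (X t a)) <= e * #|I|%:R.
  move=> e0 hB t; apply: le_trans (cabs_sum _ _ _) _.
  rewrite -sum1_card natr_sum mulr_sumr ler_sum // => a _; rewrite mulr1.
  apply: le_trans (cauchy_schwarz _ _) _.
  apply: le_trans (ler_wpM2r (hnm_ge0 _) (hB _)) _.
  rewrite -mulrA -[leRHS]mulr1 ler_wpM2l //.
  by rewrite -[leRHS]mulr1 ler_pM ?hnm_ge0 ?unit_family_le1.
have cP : uconv nat_ultra (fun t => \sum_a inner (A (X t a)) (X t a)) c.
  by apply: ulimP => //; exact: (bd A K).
have approx (e : R) : 0 < e -> exists B b, [/\ asymptotic_eigen B b,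
    forall x, hnm ((A - B) x) <= e * hnm x & cabs (c - b) <= e * #|I|%:R].
  move=> e0; have ec : 0 < e%:C%C by rewrite ltcR.
  have [B [b hB] AB] := hA _ ec.
  have AB' x : hnm ((A - B) x) <= e * hnm x.
    by rewrite -lecR rmorphM /= -!normhE; exact: AB.
  exists B, b; split => //.
  have h := uconvB FU cP (asymptotic_eigen_uconv (proj1 hB)).
  apply: (uconv_le FU h); apply: filterE => t /=.
  rewrite -sumrB (eq_bigr (fun a => inner ((A - B) (X t a)) (X t a))).
    exact: bd (ltW e0) AB' t.
  by move=> a _; rewrite sub_bopE ipBl.
(* Three errors add up: the difference of the operators, the error for [B'], and the difference of
   the eigenvalues, of sizes e, e and e #|I|. *)
have fin e (A' B' : bop L) c' b' a : 0 < e -> (forall x, hnm ((A' - B') x) <= e * hnm x) ->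
    cabs (c' - b') <= e * #|I|%:R -> unull (fun t => B' (X t a) - b' *: X t a) ->
    nat_ultra [set t | hnm (A' (X t a) - c' *: X t a) < e * (2 + #|I|%:R)].
  move=> e0 hAB hcb hB; apply: filterS (hB _ e0) => t /= h.
  rewrite (_ : _ - _ = (A' - B') (X t a) + (B' (X t a) - b' *: X t a) - (c' - b') *: X t a).
    have h1 := hAB (X t a); have h2 : e * hnm (X t a) <= e.
      by rewrite -[leRHS]mulr1 ler_wpM2l ?(ltW e0) ?unit_family_le1.
    have h3 : hnm ((c' - b') *: X t a) <= e * #|I|%:R.
      rewrite hnmZ; apply: le_trans hcb.
      by rewrite -[leRHS]mulr1 ler_wpM2l ?cabs_ge0 ?unit_family_le1.
    apply: le_lt_trans (hnmB _ _) _.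
    have := hnmD ((A' - B') (X t a)) (B' (X t a) - b' *: X t a); lra.
  by rewrite sub_bopE scalerBl addrA subrK opprB addrA subrK.
exists c; split=> a e e0.
  have N0 : 0 < 2 + #|I|%:R :> R by rewrite ltr_wpDr.
  have [B [b [[hB _] h1 h2]]] := approx _ (divr_gt0 e0 N0).
  have := fin _ _ _ _ _ _ (divr_gt0 e0 N0) h1 h2 (hB a).
  by rewrite divfK // gt_eqF.
have N0 : 0 < 2 + #|I|%:R :> R by rewrite ltr_wpDr.
have [B [b [[_ hB] h1 h2]]] := approx _ (divr_gt0 e0 N0).
have h1' : forall x, hnm ((adj A - adj B) x) <= (e / (2 + #|I|%:R)) * hnm x.
  have -> : adj A - adj B = adj (A - B).
    by rewrite adjD -scaleN1r -[- B]scaleN1r adjZ rmorphN rmorph1.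
  exact: adj_bounded h1.
have h2' : cabs (c^* - b^*) <= (e / (2 + #|I|%:R)) * #|I|%:R.
  by rewrite -rmorphB cabsC.
have := fin _ _ _ _ _ _ (divr_gt0 e0 N0) h1' h2' (hB a).
by rewrite divfK // gt_eqF.
Qed.

(** The generated algebra lies inside the algebra of operators with an asymptotic eigenvalue, on
    which the limit of vector states is multiplicative. *)
Lemma asymptotic_eigen_spectrum d (N : 'I_d -> bop L) (l : 'rV[R[i]]_d) :
  (forall i, asymptotic_eigen (N i) (l 0 i)) -> joint_spectrum N l.
Proof.
move=> hl; exists vector_character; last by move=> i; rewrite (vector_characterE (hl i)).
have gen A : cstar_generated N A -> exists c, asymptotic_eigen A c.
  move=> /(_ [set B | exists c, asymptotic_eigen B c]); apply; split.
    exact: asymptotic_eigen_cstar.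
  by move=> _ [i _ <-]; exists (l 0 i).
split.
- exact: vector_characterE asymptotic_eigen1.
- move=> a A B /gen [c hA] /gen [b hB].
  rewrite (vector_characterE hA) (vector_characterE hB).
  exact: vector_characterE (asymptotic_eigenP a hA hB).
move=> A B /gen [c hA] /gen [b hB].
rewrite (vector_characterE hA) (vector_characterE hB).
exact: vector_characterE (asymptotic_eigenM hA hB).
Qed.

End Characters.

(** * Positivity over a normal tuple *)

Section OperatorMatrices.
Variables (R : realType) (L : hilbertType R) (n : nat).
Local Notation V := ('I_n -> L).

Definition sum_ip (x y : V) : R[i] := \sum_a inner (x a) (y a).

Lemma sum_ipE (x : V) : complex.Re (sum_ip x x) = \sum_a hsq (x a).
Proof. exact: Re_sum. Qed.

Definition opmx_app (G : 'I_n -> 'I_n -> bop L) (x : V) : V :=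
  fun a => \sum_b G a b (x b).

Lemma opmx_linear G : linear (opmx_app G).
Proof.
move=> s x y; apply/funext => a; rewrite /opmx_app /=.
rewrite -[RHS]/(s *: opmx_app G x a + opmx_app G y a) /opmx_app scaler_sumr -big_split.
by apply: eq_bigr => b _; rewrite /= bopD bopZ.
Qed.

Lemma opmx_adj G (x y : V) :
  sum_ip (opmx_app G x) y = sum_ip x (opmx_app (fun a b => adj (G b a)) y).
Proof.
rewrite /sum_ip /opmx_app; under eq_bigr do rewrite ip_suml.
under [RHS]eq_bigr do rewrite ip_sumr.
rewrite exchange_big; apply: eq_bigr => a _; apply: eq_bigr => b _.
exact: adjl.
Qed.

Lemma opmx_bounded G : exists2 C : R, 0 <= C & forall x,
  complex.Re (sum_ip (opmx_app G x) (opmx_app G x)) <= C * complex.Re (sum_ip x x).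
Proof.
have /choice [c cP] : forall p : 'I_n * 'I_n, exists c : R, 0 <= c /\
    forall x, hnm (G p.1 p.2 x) <= c * hnm x.
  by move=> p; have [c c0 h] := bop_bounded (G p.1 p.2); exists c.
have c0 a b : 0 <= c (a, b) by have [] := cP (a, b).
exists (\sum_a (\sum_b c (a, b)) ^+ 2) => [|x].
  by apply: sumr_ge0 => a _; exact: sqr_ge0.
rewrite !sum_ipE; set q := \sum_a hsq (x a).
have q0 : 0 <= q by apply: sumr_ge0 => a _; exact: hsq_ge0.
have xq b : hnm (x b) <= Num.sqrt q.
  rewrite ler_sqrt // /q (bigD1 b) //= lerDl.
  by apply: sumr_ge0 => a _; exact: hsq_ge0.
rewrite mulr_suml ler_sum // => a _.
rewrite -hnm2 -[X in _ * X](sqr_sqrtr q0) -exprMn lerXn2r ?nnegrE ?hnm_ge0//.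
  by rewrite mulr_ge0 ?sqrtr_ge0 ?sumr_ge0.
apply: le_trans (hnm_sum _ _ _) _; rewrite mulr_suml ler_sum // => b _.
apply: le_trans (proj2 (cP (a, b)) _) _.
by rewrite ler_wpM2l.
Qed.

Definition opdiag (A : bop L) : 'I_n -> 'I_n -> bop L :=
  fun a b => if a == b then A else 0.

Lemma opdiagE A (x : V) a : opmx_app (opdiag A) x a = A (x a).
Proof.
rewrite /opmx_app (bigD1 a) //= /opdiag eqxx big1 ?addr0 // => b.
by rewrite eq_sym => /negPf ->.
Qed.

Lemma opmx_diag_comm A G : (forall a b, A * G a b = G a b * A) -> forall x : V,
  opmx_app (opdiag A) (opmx_app G x) = opmx_app G (opmx_app (opdiag A) x).
Proof.
move=> AG x; apply/funext => a; rewrite opdiagE /opmx_app bop_sum.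
apply: eq_bigr => b _; rewrite -mul_bopE AG mul_bopE; congr (G a b _).
by rewrite -[RHS]/(opmx_app (opdiag A) x b) opdiagE.
Qed.

End OperatorMatrices.

Lemma conj_half (R : realType) : (2^-1)^* = 2^-1 :> R[i].
Proof. by rewrite fmorphV rmorph_nat. Qed.

Section NormalTuples.
Variables (R : realType) (L : hilbertType R) (d : nat) (N : 'I_d -> bop L).
Hypothesis Nn : normal_tuple N.

Lemma normal_tuple_comm i j : N i * N j = N j * N i.
Proof. exact: (proj2 Nn). Qed.

Lemma normal_tuple_comm_adj i j : N i * adj (N j) = adj (N j) * N i.
Proof.
apply: fuglede; last exact: normal_tuple_comm.
have [B NB h] := proj1 Nn j.
by rewrite (is_adjoint_unique (adjP (N j)) NB); exact: h.
Qed.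

Definition in_commutant (A : bop L) : Prop :=
  (forall i, A * N i = N i * A) /\ (forall i, A * adj (N i) = adj (N i) * A).

Lemma commutant_N i : in_commutant (N i).
Proof.
by split=> j; [exact: normal_tuple_comm|exact: normal_tuple_comm_adj].
Qed.

Lemma commutant_adj A : in_commutant A -> in_commutant (adj A).
Proof.
move=> [h1 h2]; split=> i.
  by rewrite -{1}[N i]adjK -!mul_adj -h2 mul_adj adjK.
by rewrite -!mul_adj h1.
Qed.

Lemma commutantD A B : in_commutant A -> in_commutant B -> in_commutant (A + B).
Proof.
by move=> [h1 h2] [h3 h4]; split=> i; rewrite mulrDl mulrDr ?h1 ?h2 ?h3 ?h4.
Qed.

Lemma commutantZ a A : in_commutant A -> in_commutant (a *: A).
Proof.
by move=> [h1 h2]; split=> i; rewrite -scale_bopAl -scale_bopAr ?h1 ?h2.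
Qed.

Lemma commutant0 : in_commutant 0.
Proof. by split=> i; rewrite mul0r mulr0. Qed.

Lemma commutant1 : in_commutant (bop1 L).
Proof. by split=> i; rewrite bop1_one mul1r mulr1. Qed.

Lemma commutant_sum I (r : seq I) (F : I -> bop L) :
  (forall i, in_commutant (F i)) -> in_commutant (\sum_(i <- r) F i).
Proof.
move=> h; elim/big_rec: _ => [|i A _ hA]; first exact: commutant0.
exact: commutantD.
Qed.

Definition hpart (A : bop L) : bop L := (2^-1 : R[i]) *: (A + adj A).

Lemma hpart_adj A : adj (hpart A) = hpart A.
Proof.
by rewrite /hpart adjZ conj_half adjD adjK addrC.
Qed.

Lemma commutant_hpart A : in_commutant A -> in_commutant (hpart A).
Proof. by move=> h; apply/commutantZ/commutantD => //; exact: commutant_adj. Qed.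

(** Padding by 0 turns the tuple into a sequence. In [h], even indices carry the real parts of the
    [N i] and odd indices the imaginary parts, written as real parts of - i N. *)
Let NN (j : nat) : bop L := if insub j is Some i then N i else 0.
Let h (k : nat) : bop L :=
  hpart ((if odd k then - 'i%C else 1) *: NN k./2).

Let NN_comm A j : in_commutant A -> A * NN j = NN j * A.
Proof. by rewrite /NN; case: insub => [i|] [h1 _]; rewrite ?h1 ?mulr0 ?mul0r. Qed.

Let NN_comm_adj A j : in_commutant A -> A * adj (NN j) = adj (NN j) * A.
Proof.
rewrite /NN; case: insub => [i|] [_ h1]; rewrite ?h1 //.
have -> : adj (0 : bop L) = 0 by rewrite -[0 in LHS](scale0r 0) adjZ conjC0 scale0r.
by rewrite mulr0 mul0r.
Qed.

Let NN_in j : in_commutant (NN j).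
Proof. by rewrite /NN; case: insub => [i|]; [exact: commutant_N|exact: commutant0]. Qed.

Let h_in k : in_commutant (h k).
Proof. by apply: commutant_hpart; exact: commutantZ. Qed.

Let h_comm A k : in_commutant A -> A * h k = h k * A.
Proof.
move=> hA; rewrite /h /hpart adjZ -scale_bopAl -scale_bopAr mulrDr mulrDl.
by rewrite -!scale_bopAl -!scale_bopAr NN_comm // NN_comm_adj.
Qed.

Let NE (i : 'I_d) : N i = h i.*2 + 'i%C *: h i.*2.+1.
Proof.
rewrite /h /= odd_double /= uphalf_double doubleK /NN valK scale1r /hpart.
rewrite [X in _ + X]scalerA ['i%C * _]mulrC -scalerA -scalerDr adjZ [X in _ + X]scalerDr !scalerA.
have -> : 'i%C * - 'i%C = 1 :> R[i] by rewrite mulrN -expr2 sqr_i opprK.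
have -> : 'i%C * (- 'i%C)^* = -1 :> R[i].
  rewrite (_ : _^* = 'i%C) -?expr2 ?sqr_i //.
  by apply/eqP; rewrite eq_complex /= oppr0 opprK !eqxx.
rewrite scale1r scaleN1r addrACA subrr addr0 -mulr2n -(scaler_nat 2 (N i)) scalerA.
by rewrite mulVf ?scale1r // pnatr_eq0.
Qed.

Let NadjE (i : 'I_d) : adj (N i) = h i.*2 - 'i%C *: h i.*2.+1.
Proof.
have hadj k : adj (h k) = h k by exact: hpart_adj.
rewrite {1}NE adjD (adjZ 'i%C) !hadj -scaleNr; congr (_ + _ *: _).
by apply/eqP; rewrite eq_complex /= oppr0 !eqxx.
Qed.

Let NEv i v : N i v = h i.*2 v + 'i%C *: h i.*2.+1 v.
Proof. by rewrite {1}NE. Qed.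

Let NadjEv i v : adj (N i) v = h i.*2 v - 'i%C *: h i.*2.+1 v.
Proof. by rewrite {1}NadjE. Qed.

(* If the form took a negative value, its bottom [t < 0] together with eigenvalues
   of the real and imaginary parts of the [N i] would have joint approximate
   eigenvectors in [L^n]; they give a point [z] of the joint spectrum at which
   [Z + \sum_i z_i Y_i] is not positive. *)
Theorem normal_tuple_psd (K : set 'rV[R[i]]_d) (n : nat) (Z : 'M[R[i]]_n)
    (Y : 'I_d -> 'M[R[i]]_n) :
  joint_spectrum N `<=` K ->
  (forall z, K z -> forall u,
     0 <= complex.Re (dotv ((Z + \sum_i z 0 i *: Y i) *m u) u)) ->
  forall x : 'I_n -> L, 0 <= complex.Re (\sum_a \sum_b
    inner ((Z a b *: bop1 L + \sum_i Y i a b *: N i) (x b)) (x a)).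
Proof.
move=> NK ZY x.
pose M a b := Z a b *: bop1 L + \sum_i Y i a b *: N i.
have M_in a b : in_commutant (M a b).
  apply: commutantD; first exact/commutantZ/commutant1.
  by apply: commutant_sum => i; exact/commutantZ/commutant_N.
have ME a b v : M a b v = Z a b *: v + \sum_i Y i a b *: N i v.
  by rewrite /M add_bopE scale_bopE bop1E sum_bopE.
change (0 <= complex.Re (\sum_a \sum_b inner (M a b (x b)) (x a))).
clearbody M.
(* The eigenvector argument needs a selfadjoint operator; the hermitian part of [M] has the same
   real quadratic form. *)
pose G a b := (2^-1 : R[i]) *: (M a b + adj (M b a)).
have GE a b v : G a b v = (2^-1 : R)%:C%C *: (M a b v + adj (M b a) v).
  by rewrite /G scale_bopE add_bopE fmorphV rmorph_nat.
have G_in a b : in_commutant (G a b).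
  by apply/commutantZ/commutantD => //; exact: commutant_adj.
have G_adj : (fun a b => adj (G b a)) = G.
  apply/funext => a; apply/funext => b.
  by rewrite /G adjZ conj_half adjD adjK addrC.
clearbody G.
have sumME y : \sum_a \sum_b inner (M a b (y b)) (y a) = sum_ip (opmx_app M y) y.
  by apply: eq_bigr => a _; rewrite ip_suml.
rewrite sumME.
have GM y : complex.Re (sum_ip (opmx_app G y) y) = complex.Re (sum_ip (opmx_app M y) y).
  have : sum_ip (opmx_app G y) y =
      (2^-1 : R)%:C%C * (sum_ip (opmx_app M y) y + (sum_ip (opmx_app M y) y)^*).
    have -> : (sum_ip (opmx_app M y) y)^* = sum_ip (opmx_app (fun a b => adj (M b a)) y) y.
      rewrite opmx_adj /sum_ip rmorph_sum; apply: eq_bigr => a _.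
      by rewrite /= -ipC.
    rewrite /sum_ip -big_split mulr_sumr; apply: eq_bigr => a _ /=.
    rewrite -ipDl /opmx_app -big_split /= -ipZl; congr (inner _ _).
    rewrite scaler_sumr; apply: eq_bigr => b _.
    exact: GE.
  by move=> ->; rewrite ReZ ReD ReC; lra.
rewrite leNgt; apply/negP => xneg.
pose q := complex.Re (sum_ip x x).
have q0 : 0 < q.
  rewrite lt_neqAle eq_sym; apply/andP; split; last first.
    by rewrite /q sum_ipE sumr_ge0 // => a _; exact: hsq_ge0.
  apply: contraTneq xneg; rewrite /q sum_ipE -leNgt => /eqP.
  rewrite psumr_eq0 => [/allP x0|a _]; last exact: hsq_ge0.
  rewrite /sum_ip big1 // => a _.
  by have := x0 a (mem_index_enum _); rewrite /= hsq_eq0 => /eqP ->; rewrite ip0r.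
pose r := (Num.sqrt q)^-1.
have r2 : r ^+ 2 * q = 1 by rewrite /r exprVn sqr_sqrtr ?(ltW q0)// mulVf // gt_eqF.
pose x1 : 'I_n -> L := r%:C%C *: x.
have scaleip (y z : 'I_n -> L) : sum_ip (r%:C%C *: y) (r%:C%C *: z) = (r ^+ 2)%:C%C * sum_ip y z.
  rewrite /sum_ip mulr_sumr; apply: eq_bigr => a _.
  rewrite /= ipZl ipZr mulrA rmorphXn expr2; congr (_ * _ * _); exact: conjc_real.
have x11 : complex.Re (sum_ip x1 x1) = 1 by rewrite scaleip ReZ.
have x1neg : complex.Re (sum_ip (opmx_app G x1) x1) < 0.
  have GZ : opmx_app G x1 = r%:C%C *: opmx_app G x.
    have := opmx_linear G r%:C%C x 0; rewrite addr0 => ->.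
    have -> : opmx_app G 0 = 0.
      by apply/funext => a; rewrite /opmx_app big1 // => b _; exact: bop0.
    by rewrite addr0.
  rewrite GZ scaleip ReZ GM pmulr_rlt0 // exprn_gt0 //.
  by rewrite invr_gt0 sqrtr_gt0.
(* [G] takes index 0, where the limit value is the bottom of its numerical range and hence negative;
   this shifts the indices of [h] by one. *)
pose Am (k : nat) := if k is k'.+1 then opdiag (h k') else G.
pose A (k : nat) : ('I_n -> L) -> ('I_n -> L) := opmx_app (Am k).
have Am_adj k : (fun a b => adj (Am k b a)) = Am k.
  case: k => [|k] //; apply/funext => a; apply/funext => b; rewrite /= /opdiag eq_sym.
  case: eqP => _; first exact: hpart_adj.
  by rewrite -[0 in LHS](scale0r 0) adjZ conjC0 scale0r.
have Acomm j k y : A j (A k y) = A k (A j y).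
  rewrite /A; case: j k => [|j] [|k] //=.
  - by rewrite (opmx_diag_comm (G := G)) // => b c; rewrite h_comm.
  - by rewrite (opmx_diag_comm (G := G)) // => b c; rewrite h_comm.
  apply: opmx_diag_comm => b c; rewrite /opdiag; case: eqP => _.
    by rewrite h_comm.
  by rewrite mulr0 mul0r.
have [a [app alo]] : exists a : nat -> R, joint_approx_eigen (@sum_ip R L n) A d.*2.+1 a /\
    forall y, complex.Re (sum_ip y y) = 1 -> a 0%N <= complex.Re (sum_ip (A 0%N y) y).
  apply: (@joint_approx_eigen_exists R _ (@sum_ip R L n) _ _ _ _ A _ _ _ _ d.*2 x1 x11).
  - by move=> y z w; rewrite /sum_ip -big_split; apply: eq_bigr => b _; rewrite ipDl.
  - by move=> s y w; rewrite /sum_ip mulr_sumr; apply: eq_bigr => b _; rewrite ipZl.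
  - by move=> y w; rewrite /sum_ip rmorph_sum; apply: eq_bigr => b _; exact: ipC.
  - by move=> y; apply: sumr_ge0 => b _; exact: ip_ge0.
  - by move=> k; exact: opmx_linear.
  - by move=> k y w; rewrite /A opmx_adj Am_adj.
  - by move=> k; exact: opmx_bounded.
  - exact: Acomm.
have a0 : a 0%N < 0 by apply: le_lt_trans (alo x1 x11) x1neg.
have /choice [X XP] : forall t : nat, exists y, complex.Re (sum_ip y y) = 1 /\
    forall j, (j < d.*2.+1)%N -> complex.Re (sum_ip (A j y - (a j)%:C%C *: y)
       (A j y - (a j)%:C%C *: y)) <= t.+1%:R^-1.
  by move=> t; apply: app; rewrite invr_gt0.
have X1 t : \sum_b hsq (X t b) = 1 by rewrite -sum_ipE; have [] := XP t.
have nullA j b : (j < d.*2.+1)%N -> unull (fun t => A j (X t) b - (a j)%:C%C *: X t b).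
  move=> jd e e0; have e2 : 0 < e ^+ 2 by rewrite exprn_gt0.
  have [T] := @ltr_add_invr R 0 _ e2; rewrite add0r => hT.
  apply: nat_ultra_oo; exists T => // t Tt /=.
  rewrite -(@ltr_pXn2r _ 2) ?nnegrE ?hnm_ge0 ?(ltW e0)// hnm2.
  have tT : t.+1%:R^-1 <= T.+1%:R^-1 :> R by rewrite lef_pV2 ?posrE// ler_nat ltnS.
  apply: le_lt_trans hT; apply: le_trans tT; have := proj2 (XP t) j jd.
  rewrite sum_ipE; apply: le_trans; rewrite [leRHS](bigD1 b) //= lerDl.
  by apply: sumr_ge0 => c _; exact: hsq_ge0.
pose l : 'rV[R[i]]_d := \row_i ((a i.*2.+1)%:C%C + 'i%C * (a i.*2.+2)%:C%C).
have hd (i : 'I_d) : (i.*2.+2 < d.*2.+1)%N by rewrite ltnS -doubleS leq_double.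
have h1 (i : 'I_d) b : unull (fun t => h i.*2 (X t b) - (a i.*2.+1)%:C%C *: X t b).
  have := nullA i.*2.+1 b (ltnW (hd i)); congr (unull _); apply/funext => t.
  by rewrite /A /= opdiagE.
have h2 (i : 'I_d) b : unull (fun t => h i.*2.+1 (X t b) - (a i.*2.+2)%:C%C *: X t b).
  have := nullA i.*2.+2 b (hd i); congr (unull _); apply/funext => t.
  by rewrite /A /= opdiagE.
have eig i : asymptotic_eigen X (N i) (l 0 i).
  split=> b.
    have := unullD (h1 i b) (unullZ 'i%C (h2 i b)); congr (unull _); apply/funext => t.
    by rewrite NEv mxE scalerBr scalerDl -(scalerA 'i%C) opprD addrACA.
  have := unullB (h1 i b) (unullZ 'i%C (h2 i b)); congr (unull _); apply/funext => t.
  rewrite NadjEv mxE scalerBr.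
  have -> : ((a i.*2.+1)%:C%C + 'i%C * (a i.*2.+2)%:C%C)^* =
      (a i.*2.+1)%:C%C - 'i%C * (a i.*2.+2)%:C%C :> R[i].
    by apply/eqP; rewrite eq_complex /=; apply/andP; split; apply/eqP; ring.
  rewrite scalerBl -(scalerA 'i%C) !opprB addrACA [RHS]addrACA.
  by congr (_ + _); exact: addrC.
have Kl : K l by apply: NK; apply: (asymptotic_eigen_spectrum X1); exact: eig.
pose P := Z + \sum_i l 0 i *: Y i.
have MP b c : unull (fun t => M b c (X t c) - P b c *: X t c).
  have := unull_sum (index_enum 'I_d) (fun i => unullZ (Y i b c) (proj1 (eig i) c)).
  congr (unull _); apply/funext => t.
  rewrite ME /P mxE summxE scalerDl opprD addrACA subrr add0r.
  rewrite scaler_suml -sumrB; apply: eq_bigr => i _.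
  by rewrite [(_ *: Y i) b c]mxE scalerBr [l 0 i * _]mulrC -scalerA.
have conv := uconv_sum nat_ultraP (index_enum 'I_n) (fun b =>
  uconv_sum nat_ultraP (index_enum 'I_n) (fun c =>
    unull_ip (MP b c) (fun t => unit_family_le1 X1 t b))).
have conv0 := uconv_sum nat_ultraP (index_enum 'I_n) (fun b =>
  unull_ip (nullA 0%N b isT) (fun t => unit_family_le1 X1 t b)).
rewrite big1 // in conv0; rewrite big1 in conv; last by move=> b _; rewrite big1.
(* Each approximation may cost half of |a 0|: the real form of [M] at [X t] would be above a 0 / 2
   by positivity at [l], and below a 0 / 2 by the choice of [a]. *)
have e0 : 0 < - a 0%N / 2 by rewrite divr_gt0 // oppr_gt0.
have PU : ProperFilter nat_ultra := @ultra_proper _ _ nat_ultraP.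
have [t /= [c1 c2]] := filter_ex (filterI (conv _ e0) (conv0 _ e0)).
rewrite !subr0 in c1 c2.
have c1' := le_lt_trans (Re_le_cabs _) c1; have c2' := le_lt_trans (Re_le_cabs _) c2.
have eG : complex.Re (\sum_b inner (A 0%N (X t) b - (a 0%N)%:C%C *: X t b) (X t b)) =
    complex.Re (sum_ip (opmx_app G (X t)) (X t)) - a 0%N.
  under eq_bigr do rewrite ipBl ipZl.
  rewrite sumrB ReB -mulr_sumr ReZ; congr (_ - _).
  by rewrite -[X in _ * X]/(complex.Re (sum_ip (X t) (X t))) (proj1 (XP t)) mulr1.
have eM : complex.Re (\sum_b \sum_c inner (M b c (X t c) - P b c *: X t c) (X t b)) =
    complex.Re (sum_ip (opmx_app M (X t)) (X t)) -
    complex.Re (\sum_b \sum_c P b c * inner (X t c) (X t b)).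
  rewrite -sumME -ReB -sumrB; congr complex.Re; apply: eq_bigr => b _.
  by rewrite -sumrB; apply: eq_bigr => c _; rewrite ipBl ipZl.
have pos := psd_gram_re (X t) (ZY l Kl).
rewrite eG GM in c2'; rewrite eM in c1'.
move: c1' c2'; rewrite !ltr_norml => /andP[c3 c4] /andP[c5 c6].
by rewrite -/P in pos; clear G_adj; lra.
Qed.

End NormalTuples.

(** * Positive decompositions of matrix tuples *)

Section ConeDuality.
Variables (R : realType) (K J : finType) (n : nat).
Variables (w : K -> J -> R[i]) (T : K -> 'M[R[i]]_n) (k0 : K).
Hypothesis wk0 : forall j, w k0 j = 1.
Local Notation I := (K * ('I_n * 'I_n))%type.
Local Notation C := R[i].

Let fip (r s : I -> C) : C := \sum_p r p * (s p)^*.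
Let fre r s : R := complex.Re (fip r s).
Let fsq r : R := fre r r.
Let comb (F : J -> 'M[C]_n) (p : I) : C := \sum_j w p.1 j * F j p.2.1 p.2.2.
Let rem F (p : I) : C := T p.1 p.2.1 p.2.2 - comb F p.
Let psdf (F : J -> 'M[C]_n) := forall j, psd (F j).

Let fsqE r : fip r r = (fsq r)%:C%C.
Proof. by apply: ge0_ReE; apply: sumr_ge0 => p _; exact: mul_conjC_ge0. Qed.
Let fsq_ge0 r : 0 <= fsq r.
Proof. by apply: ge0_Re; apply: sumr_ge0 => p _; exact: mul_conjC_ge0. Qed.

Let fsq_sub (r s : I -> C) (t : R) :
  fsq (fun p => r p - t%:C%C * s p) = fsq r - 2 * t * fre r s + t ^+ 2 * fsq s.
Proof.
rewrite /fsq /fre -[X in _ + X]ReZ -[2 * t * _]ReZ -ReB -ReD /fip !mulr_sumr.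
rewrite -sumrB -big_split !Re_sum; apply: eq_bigr => p _ /=.
case: (r p) => a b; case: (s p) => c e /=; ring.
Qed.

Let cabs_le_fsq r p : cabs (r p) ^+ 2 <= fsq r.
Proof.
rewrite -lecR -fsqE /fip (bigD1 p) //= mul_conjE lerDl.
by apply: sumr_ge0 => q _; exact: mul_conjC_ge0.
Qed.

Let vals : set R := [set fsq (rem F) | F in psdf].

Let psd0 : psd (0 : 'M[C]_n).
Proof. by move=> u; rewrite mul0mx /dotv big1 // => i _; rewrite mxE mul0r. Qed.

Let psdD (A B : 'M[C]_n) : psd A -> psd B -> psd (A + B).
Proof. by move=> hA hB u; rewrite mulmxDl dotvDl addr_ge0. Qed.

Let psdZ (t : C) (A : 'M[C]_n) : 0 <= t -> psd A -> psd (t *: A).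
Proof. by move=> t0 hA u; rewrite -scalemxAl dotvZl mulr_ge0. Qed.

Let vals_inf : has_inf vals.
Proof.
split; first by exists (fsq (rem (fun=> 0))); exists (fun=> 0).
by exists 0 => _ [F _ <-]; exact: fsq_ge0.
Qed.

Let psd_diag (A : 'M[C]_n) a : psd A -> 0 <= A a a.
Proof. by move=> hA; rewrite -mx_dotv_delta. Qed.

(** Row [k0], where all weights are 1, bounds the sum of the positive [F j], hence the diagonal of
    each and the entries of its factor. Limits are taken of the factors, so positivity of the limit
    is automatic. *)
Let inf_attained : exists2 F, psdf F & fsq (rem F) <= inf vals.
Proof.
set dl := inf vals.
have /choice [B BP] : forall t : nat, exists B : J -> 'M[C]_n,
    fsq (rem (fun j => mxadj (B j) *m B j)) < dl + t.+1%:R^-1.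
  move=> t; have t0 : 0 < t.+1%:R^-1 :> R by rewrite invr_gt0.
  have [_ [F Fpsd <-] h] := inf_adherent t0 vals_inf.
  have /choice [B hB] : forall j, exists B : 'M[C]_n, F j = mxadj B *m B.
    by move=> j; exact: psd_factor.
  by exists B; have -> : (fun j => mxadj (B j) *m B j) = F by apply/funext.
pose Ft t j := mxadj (B t j) *m B t j.
have dl0 : 0 <= dl by apply: lb_le_inf; [have [] := vals_inf|move=> _ [F _ <-]; exact: fsq_ge0].
pose c := dl + 1.
pose M := \sum_a cabs (T k0 a a) + (c + 1).
have Bbd t j a b : cabs (B t j a b) <= M + 1.
  have h1 : fsq (rem (Ft t)) <= c.
    apply: le_trans (ltW (BP t)) _; rewrite lerD2l invf_le1 ?ltr0n// ler1n //.
  have h2 : cabs (rem (Ft t) (k0, (b, b))) <= c + 1.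
    have := le_trans (cabs_le_fsq (rem (Ft t)) (k0, (b, b))) h1.
    have := cabs_ge0 (rem (Ft t) (k0, (b, b))).
    by set z := cabs _; rewrite /c in h1 *; nra.
  have h3 : cabs (\sum_j Ft t j b b) <= M.
    have e : \sum_j Ft t j b b = T k0 b b - rem (Ft t) (k0, (b, b)).
      rewrite /rem /comb /= opprB addrC subrK.
      by apply: eq_bigr => i _; rewrite wk0 mul1r.
    rewrite e; apply: le_trans (cabsD _ _) _; rewrite cabsN lerD //.
    by rewrite (bigD1 b) //= lerDl sumr_ge0 // => i _; exact: cabs_ge0.
  have Fpos i : 0 <= Ft t i b b by apply: psd_diag; exact: psd_adj_mul.
  have h4 : cabs (Ft t j b b) <= M.
    apply: le_trans h3; rewrite -lecR -!cabsE !ger0_norm //.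
      by rewrite [leRHS](bigD1 j) //= lerDl sumr_ge0.
    by rewrite sumr_ge0.
  have h5 : cabs (B t j a b) ^+ 2 <= cabs (Ft t j b b).
    rewrite -lecR -[leRHS]cabsE ger0_norm // /Ft mxE.
    under eq_bigr do rewrite mxE mulrC mul_conjE.
    rewrite (bigD1 a) //= lerDl sumr_ge0 // => i _.
    by rewrite lecR sqr_ge0.
  have := cabs_ge0 (B t j a b); have := le_trans h5 h4; nra.
have [Bl Blim] : exists Bl : J -> 'M[C]_n, forall j a b,
    uconv nat_ultra (fun t => B t j a b) (Bl j a b).
  exists (fun j => \matrix_(a, b) ulim nat_ultra (fun t => B t j a b)) => j a b.
  by rewrite mxE; apply: (ulimP nat_ultraP) => t; exact: Bbd.
pose Fl j := mxadj (Bl j) *m Bl j.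
have Flim j a b : uconv nat_ultra (fun t => Ft t j a b) (Fl j a b).
  rewrite /Ft /Fl mxE; under [X in uconv _ X _]eq_fun do rewrite mxE.
  apply: (uconv_sum nat_ultraP) => e; rewrite !mxE.
  under [X in uconv _ X _]eq_fun do rewrite mxE.
  by apply: (uconvM nat_ultraP) => //; apply: (uconvC nat_ultraP).
exists Fl => [j|]; first exact: psd_adj_mul.
have rlim p : uconv nat_ultra (fun t => rem (Ft t) p) (rem Fl p).
  apply: (uconvB nat_ultraP); first exact: (uconv_cst nat_ultraP).
  by apply: (uconv_sum nat_ultraP) => j; apply: (uconvZ nat_ultraP).
have glim : uconv nat_ultra (fun t => fip (rem (Ft t)) (rem (Ft t))) (fip (rem Fl) (rem Fl)).
  apply: (uconv_sum nat_ultraP) => p.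
  by apply: (uconvM nat_ultraP) => //; apply: (uconvC nat_ultraP).
apply/ler_addgt0Pr => e e0; have e2 : 0 < e / 2 by rewrite divr_gt0.
have [N] := @ltr_add_invr R 0 _ e2; rewrite add0r => hN.
have PU : ProperFilter nat_ultra := @ultra_proper _ _ nat_ultraP.
have Nev : nat_ultra [set t | (N <= t)%N] by apply: nat_ultra_oo; exists N.
have [t /= [c1 Nt]] := filter_ex (filterI (glim _ e2) Nev).
have tN : t.+1%:R^-1 <= N.+1%:R^-1 :> R by rewrite lef_pV2 ?posrE// ler_nat ltnS.
have := le_lt_trans (Re_le_cabs _) c1; rewrite ReB -!/(fre _ _) -!/(fsq _).
rewrite ltr_norml => /andP[c2 c3].
have := BP t; rewrite -/(Ft t) => c4.
move: hN tN c2 c3 c4; move: (t.+1%:R^-1) (N.+1%:R^-1) => u v; rewrite -/dl; lra.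
Qed.

(** A one-sided first order condition. The restriction to t <= 1 accommodates the variation (1 - t)
    F, which stays in the cone only that far. *)
Let deriv_le0 (p q : R) : (forall t, 0 <= t -> t <= 1 -> 0 <= - 2 * t * p + t ^+ 2 * q) ->
  p <= 0.
Proof.
move=> h; rewrite leNgt; apply/negP => p0.
have q1 : 0 < `|q| + p by rewrite ltr_wpDl.
pose t := p / (`|q| + p).
have t0 : 0 < t by rewrite divr_gt0.
have t1 : t <= 1 by rewrite ler_pdivrMr // mul1r lerDr.
have tq : t * `|q| <= p.
  have : t * (`|q| + p) = p by rewrite divfK // gt_eqF.
  by rewrite mulrDr => h1; have : 0 <= t * p by [rewrite mulr_ge0 // ltW]; lra.
have := h t (ltW t0) t1.
have -> : - 2 * t * p + t ^+ 2 * q = t * (- 2 * p + t * q) by ring.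
rewrite pmulr_rge0 //.
have : t * q <= t * `|q| by rewrite ler_wpM2l ?ler_norm ?ltW.
lra.
Qed.

Let triple (G : K -> 'I_n -> 'I_n -> C) :
  \sum_(p : I) G p.1 p.2.1 p.2.2 = \sum_k \sum_a \sum_b G k a b.
Proof.
rewrite -(pair_bigA _ (fun k q => G k q.1 q.2)); apply: eq_bigr => k _.
by rewrite -(pair_bigA _ (G k)).
Qed.

(* At a minimizer [F] of the distance from [T] to the cone, the residual is a
   functional which is nonnegative on the cone and negative on [T] unless it
   vanishes. *)
Lemma psd_cone_duality :
  (forall Y : K -> 'M[C]_n,
    (forall j u, 0 <= complex.Re (dotv ((\sum_k w k j *: Y k) *m u) u)) ->
    0 <= complex.Re (\sum_k \sum_a \sum_b Y k a b * T k a b)) ->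
  exists F : J -> 'M[C]_n, (forall j, psd (F j)) /\
    forall k, T k = \sum_j w k j *: F j.
Proof.
move=> dual; have [F Fpsd Fmin] := inf_attained.
exists F; split => //.
pose r := rem F.
have var (D : J -> 'M[C]_n) :
    (forall t : R, 0 <= t -> t <= 1 -> psdf (fun j => F j + t%:C%C *: D j)) ->
    fre r (comb D) <= 0.
  move=> hD; apply: (@deriv_le0 _ (fsq (comb D))) => t t0 t1.
  have : inf vals <= fsq (rem (fun j => F j + t%:C%C *: D j)).
    apply: ge_inf; first by have [] := vals_inf.
    by exists (fun j => F j + t%:C%C *: D j) => //; exact: hD.
  have -> : rem (fun j => F j + t%:C%C *: D j) = fun p => r p - t%:C%C * comb D p.
    apply/funext => p; rewrite /r /rem /comb -addrA -opprD; congr (_ - _).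
    rewrite mulr_sumr -big_split; apply: eq_bigr => j _ /=.
    by rewrite !mxE mulrDr mulrCA.
  by rewrite fsq_sub -/r in Fmin *; lra.
have var1 j F' : psd F' -> fre r (comb (fun i => if i == j then F' else 0)) <= 0.
  move=> hF'; apply: var => t t0 _ i; apply: psdD => //.
  by case: eqP => _; rewrite ?scaler0//; apply: psdZ => //; rewrite ler0c.
have var2 : 0 <= fre r (comb F).
  have : fre r (comb (fun j => - F j)) <= 0.
    apply: var => t t0 t1 j; rewrite scalerN -{1}[F j]scale1r -scalerBl.
    by apply: psdZ => //; rewrite -(rmorph1 (real_complex R)) -rmorphB ler0c subr_ge0.
  rewrite (_ : comb _ = fun p => - comb F p); last first.
    by apply/funext => p; rewrite /comb -sumrN; apply: eq_bigr => j _; rewrite mxE mulrN.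
  rewrite /fre /fip (eq_bigr (fun p => - (r p * (comb F p)^*))); last first.
    by move=> p _; rewrite rmorphN mulrN.
  by rewrite sumrN ReN oppr_le0.
(* With this sign and conjugate, testing [Y] at a vector u gives, in real part, minus the inner
   product of the residual with the cone element of the rank one matrix [F'] built from u. *)
pose Y k : 'M[C]_n := \matrix_(a, b) - (r (k, (a, b)))^*.
have hY : 0 <= complex.Re (\sum_k \sum_a \sum_b Y k a b * T k a b).
  apply: dual => j u.
  pose F' : 'M[C]_n := \matrix_(a, b) ((u a 0)^* * u b 0).
  have F'psd : psd F'.
    have -> : F' = mxadj (u^T) *m u^T.
      by apply/matrixP => a b; rewrite !mxE big_ord1 !mxE.
    exact: psd_adj_mul.
  have -> : dotv ((\sum_k w k j *: Y k) *m u) u =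
      - (fip r (comb (fun i => if i == j then F' else 0)))^*.
    have cE p : comb (fun i => if i == j then F' else 0) p = w p.1 j * F' p.2.1 p.2.2.
      rewrite /comb (bigD1 j) //= eqxx big1 ?addr0 // => i /negPf ->.
      by rewrite mxE mulr0.
    rewrite /fip (eq_bigr (fun p => r (p.1, (p.2.1, p.2.2)) * (w p.1 j * F' p.2.1 p.2.2)^*)).
      rewrite (triple (fun k a b => r (k, (a, b)) * (w k j * F' a b)^*)) exchange_big /dotv.
      rewrite rmorph_sum -sumrN; apply: eq_bigr => a _; rewrite mxE mulr_suml.
      rewrite exchange_big rmorph_sum -sumrN; apply: eq_bigr => b _ /=.
      rewrite summxE !mulr_suml rmorph_sum -sumrN; apply: eq_bigr => k _ /=.
      have cM (x y z : C) : (x * (y * z)^*)^* = x^* * (y * z) by rewrite [LHS]rmorphM /= conjCK.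
      rewrite cM.
      by rewrite !mxE; ring.
    by move=> [k [a b]] _; rewrite cE.
  by rewrite ReN ReC oppr_ge0; exact: var1.
(* [T] is the sum of [r] and [comb F], so its pairing with [Y] is - |r|^2 - <r, comb F> in real
   part, and [var2] controls the last term. *)
have rr : fsq r <= 0.
  suff : complex.Re (\sum_k \sum_a \sum_b Y k a b * T k a b) =
      - (fsq r + fre r (comb F)) by move=> e; move: hY; rewrite e; lra.
  rewrite /fsq /fre -ReD -ReN -[RHS]ReC; congr complex.Re.
  rewrite /fip -big_split rmorphN rmorph_sum /=.
  rewrite -(triple (fun k a b => Y k a b * T k a b)) -sumrN.
  apply: eq_bigr => -[k [a b]] _; rewrite mxE /= -mulrDr -rmorphD.
  have -> : r (k, (a, b)) + comb F (k, (a, b)) = T k a b by rewrite /r /rem subrK.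
  by rewrite rmorphM /= conjCK mulNr.
move=> k; apply/matrixP => a b.
have := le_trans (cabs_le_fsq r (k, (a, b))) rr.
rewrite le_eqVlt ltNge sqr_ge0 orbF sqrf_eq0 cabs_eq0 /r /rem /comb /= subr_eq0.
by move=> /eqP ->; rewrite summxE; apply: eq_bigr => j _; rewrite mxE.
Qed.

End ConeDuality.

Section Decomposition.
Variables (R : realType) (d m : nat) (v : 'I_m.+1 -> 'rV[R[i]]_d).
Local Notation C := R[i].

Definition psd_decomposition n (X : 'I_d -> 'M[C]_n) (F : 'I_m.+1 -> 'M[C]_n) : Prop :=
  [/\ forall j, psd (F j), \sum_j F j = 1%:M &
      forall i, X i = \sum_j v j 0 i *: F j].

Definition convex_combinations : set 'rV[C]_d :=
  [set z | exists t : 'I_m.+1 -> C, [/\ forall j, 0 <= t j, \sum_j t j = 1 &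
     z = \sum_j t j *: v j]].

(** Row [ord0] of the cone problem encodes sum_j F_j = 1 and the other rows the equations for the
    X_i. A dual functional nonnegative at all v_j is an affine matrix function nonnegative on K;
    substituting N and compressing by V evaluates it at X. *)
Theorem Wmin_decomposition (K : set 'rV[C]_d) n (X : 'I_d -> 'M[C]_n.+1) :
  K `<=` convex_combinations -> Wmin K (existT _ n X) ->
  exists F, psd_decomposition X F.
Proof.
move=> Kv [L [N [Nn NK [V [Vs [V1 V2 V3]]]]]] /=.
pose w (k : 'I_d.+1) (j : 'I_m.+1) : C := if unlift ord0 k is Some i then v j 0 i else 1.
pose T (k : 'I_d.+1) : 'M[C]_n.+1 := if unlift ord0 k is Some i then X i else 1%:M.
have w0 j : w ord0 j = 1 by rewrite /w unlift_none.
have wS i j : w (lift ord0 i) j = v j 0 i by rewrite /w liftK.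
have [|F [Fpsd FT]] := @psd_cone_duality R _ _ n.+1 w T ord0 w0; last first.
  exists F; split => //.
    have := FT ord0; rewrite /T unlift_none => ->.
    by apply: eq_bigr => j _; rewrite w0 scale1r.
  move=> i; have := FT (lift ord0 i); rewrite /T liftK => ->.
  by apply: eq_bigr => j _; rewrite wS.
move=> Y hY.
have ZY z : K z -> forall u, 0 <= complex.Re
    (dotv ((Y ord0 + \sum_i z 0 i *: Y (lift ord0 i)) *m u) u).
  move=> /Kv [t [t0 t1 zE]] u.
  have -> : Y ord0 + \sum_i z 0 i *: Y (lift ord0 i) =
      \sum_j t j *: (\sum_k w k j *: Y k).
    under [RHS]eq_bigr do rewrite big_ord_recl w0 scale1r scalerDr.
    rewrite big_split /= -scaler_suml t1 scale1r; congr (_ + _).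
    under [RHS]eq_bigr do rewrite scaler_sumr.
    rewrite exchange_big; apply: eq_bigr => i _.
    rewrite zE summxE scaler_suml; apply: eq_bigr => j _.
    by rewrite mxE wS scalerA.
  rewrite mulmx_suml dotv_suml Re_sum; apply: sumr_ge0 => j _.
  rewrite -scalemxAl dotvZl (ge0_ReE (t0 j)) ReZ.
  by apply: mulr_ge0; [exact: ge0_Re|exact: hY].
(* At the images of the standard basis the Gram matrix is 1 and the compressions of the [N i] are
   the X_i, so the form is the pairing of [Y] with [T]. *)
have := normal_tuple_psd Nn NK ZY (fun a => V (delta_mx a 0)).
congr (0 <= complex.Re _).
have VN i a b : inner (N i (V (delta_mx b 0))) (V (delta_mx a 0)) = X i a b.
  by rewrite ipC V2 -V3 -dotvC mx_dotv_delta.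
have VV a b : inner (V (delta_mx b 0)) (V (delta_mx a 0)) = (1%:M : 'M[C]_n.+1) a b.
  by rewrite V1 -[X in dotv X]mul1mx mx_dotv_delta.
rewrite [RHS]big_ord_recl [X in _ = _ + X]exchange_big -big_split; apply: eq_bigr => a _.
rewrite [X in _ = _ + X]exchange_big -big_split; apply: eq_bigr => b _.
rewrite add_bopE scale_bopE bop1E ipDl ipZl VV /T unlift_none; congr (_ + _).
rewrite sum_bopE ip_suml; apply: eq_bigr => i _.
by rewrite scale_bopE ipZl VN liftK.
Qed.

Variables (H : hilbertType R) (T : 'I_d -> bop H).

(** The map A |-> sum_j s_j(A) F_j, with s_j a limit of vector states, sends T to X. Factoring F_l
    reduces its complete positivity to positivity of the operator matrix at multiples of [f l t]. *)
Theorem states_range n (X : 'I_d -> 'M[C]_n.+1) F (f : 'I_m.+1 -> nat -> H) :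
  psd_decomposition X F -> (forall j t, hnm (f j t) = 1) ->
  (forall j i, uconv nat_ultra (fun t => inner (T i (f j t)) (f j t)) (v j 0 i)) ->
  matrix_range T (existT _ n X).
Proof.
move=> [Fpsd F1 XF] f1 fT.
pose s j (A : bop H) := ulim nat_ultra (fun t => inner (A (f j t)) (f j t)).
have sP j (A : bop H) : uconv nat_ultra (fun t => inner (A (f j t)) (f j t)) (s j A).
  have [c _ Ac] := bop_bounded A.
  apply: (@ulimP _ _ _ nat_ultraP _ c) => t; apply: le_trans (cauchy_schwarz _ _) _.
  by rewrite f1 mulr1; have := Ac (f j t); rewrite f1 mulr1.
pose psi (A : bop H) : 'M[C]_n.+1 := \sum_j s j A *: F j.
have psi_lin : linear psi.
  move=> a A B; rewrite /psi scaler_sumr -big_split; apply: eq_bigr => j _ /=.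
  rewrite scalerA -scalerDl; congr (_ *: _).
  apply: (ulimE nat_ultraP).
  have := uconvD nat_ultraP (uconvZ nat_ultraP a (sP j A)) (sP j B).
  congr (uconv _ _ _); apply/funext => t.
  by rewrite add_bopE scale_bopE ipDl ipZl.
pose psiL := @GRing.isLinear.Build _ _ _ _ psi psi_lin.
pose psi' : {linear bop H -> 'M[C]_n.+1} := HB.pack psi psiL.
exists psi'; last first.
  apply/funext => i; rewrite /= XF; apply: eq_bigr => j _; congr (_ *: _).
  by apply/esym/(ulimE nat_ultraP).
split.
  rewrite -[LHS]/(psi (bop1 H)) -[RHS]F1; apply: eq_bigr => j _.
  rewrite (_ : s j _ = 1) ?scale1r //; apply: (ulimE nat_ultraP).
  have := uconv_cst nat_ultraP (1 : C); congr (uconv _ _ _); apply/funext => t.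
  by rewrite bop1E hsqE -hnm2 f1 expr1n.
move=> k A Apos x.
have -> : \sum_i \sum_j dotv (map_mx psi' A i j *m x j) (x i) =
    \sum_l \sum_i \sum_j s l (A i j) * dotv (F l *m x j) (x i).
  rewrite [RHS]exchange_big; apply: eq_bigr => i _.
  rewrite [RHS]exchange_big; apply: eq_bigr => j _.
  rewrite mxE /= /psi mulmx_suml dotv_suml; apply: eq_bigr => l _.
  by rewrite -scalemxAl dotvZl.
apply: sumr_ge0 => l _.
have [B FB] := psd_factor (Fpsd l).
have lim : uconv nat_ultra
    (fun t => \sum_i \sum_j inner (A i j (f l t)) (f l t) * dotv (F l *m x j) (x i))
    (\sum_i \sum_j s l (A i j) * dotv (F l *m x j) (x i)).
  apply: (uconv_sum nat_ultraP) => i; apply: (uconv_sum nat_ultraP) => j.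
  by apply: (uconvM nat_ultraP) => //; exact: (uconv_cst nat_ultraP).
apply: (uconv_ge0 nat_ultraP lim) => t.
have -> : \sum_i \sum_j inner (A i j (f l t)) (f l t) * dotv (F l *m x j) (x i) =
    \sum_c \sum_i \sum_j inner (A i j ((B *m x j) c 0 *: f l t)) ((B *m x i) c 0 *: f l t).
  rewrite [RHS]exchange_big; apply: eq_bigr => i _.
  rewrite [RHS]exchange_big; apply: eq_bigr => j _.
  rewrite FB -mulmxA dotv_adj mxadjK /dotv mulr_sumr; apply: eq_bigr => c _.
  by rewrite bopZ ipZl ipZr [RHS]mulrA mulrC.
by apply: sumr_ge0 => c _; exact: Apos.
Qed.

Definition positive_bop (A : bop H) : Prop := forall x, 0 <= inner (A x) x.

Lemma ucp_psd n (psi : {linear bop H -> 'M[C]_n}) A :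
  ucp psi -> positive_bop A -> psd (psi A).
Proof.
move=> [_ cp] A0 u.
have := cp 1%N (\matrix_(i < 1, j < 1) A) _ (fun=> u).
rewrite !big_ord1 !mxE; apply => x.
by rewrite !big_ord1 mxE; exact: A0.
Qed.

Theorem ucp_decomposition (P : 'I_m.+1 -> bop H) n (X : 'I_d -> 'M[C]_n.+1) :
  (forall j, positive_bop (P j)) -> \sum_j P j = bop1 H ->
  (forall i, T i = \sum_j v j 0 i *: P j) -> matrix_range T (existT _ n X) ->
  exists2 psi : {linear bop H -> 'M[C]_n.+1}, ucp psi &
    psd_decomposition X (fun j => psi (P j)).
Proof.
move=> P0 P1 TP [psi hpsi /= ->]; exists psi => //; split.
- by move=> j; exact: ucp_psd.
- by rewrite -linear_sum P1 (proj1 hpsi).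
by move=> i; rewrite TP linear_sum; apply: eq_bigr => j _; rewrite linearZ.
Qed.

End Decomposition.

(** * Polyhedra and their vertices *)

Section Polytopes.
Variables (R : realType) (d : nat).
Local Notation C := R[i].
Local Notation E := 'rV[C]_d.

Definition barycenter m (v : 'I_m -> E) (t : 'I_m -> C) : E := \sum_j t j *: v j.

Definition weights m (t : 'I_m -> C) : Prop := (forall j, 0 <= t j) /\ \sum_j t j = 1.

Definition hull m (v : 'I_m -> E) : set E :=
  [set z | exists2 t, weights t & z = barycenter v t].

Definition segment_closed (D : set E) : Prop := forall x y (t : C), D x -> D y ->
  0 <= t -> t <= 1 -> D (t *: x + (1 - t) *: y).

Lemma convex_setE (D : set E) : @convex_set C E D <-> segment_closed D.
Proof.
split=> [cD x y t Dx Dy t0 t1|cD x y l /set_mem Dx /set_mem Dy].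
  by have := cD x y (Itv01 t0 t1) (mem_set Dx) (mem_set Dy) => /set_mem.
by apply/mem_set; exact: (cD x y l%:num Dx Dy).
Qed.

Lemma hull_segment m (v : 'I_m -> E) : segment_closed (hull v).
Proof.
move=> _ _ t [a [a0 a1] ->] [b [b0 b1] ->] t0 t1.
exists (fun j => t * a j + (1 - t) * b j); first split.
- by move=> j; rewrite addr_ge0 // mulr_ge0 // subr_ge0.
- by rewrite big_split /= -!mulr_sumr a1 b1 !mulr1 addrC subrK.
rewrite /barycenter !scaler_sumr -big_split; apply: eq_bigr => j _ /=.
by rewrite [RHS]scalerDl !scalerA.
Qed.

Lemma hull_sub (D : set E) : segment_closed D ->
  forall m (v : 'I_m -> E), (forall j, D (v j)) -> hull v `<=` D.
Proof.
move=> cD; elim=> [|m IH] v Dv z [t [t0 t1] ->].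
  by move: t1; rewrite big_ord0 => /eqP; rewrite eq_sym oner_eq0.
move: t1; rewrite /barycenter !big_ord_recl => t1.
have tl0 : 0 <= \sum_(i < m) t (lift ord0 i) by exact: sumr_ge0.
have tE : \sum_(i < m) t (lift ord0 i) = 1 - t ord0 by rewrite -t1 addrC addKr.
have [t01|t01] := eqVneq (t ord0) 1.
  rewrite big1 ?addr0 ?t01 ?scale1r // => i _.
  have : \sum_(i < m) t (lift ord0 i) == 0 by rewrite tE t01 subrr.
  rewrite psumr_eq0 // => /allP /(_ i (mem_index_enum _)) /= /eqP ->.
  by rewrite scale0r.
have n0 : 1 - t ord0 != 0 by rewrite subr_eq0 eq_sym.
have -> : \sum_(i < m) t (lift ord0 i) *: v (lift ord0 i) =
    (1 - t ord0) *: barycenter (v \o lift ord0) (fun i => t (lift ord0 i) / (1 - t ord0)).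
  rewrite /barycenter scaler_sumr; apply: eq_bigr => i _.
  by rewrite scalerA mulrCA divff // mulr1.
apply: cD => //; last by rewrite -subr_ge0 -tE.
apply: (IH (v \o lift ord0)) => [j|]; first exact: Dv.
exists (fun i => t (lift ord0 i) / (1 - t ord0)) => //; split=> [j|].
  by rewrite divr_ge0 // -tE.
by rewrite -mulr_suml tE divff.
Qed.

Lemma hull_mem m (v : 'I_m -> E) j : hull v (v j).
Proof.
exists (fun i => (i == j)%:R); first split.
- by move=> i; rewrite ler0n.
- by rewrite (bigD1 j) //= eqxx big1 ?addr0 // => i /negPf ->.
by rewrite /barycenter (bigD1 j) //= eqxx scale1r big1 ?addr0 // => i /negPf ->;
  rewrite scale0r.
Qed.

Lemma weights_le1 m (t : 'I_m -> C) j : weights t -> t j <= 1.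
Proof. by move=> [t0 <-]; rewrite (bigD1 j) //= lerDl sumr_ge0. Qed.

Lemma weights_eq1 m (t : 'I_m -> C) j : weights t -> t j = 1 ->
  forall i, i != j -> t i = 0.
Proof.
move=> [t0 t1] tj i ij.
have : \sum_(k | k != j) t k == 0.
  by move: t1; rewrite (bigD1 j) //= tj => h; apply/eqP/(addrI 1); rewrite addr0.
by rewrite psumr_eq0 // => /allP /(_ i (mem_index_enum _)); rewrite ij => /eqP.
Qed.

Lemma barycenter_eq1 m (v : 'I_m -> E) t j : weights t -> t j = 1 -> barycenter v t = v j.
Proof.
move=> wt tj; rewrite /barycenter (bigD1 j) //= tj scale1r big1 ?addr0 // => i ij.
by rewrite (weights_eq1 wt tj ij) scale0r.
Qed.

Lemma barycenter_split m (v : 'I_m.+1 -> E) t j : weights t -> t j != 1 ->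
  exists2 y, hull (v \o lift j) y & barycenter v t = t j *: v j + (1 - t j) *: y.
Proof.
move=> wt tj; have [t0 t1] := wt.
have n0 : 1 - t j != 0 by rewrite subr_eq0 eq_sym.
have tE : \sum_i t (lift j i) = 1 - t j.
  by rewrite -t1 [in RHS](bigD1_ord j) //= [RHS]addrC addKr.
exists (barycenter (v \o lift j) (fun i => t (lift j i) / (1 - t j))).
  exists (fun i => t (lift j i) / (1 - t j)) => //; split=> [i|].
    by rewrite divr_ge0 // -tE sumr_ge0.
  by rewrite -mulr_suml tE divff.
rewrite /barycenter (bigD1_ord j) //=; congr (_ + _); rewrite scaler_sumr.
by apply: eq_bigr => i _; rewrite scalerA mulrCA divff // mulr1.
Qed.

(** A weight t_j other than 0 and 1 puts z strictly between v_j and another point of the hull, and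
    extremality then gives z = v_j. *)
Lemma vertex_hull m (v : 'I_m -> E) z : vertices (hull v) z -> exists j, z = v j.
Proof.
case: m v => [|m] v [[t wt zE] zext].
  by have [_] := wt; rewrite big_ord0 => /eqP; rewrite eq_sym oner_eq0.
have [t0 t1] := wt.
have [j tj] : exists j, t j != 0.
  apply/existsP; apply: contraT; rewrite negb_exists => /forallP h.
  have : \sum_j t j = 0 by apply: big1 => j _; apply/eqP; have := h j; rewrite negbK.
  by rewrite t1 => /eqP; rewrite oner_eq0.
exists j; have [tj1|tj1] := eqVneq (t j) 1; first by rewrite zE (barycenter_eq1 v wt tj1).
have [y hy yE] := barycenter_split v wt tj1.
have hy' : hull v y.
  apply: (hull_sub (hull_segment (v := v)) (v := v \o lift j)) hy => i.
  exact: hull_mem.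
have := zext (v j) y (Itv01 (t0 j) (weights_le1 j wt)) (hull_mem v j) hy'.
case=> //=.
- by rewrite lt_neqAle eq_sym tj t0.
- by rewrite lt_neqAle tj1 (weights_le1 j wt).
by rewrite zE yE.
Qed.

(** Phrased through weights because a point of the matrix range at level 1 delivers exactly such
    weights. It also forces the v_j to be distinct. *)
Definition extreme_family m (v : 'I_m -> E) : Prop :=
  forall j t, weights t -> v j = barycenter v t -> t j = 1.

(** A generating family of least size is irredundant: a representation of v_j with t_j different
    from 1 can be solved for v_j in terms of the others, and v_j could be dropped. All vertices
    occur in the family, which yields its three members and the position of 0. *)
Theorem polyhedron_extreme_family (K : set E) : polyhedron K ->
  (`I_3 #<= vertices K)%card -> vertices K 0 ->
  exists m (v : 'I_m.+3 -> E), [/\ v ord0 = 0, K = hull v & extreme_family v].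
Proof.
move=> [P /finite_seqP [s sP] KP] K3 K0.
pose Q m := `[< exists v : 'I_m -> E, K = hull v >].
have exQ : exists m, Q m.
  exists (size s); apply/asboolP; exists (fun j => nth 0 s j); rewrite KP.
  apply/seteqP; split.
    apply: smallest_sub; first exact/convex_setE/hull_segment.
    move=> x; rewrite sP => /= xs.
    have sx : (index x s < size s)%N by rewrite index_mem.
    by have := hull_mem (fun j : 'I_(size s) => nth 0 s j) (Ordinal sx); rewrite /= nth_index.
  apply: hull_sub => [|j].
    by apply/convex_setE => x y l /set_mem Kx /set_mem Ky; apply/mem_set => D DP;
      apply/set_mem/(proj1 DP); apply/mem_set; [exact: Kx|exact: Ky].
  by move=> D [_]; apply; rewrite sP /=; apply: mem_nth.
have [m /asboolP [v0 Kv0] mmin] := ex_minnP exQ.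
have m3 : (2 < m)%N.
  rewrite -card_le_II; apply: card_le_trans K3 _.
  apply: (@card_le_trans _ _ _ (v0 @` [set: 'I_m])).
    apply: subset_card_le => z; rewrite Kv0 => /vertex_hull [j ->].
    by exists j.
  by apply: card_le_trans (card_image_le _ _) _; rewrite (card_le_eql (card_esym card_II)).
case: m m3 v0 Kv0 mmin => [|[|[|m]]] // _ v0 Kv0 mmin.
have [j0 j0E] : exists j, 0 = v0 j by apply: vertex_hull; rewrite -Kv0.
pose v := v0 \o tperm ord0 j0.
have Kv : K = hull v.
  rewrite Kv0; apply/seteqP; split; apply: hull_sub; try exact: hull_segment.
    move=> j; have -> : v0 j = v (tperm ord0 j0 j) by rewrite /v /= tpermK.
    exact: hull_mem.
  by move=> j; exact: hull_mem.
exists m, v; split => //; first by rewrite /v /= tpermL.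
move=> j t wt vj; apply/eqP; apply: contraT => tj.
have [y hy yE] := barycenter_split v wt tj.
have hvj : hull (v \o lift j) (v j).
  suff -> : v j = y by [].
  have n0 : 1 - t j != 0 by rewrite subr_eq0 eq_sym.
  move/eqP: vj; rewrite yE -subr_eq0 opprD addrA -{1}[v j]scale1r -scalerBl.
  rewrite -scalerBr scaler_eq0 (negPf n0) /= subr_eq0 => /eqP //.
suff : Q m.+2 by move=> /mmin; rewrite ltnn.
apply/asboolP; exists (v \o lift j); rewrite Kv.
apply/seteqP; split; apply: hull_sub; try exact: hull_segment.
  move=> i; case: (unliftP j i) => [k ->|->] //.
  exact: (hull_mem (v \o lift j)).
by move=> i; exact: hull_mem.
Qed.

End Polytopes.

(** * Real linear functionals separating two vertices *)

Section RealFunctionals.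
Variables (R : realType) (d : nat).
Local Notation C := R[i].
Local Notation E := 'rV[C]_d.

(** Every real linear functional on C^d has this form. Convexity is over the reals, so vertices may
    be complex multiples of each other, and only real functionals can tell such vertices apart. *)
Definition refun (c z : E) : R := complex.Re (\sum_i c 0 i * z 0 i).

(** On a real line through 0 the middle one of 0, v_i, v_j would be a convex combination of the
    other two: it is 0 if r < 0, v_i if 0 <= r <= 1, and v_j if r > 1. *)
Lemma extreme_no_multiple m (v : 'I_m.+1 -> E) i j (r : R) :
  extreme_family v -> v ord0 = 0 -> i != j -> i != ord0 -> j != ord0 ->
  v i <> r%:C%C *: v j.
Proof.
have inv01 (x : R) : 1 <= x -> [/\ 0 <= x^-1, x^-1 <= 1 & x^-1 * x = 1].
  move=> x1; have x0 : 0 < x by lra.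
  by split; rewrite ?invr_ge0 ?(ltW x0) ?invf_le1 // mulVf // gt_eqF.
have neg_case : r < 0 -> 1 <= 1 - r /\ (1 - r)^-1 * r + (1 - (1 - r)^-1) = 0.
  move=> r0; split; first by lra.
  have [_ _] := inv01 (1 - r) ltac:(lra).
  by set q := (1 - r)^-1; lra.
have pos_case : 1 < r -> 1 <= r by exact: ltW.
move=> ext v0 ij i0 j0 vij.
have two (a b k : 'I_m.+1) (s : R) : a != b -> k != a -> k != b -> 0 <= s -> s <= 1 ->
    v k = s%:C%C *: v a + (1 - s)%:C%C *: v b -> False.
  move=> ab ka kb s0 s1 vk.
  pose t l : C := if l == a then s%:C%C else if l == b then (1 - s)%:C%C else 0.
  have ba : (b == a) = false by rewrite eq_sym (negPf ab).
  have wt : weights t.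
    split=> [l|].
      rewrite /t; case: (l == a); first by rewrite ler0c.
      by case: (l == b); rewrite ?ler0c ?subr_ge0.
    rewrite (bigD1 a) //= (bigD1 b) /= ?ba //= big1 => [|l /andP[/negPf la /negPf lb]].
      by rewrite /t eqxx ba eqxx addr0 -rmorphD addrC subrK.
    by rewrite /t la lb.
  have : t k = 1.
    apply: ext wt _; rewrite vk /barycenter (bigD1 a) //= (bigD1 b) /= ?ba //=.
    rewrite big1 => [|l /andP[/negPf la /negPf lb]]; first by rewrite /t eqxx ba eqxx addr0.
    by rewrite /t la lb scale0r.
  by rewrite /t (negPf ka) (negPf kb) => /eqP; rewrite eq_sym oner_eq0.
have [r0|r0] := ltP r 0.
  have [r1 re] := neg_case r0; have [q0 q1 _] := inv01 _ r1.
  apply: (two i j ord0 (1 - r)^-1) => //; rewrite 1?eq_sym //.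
  by rewrite v0 vij scalerA -scalerDl -rmorphM -rmorphD /= re scale0r.
have [r1|r1] := leP r 1.
  apply: (two j ord0 i r) => //.
  by rewrite v0 scaler0 addr0.
have [q0 q1 qr] := inv01 _ (pos_case r1).
apply: (two i ord0 j r^-1) => //; rewrite 1?eq_sym //.
by rewrite v0 scaler0 addr0 vij scalerA -rmorphM /= qr scale1r.
Qed.

(** The component of a orthogonal to b for the real inner product is nonzero; c is the pairing with
    it, divided by its square norm. *)
Lemma dual_functional (a b : E) : (forall r : R, a <> r%:C%C *: b) ->
  exists c, refun c a = 1 /\ refun c b = 0.
Proof.
move=> nab; pose rip (z w : E) := complex.Re (\sum_i z 0 i * (w 0 i)^*).
have ripP (s : R) z z' w : rip (z - s%:C%C *: z') w = rip z w - s * rip z' w.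
  rewrite /rip -[s * _]ReZ -ReB mulr_sumr -sumrB; congr complex.Re.
  by apply: eq_bigr => i _; rewrite !mxE mulrBl mulrA.
have ripC z w : rip z w = rip w z.
  rewrite /rip -ReC rmorph_sum; congr complex.Re; apply: eq_bigr => i _.
  by rewrite rmorphM /= conjCK mulrC.
have rip_gt0 z : z != 0 -> 0 < rip z z.
  move=> z0; have [i zi] : exists i, z 0 i != 0.
    apply/existsP; apply: contraNT z0; rewrite negb_exists => /forallP h.
    by apply/eqP/rowP => i; rewrite mxE; apply/eqP; have := h i; rewrite negbK.
  rewrite /rip Re_sum (bigD1 i) //= ltr_pwDl ?sumr_ge0 //.
    rewrite mul_conjE /= exprn_gt0 // lt_neqAle eq_sym cabs_eq0 zi.
    exact: cabs_ge0.
  by move=> j _; rewrite mul_conjE /= sqr_ge0.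
pose w := a - (rip a b / rip b b)%:C%C *: b.
have w0 : w != 0 by rewrite subr_eq0; apply/eqP/nab.
have wb : rip b w = 0.
  rewrite ripC /w ripP; have [->|b0] := eqVneq b 0.
    rewrite [rip 0 0]/rip big1 ?mulr0 ?subr0 /rip ?big1 // => i _;
      by rewrite mxE ?conjC0 ?mulr0 ?mul0r.
  by rewrite divfK ?subrr // gt_eqF // rip_gt0.
have aw : rip a w = rip w w.
  by rewrite [in RHS]/w ripP wb mulr0 subr0.
have ww := rip_gt0 w w0.
have cE z : refun (\row_i ((rip w w)^-1%:C%C * (w 0 i)^*)) z = (rip w w)^-1 * rip z w.
  rewrite /refun /rip -ReZ mulr_sumr; congr complex.Re; apply: eq_bigr => i _.
  by rewrite mxE -mulrA; congr (_ * _); rewrite mulrC.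
exists (\row_i ((rip w w)^-1%:C%C * (w 0 i)^*)); split; rewrite cE.
  by rewrite aw mulVf // gt_eqF.
by rewrite wb mulr0.
Qed.

End RealFunctionals.

(** * Orthonormal bases and diagonal operators *)

Section OrthonormalBasis.
Variables (R : realType) (H : hilbertType R).
Local Notation C := R[i].

Definition orthonormal_basis (e : nat -> H) : Prop :=
  (forall k l, inner (e k) (e l) = (k == l)%:R) /\
  (forall x, (forall k, inner x (e k) = 0) -> x = 0).

Let residual (s : seq H) (x : H) : H := x - \sum_(y <- s) inner x y *: y.

(** Gram-Schmidt on a dense sequence, skipping vectors already in the span of those chosen. The
    process never stops: otherwise a dense set, and by the bound on [res n] all of H, would lie in a
    finite dimensional span. *)
Lemma orthonormal_basis_exists :
  separable_space H -> infinite_dimensional H -> exists e, orthonormal_basis e.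
Proof.
move=> [D Dc Dd] Hinf.
have [dn dnP] : exists dn : nat -> H, forall x, D x -> exists n, dn n = x.
  have /countable_injP [f finj] := Dc.
  exists (fun n => xget 0 [set x | D x /\ f x = n]) => x Dx; exists (f x).
  case: xgetP => [y _ [Dy fy]|/(_ x)]; last by case.
  by apply: finj => //; exact/mem_set.
have dense_dn x (eps : R) : 0 < eps -> exists n, hnm (x - dn n) < eps.
  move=> eps0; have ec : 0 < eps%:C%C by rewrite ltcR.
  have [y [By Dy]] : ball x eps%:C%C `&` D !=set0.
    apply: Dd; first by exists x; exact: ballxx.
    exact: ball_open.
  have [n dy] := dnP y Dy; exists n.
  by move: By; rewrite -ball_normE /= normhE ltcR dy.
pose next (s : seq H) : H := xget 0 [set x | exists j, [/\ residual s (dn j) != 0,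
  forall i, (i < j)%N -> residual s (dn i) = 0 &
  x = (hnm (residual s (dn j)))^-1%:C%C *: residual s (dn j)]].
pose S := fix S n := if n is n'.+1 then rcons (S n') (next (S n')) else [::].
pose e n := next (S n).
have SE n : S n = mkseq e n.
  elim: n => [|n IH] //=; rewrite -[RHS]/(map e (iota 0 n.+1)) -addn1 iotaD map_cat /=.
  by rewrite -/(mkseq e n) -IH cats1 add0n.
pose res n x := x - \sum_(i < n) inner x (e i) *: e i.
have resE n x : residual (S n) x = res n x.
  rewrite /residual /res SE big_map -[n in iota 0 n]subn0 -/(index_iota 0 n).
  by rewrite big_mkord.
have resS n x : res n.+1 x = res n x - inner x (e n) *: e n.
  by rewrite /res big_ord_recr /= opprD addrA.
pose ON n := forall k l, (k < n)%N -> (l < n)%N -> inner (e k) (e l) = (k == l)%:R.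
have res_orth n : ON n -> forall x k, (k < n)%N -> inner (res n x) (e k) = 0.
  move=> on x k kn; rewrite /res ipBl ip_suml (bigD1 (Ordinal kn)) //= ipZl on //.
  rewrite eqxx mulr1 big1 ?addr0 ?subrr // => i; rewrite -val_eqE /= => /negPf ik.
  by rewrite ipZl on // ik mulr0.
have e_hnm n : ON n -> forall k, (k < n)%N -> hnm (e k) = 1.
  by move=> on k kn; rewrite /hnm /hsq on // eqxx sqrtr1.
have res_bound n : ON n -> forall x, hnm (res n x) <= (1 + n%:R) * hnm x.
  move=> on x; rewrite /res; apply: le_trans (hnmB _ _) _.
  rewrite mulrDl mul1r lerD2l; apply: le_trans (hnm_sum _ _ _) _.
  rewrite -[n in n%:R]card_ord -sum1_card natr_sum mulr_suml ler_sum // => i _.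
  rewrite mul1r hnmZ (e_hnm n on) // mulr1; apply: le_trans (cauchy_schwarz _ _) _.
  by rewrite (e_hnm n on) // mulr1.
have resB n x y : res n (x - y) = res n x - res n y.
  rewrite /res; have -> : \sum_(i < n) inner (x - y) (e i) *: e i =
      \sum_(i < n) inner x (e i) *: e i - \sum_(i < n) inner y (e i) *: e i.
    by rewrite -sumrB; apply: eq_bigr => i _; rewrite ipBl scalerBl.
  by rewrite !opprB addrACA [RHS]addrACA; congr (_ + _); exact: addrC.
have exj n : ON n -> exists j, residual (S n) (dn j) != 0.
  move=> on; apply: contrapT => /forallNP hj.
  have r0 j : res n (dn j) = 0.
    by rewrite -resE; apply/eqP/negPn/negP; exact: hj.
  apply: Hinf; exists n, (fun i : 'I_n => e i) => x; exists (fun i => inner x (e i)).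
  apply/eqP; rewrite -subr_eq0 -/(res n x) -hnm_eq0; apply/eqP/le_anti.
  rewrite hnm_ge0 andbT; apply/ler_addgt0Pr => eps eps0; rewrite add0r.
  have n1 : 0 < 1 + n%:R :> R by rewrite ltr_wpDr.
  have [j hjx] := dense_dn x _ (divr_gt0 eps0 n1).
  have := res_bound n on (x - dn j); rewrite resB r0 subr0 => h; apply: le_trans h _.
  by rewrite mulrC -ler_pdivlMr // ltW.
have nextP n : ON n -> exists j, [/\ res n (dn j) != 0,
    forall i, (i < j)%N -> res n (dn i) = 0 &
    e n = (hnm (res n (dn j)))^-1%:C%C *: res n (dn j)].
  move=> /exj ex; have [j jP jmin] := ex_minnP ex.
  rewrite /e /next.
  case: xgetP => [x _ [i [i1 i2 i3]]|
    /(_ ((hnm (residual (S n) (dn j)))^-1%:C%C *: residual (S n) (dn j)))].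
    by exists i; rewrite -!resE; split => // k ki; rewrite -resE; exact: i2.
  case; exists j; split => // i ij; apply/eqP/negPn/negP => /jmin.
  by rewrite leqNgt ij.
have ONn n : ON n.
  elim: n => [|n on] // k l.
  have [j [r0 _ enE]] := nextP n on.
  have rn : hnm (res n (dn j)) != 0 by rewrite hnm_eq0.
  have eo i : (i < n)%N -> inner (e n) (e i) = 0.
    by move=> i_n; rewrite enE ipZl res_orth // mulr0.
  have en : inner (e n) (e n) = 1.
    rewrite hsqE -hnm2 enE hnmZ cabsR ger0_norm ?invr_ge0 ?hnm_ge0//.
    by rewrite mulVf // expr1n.
  rewrite !ltnS [(k <= n)%N]leq_eqVlt [(l <= n)%N]leq_eqVlt.
  move=> /predU1P[->|kn] /predU1P[->|ln].
  - by rewrite eqxx en.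
  - by rewrite eo // gtn_eqF.
  - by rewrite ipC eo // conjC0 ltn_eqF.
  exact: on.
have inv n : forall j, (j < n)%N -> res n (dn j) = 0.
  elim: n => [|n IH] // j jn.
  have [j0 [r0 rlt enE]] := nextP n (ONn n).
  have j0n : (n <= j0)%N.
    by rewrite leqNgt; apply/negP => /IH h; move: r0; rewrite h eqxx.
  have rn : hnm (res n (dn j0)) != 0 by rewrite hnm_eq0.
  have dE x : x = res n x + \sum_(i < n) inner x (e i) *: e i by rewrite /res subrK.
  have ipe x : inner x (e n) = inner (res n x) (e n).
    rewrite {1}[x]dE ipDl ip_suml big1 ?addr0 // => i _.
    by rewrite ipZl (ONn n.+1) // ?ltnS ?(ltnW (ltn_ord i)) // ltn_eqF ?mulr0.
  rewrite resS ipe; case: (ltngtP j j0) => [/rlt ->|jj|->].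
  - by rewrite ip0l scale0r subr0.
  - by move: (leq_ltn_trans j0n jj); rewrite ltnNge -ltnS jn.
  rewrite enE ipZr hsqE -hnm2 scalerA.
  have -> : (((hnm (res n (dn j0)))^-1%:C%C)^* : C) = ((hnm (res n (dn j0)))^-1)%:C%C.
    exact: conjc_real.
  rewrite mulrAC -!rmorphM /= -expr2 -exprMn mulVf // expr1n.
  by rewrite scale1r subrr.
exists e; split.
  by move=> k l; apply: (ONn (maxn k l).+1); rewrite ltnS ?leq_maxl ?leq_maxr.
move=> x xe.
have xd j : inner x (dn j) = 0.
  have := inv j.+1 j (ltnSn j); rewrite /res => /eqP; rewrite subr_eq0 => /eqP ->.
  by rewrite ip_sumr big1 // => i _; rewrite ipZr xe mulr0.
apply/eqP; rewrite -hnm_eq0; apply: contraT => x0.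
have xp : 0 < hnm x by rewrite lt_neqAle eq_sym x0 hnm_ge0.
have [j hj] := dense_dn x _ xp.
(* As x is orthogonal to all [dn j], |x|^2 = <x, x - dn j>, which is impossible once [dn j] is
   closer to x than |x|. *)
have : hsq x <= hnm x * hnm (x - dn j).
  have -> : hsq x = complex.Re (inner x (x - dn j)) by rewrite ipBr xd subr0.
  exact: re_cauchy_schwarz.
by rewrite -hnm2 expr2 ler_pM2l // leNgt hj.
Qed.

End OrthonormalBasis.

Section BasisOperators.
Variables (R : realType) (H : hilbertType R) (e : nat -> H).
Hypothesis eb : orthonormal_basis e.
Local Notation C := R[i].

Lemma onbE k l : inner (e k) (e l) = (k == l)%:R. Proof. exact: (proj1 eb). Qed.

Lemma onb_hnm k : hnm (e k) = 1.
Proof. by rewrite /hnm /hsq onbE eqxx sqrtr1. Qed.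

Lemma onb_eq x y : (forall k, inner x (e k) = inner y (e k)) -> x = y.
Proof.
move=> h; apply/eqP; rewrite -subr_eq0; apply/eqP/(proj2 eb) => k.
by rewrite ipBl h subrr.
Qed.

(** Geometric decay makes the partial sums Cauchy by the triangle inequality; the explicit tail
    later yields compactness of diagonal operators. *)
Lemma series_exists (c : nat -> C) (K : R) :
  (forall k, cabs (c k) <= K * 2^-1 ^+ k) ->
  exists s, [/\ forall k, inner s (e k) = c k, hnm s <= 2 * K &
    forall n, hnm (s - \sum_(k < n) c k *: e k) <= 2 * K * 2^-1 ^+ n].
Proof.
move=> cK; pose u n := \sum_(k < n) c k *: e k.
have K0 : 0 <= K by have := cK 0%N; rewrite expr0 mulr1; apply: le_trans; exact: cabs_ge0.
have h0 n : 0 <= 2^-1 ^+ n :> R by rewrite exprn_ge0.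
have ud p n : hnm (u (p + n)%N - u p) <= 2 * K * (2^-1 ^+ p - 2^-1 ^+ (p + n)).
  elim: n => [|n IH]; first by rewrite addn0 !subrr hnm0 mulr0.
  rewrite addnS /u big_ord_recr /= -/(u _) addrAC; apply: le_trans (hnmD _ _) _.
  rewrite hnmZ onb_hnm mulr1 exprS; have := cK (p + n)%N; move: IH.
  set a := 2^-1 ^+ p; set b := 2^-1 ^+ (p + n); move=> h1 h2.
  have : K * b = 2 * K * (b - 2^-1 * b) by field.
  lra.
have ud' p n : (p <= n)%N -> hnm (u n - u p) <= 2 * K * 2^-1 ^+ p.
  move=> pn; have := ud p (n - p)%N; rewrite subnKC // => h; apply: le_trans h _.
  by rewrite ler_wpM2l ?mulr_ge0 // gerBl.
have [eps eps0|s us] := @hilbert_complete _ _ u.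
  have [N hN] : exists N, 2 * (2 * K * 2^-1 ^+ N) < eps.
    have K1 : 0 < 4 * K + 1 by lra.
    have [N] := @ltr_add_invr R 0 (eps / (4 * K + 1)) (divr_gt0 eps0 K1).
    rewrite add0r ltr_pdivlMr // => hN; exists N.+1.
    have hp : 2^-1 ^+ N.+1 <= N.+1%:R^-1 :> R.
      rewrite exprVn lef_pV2 ?posrE ?exprn_gt0 ?ltr0n//.
      by rewrite -natrX ler_nat ltnW // ltn_expl.
    have := ler_wpM2l (_ : 0 <= 4 * K) hp; move: hN.
    have i0 : 0 < N.+1%:R^-1 :> R by rewrite invr_gt0.
    move: i0; move: (N.+1%:R^-1) (2^-1 ^+ N.+1) => x y i0 h1 /(_ _) h2.
    have := h2 ltac:(lra); lra.
  exists N => n p Nn Np.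
  rewrite (_ : u n - u p = (u n - u N) - (u p - u N)); last by rewrite opprB addrA subrK.
  apply: le_lt_trans (hnmB _ _) _; have := ud' _ _ Nn; have := ud' _ _ Np; lra.
have tail n : hnm (s - u n) <= 2 * K * 2^-1 ^+ n.
  have us' : hlim (fun p => u (n + p)%N) s.
    by move=> eps /us [N hN]; exists N => p Np; apply: hN; exact: leq_trans (leq_addl _ _).
  by apply: (hlim_le us') => p; apply: ud'; exact: leq_addr.
exists s; split => //; last by have := tail 0%N; rewrite /u big_ord0 subr0 expr0 mulr1.
move=> k; apply/eqP; rewrite -subr_eq0 -cabs_eq0; apply/eqP/le_anti.
rewrite cabs_ge0 andbT; apply/ler_addgt0Pr => eps eps0; rewrite add0r.
have [N hN] := hlim_ip (e k) us eps0.
have := hN (maxn N k.+1) (leq_maxl _ _).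
have -> : inner (u (maxn N k.+1)) (e k) = c k.
  have kn : (k < maxn N k.+1)%N by rewrite leq_max ltnSn orbT.
  rewrite /u ip_suml (bigD1 (Ordinal kn)) //= ipZl onbE eqxx mulr1 big1 ?addr0 // => i.
  by rewrite -val_eqE ipZl onbE /= => /negPf ->; rewrite mulr0.
by rewrite -cabsN opprB => /ltW.
Qed.

Lemma cabs_ip_onb x k : cabs (inner x (e k)) <= hnm x.
Proof. by apply: le_trans (cauchy_schwarz _ _) _; rewrite onb_hnm mulr1. Qed.

Lemma diagonal_exists (b : nat -> R) (K : R) :
  (forall k, `|b k| <= K * 2^-1 ^+ k) ->
  exists B : bop H, [/\ forall x k, inner (B x) (e k) = (b k)%:C%C * inner x (e k),
    forall x, hnm (B x) <= 2 * K * hnm x & forall n x,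
    hnm (B x - \sum_(k < n) ((b k)%:C%C * inner x (e k)) *: e k) <=
      2 * K * hnm x * 2^-1 ^+ n].
Proof.
move=> bK.
have /choice [f fP] : forall x, exists s,
    [/\ forall k, inner s (e k) = (b k)%:C%C * inner x (e k), hnm s <= 2 * (K * hnm x) &
    forall n, hnm (s - \sum_(k < n) ((b k)%:C%C * inner x (e k)) *: e k) <=
      2 * (K * hnm x) * 2^-1 ^+ n].
  move=> x; apply: series_exists => k; rewrite cabsM cabsR mulrAC.
  by rewrite ler_pM ?cabs_ge0 ?cabs_ip_onb.
have lf : linear f.
  move=> a x y; apply: onb_eq => k.
  by rewrite ipDl ipZl !(let: And3 h _ _ := fP _ in h) ipDl ipZl mulrDr mulrCA.
have bf x : hnm (f x) <= 2 * K * hnm x.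
  by have [_ h _] := fP x; rewrite -mulrA.
exists (mk_bop lf bf); split => [x k|x|n x].
- by have [h _ _] := fP x; exact: h.
- exact: bf.
by have [_ _ h] := fP x; rewrite -[2 * K * _]mulrA; exact: h.
Qed.

Lemma rank1_exists (y z : H) : exists A : bop H, forall x, A x = inner x y *: z.
Proof.
have lf : linear (fun x => inner x y *: z).
  by move=> a u w; rewrite ipDl ipZl scalerDl scalerA.
have bf x : hnm (inner x y *: z) <= hnm y * hnm z * hnm x.
  rewrite hnmZ mulrAC ler_wpM2r ?hnm_ge0 // [leRHS]mulrC; exact: cauchy_schwarz.
by exists (mk_bop lf bf).
Qed.

Definition rank1 (y z : H) : bop H := sval (cid (rank1_exists y z)).
Lemma rank1E y z x : rank1 y z x = inner x y *: z.
Proof. by rewrite /rank1; case: cid => A /= ->. Qed.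

End BasisOperators.

(** * Compact operators *)

Section UltraCompact.
Variables (R : realType) (H : hilbertType R).
Local Notation C := R[i].

(* Stability under sums, products and limits is immediate in this form. *)
Definition ultra_compact (A : bop H) : Prop :=
  forall F : set_system H, UltraFilter F -> F [set x | hnm x <= 1] ->
  exists l, forall eps : R, 0 < eps -> F [set x | hnm (A x - l) < eps].

Lemma ultra_compactD A B : ultra_compact A -> ultra_compact B -> ultra_compact (A + B).
Proof.
move=> hA hB F FU F1; have [l hl] := hA F FU F1; have [k hk] := hB F FU F1.
have FF : ProperFilter F := @ultra_proper _ _ FU.
exists (l + k) => eps eps0; have e2 : 0 < eps / 2 by rewrite divr_gt0.
apply: filterS (filterI (hl _ e2) (hk _ e2)) => x [/= h1 h2].
change (hnm ((A + B) x - (l + k)) < eps).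
rewrite add_bopE opprD addrACA; apply: le_lt_trans (hnmD _ _) _; lra.
Qed.

Lemma ultra_compactM A B : ultra_compact B -> ultra_compact (bopM A B).
Proof.
move=> hB F FU F1; have [l hl] := hB F FU F1.
have FF : ProperFilter F := @ultra_proper _ _ FU.
have [c c0 Ac] := bop_bounded A; have c1 : 0 < c + 1 by lra.
exists (A l) => eps eps0; apply: filterS (hl _ (divr_gt0 eps0 c1)) => x /=.
rewrite ltr_pdivlMr // => h; rewrite -bopB; apply: le_lt_trans (Ac _) _.
by have := hnm_ge0 (B x - l); lra.
Qed.

Lemma ultra_compactZ a A : ultra_compact A -> ultra_compact (a *: A).
Proof.
move=> hA; have -> : a *: A = bopM (a *: bop1 H) A by exact: bopP.
exact: ultra_compactM.
Qed.

Lemma ultra_compact_rank1 y z : ultra_compact (rank1 y z).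
Proof.
move=> F FU F1; have FF : ProperFilter F := @ultra_proper _ _ FU.
have [l hl] : exists l, uconv F (fun x => inner x y) l.
  apply: (@uconv_bounded _ _ _ FU _ (hnm y)); apply: filterS F1 => x /= x1.
  apply: le_trans (cauchy_schwarz _ _) _.
  by rewrite -[leRHS]mul1r ler_wpM2r ?hnm_ge0.
have c1 : 0 < hnm z + 1 by rewrite ltr_wpDl ?hnm_ge0.
exists (l *: z) => eps eps0; apply: filterS (hl _ (divr_gt0 eps0 c1)) => x /=.
rewrite ltr_pdivlMr // rank1E -scalerBl hnmZ => h.
by have := cabs_ge0 (inner x y - l); lra.
Qed.

Lemma ultra_compact0 : ultra_compact 0.
Proof.
move=> F FU _; exists 0 => eps eps0; have FF : ProperFilter F := @ultra_proper _ _ FU.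
apply: filterE => x; change (hnm ((0 : bop H) x - 0) < eps).
by rewrite zero_bopE subrr hnm0.
Qed.

Lemma ultra_compact_sum I (r : seq I) (A : I -> bop H) :
  (forall i, ultra_compact (A i)) -> ultra_compact (\sum_(i <- r) A i).
Proof.
move=> hA; elim/big_rec: _ => [|i B _ hB]; first exact: ultra_compact0.
exact: ultra_compactD.
Qed.

(** The limits of approximants with error 1/(n+1) form a Cauchy sequence, since any two are compared
    at a common point of the filter; its limit serves for [A]. *)
Lemma ultra_compact_limit (A : bop H) : (forall eps : R, 0 < eps -> exists2 B, ultra_compact B &
    forall x, hnm (A x - B x) <= eps * hnm x) -> ultra_compact A.
Proof.
move=> hA F FU F1; have FF : ProperFilter F := @ultra_proper _ _ FU.
have inv0 n : 0 < n.+1%:R^-1 :> R by rewrite invr_gt0.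
have /choice [l hl] : forall n : nat, exists l,
    F [set x | hnm (A x - l) < 2 * n.+1%:R^-1].
  move=> n; have [B hB AB] := hA _ (inv0 n); have [l lP] := hB F FU F1.
  exists l; apply: filterS (filterI F1 (lP _ (inv0 n))) => x /= [x1 h].
  rewrite (_ : A x - l = (A x - B x) + (B x - l)); last by rewrite addrA subrK.
  apply: le_lt_trans (hnmD _ _) _.
  have : n.+1%:R^-1 * hnm x <= n.+1%:R^-1 by rewrite -[leRHS]mulr1 ler_wpM2l // ltW.
  have := AB x; move: h; move: (n.+1%:R^-1) => i; lra.
have small (eps : R) : 0 < eps -> exists N, forall n, (N <= n)%N -> 2 * n.+1%:R^-1 < eps.
  move=> eps0; have e2 : 0 < eps / 2 by rewrite divr_gt0.
  have [N] := @ltr_add_invr R 0 _ e2; rewrite add0r => hN.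
  exists N => n Nn; have : n.+1%:R^-1 <= N.+1%:R^-1 :> R by rewrite lef_pV2 ?posrE// ler_nat ltnS.
  by move: hN; move: (n.+1%:R^-1) (N.+1%:R^-1) => i j; lra.
have [eps eps0|L hL] := @hilbert_complete _ _ l.
  have [N hN] := small _ (divr_gt0 eps0 (ltr0n _ 2)).
  exists N => n p Nn Np.
  have [x /= [h1 h2]] := filter_ex (filterI (hl n) (hl p)).
  rewrite (_ : l n - l p = (A x - l p) - (A x - l n)); last by rewrite opprB [RHS]addrC addrA subrK.
  apply: le_lt_trans (hnmB _ _) _; move: h1 h2 (hN _ Nn) (hN _ Np).
  by move: (n.+1%:R^-1) (p.+1%:R^-1) => i j; lra.
exists L => eps eps0; have e2 : 0 < eps / 2 by rewrite divr_gt0.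
have [N hN] := small _ e2; have [M hM] := hL _ e2.
have := hN (maxn N M) (leq_maxl _ _); have := hM (maxn N M) (leq_maxr _ _).
set n := maxn N M => h1 h2; apply: filterS (hl n) => x /= h3.
rewrite (_ : A x - L = (A x - l n) + (l n - L)); last by rewrite addrA subrK.
apply: le_lt_trans (hnmD _ _) _; move: h2 h3.
by move: (n.+1%:R^-1) => i; lra.
Qed.

(** An ultrafilter [V] on the closure of the image of the ball may live off the image, so it cannot
    be pulled back directly. [G] is generated by the points of the ball whose images are near a set
    of [V]; a finer ultrafilter has a limit under [A], and [V] converges to it. *)
Lemma ultra_compact_op A : ultra_compact A -> compact_op A.
Proof.
move=> hA; rewrite /compact_op precompactE compact_ultra => V VU VY.
have VF : ProperFilter V := @ultra_proper _ _ VU.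
set Y := A @` _ in VY *.
pose G : set_system H := [set X | exists S, exists2 eps : R, V S /\ 0 < eps &
  [set x | hnm x <= 1 /\ exists2 y, S y & hnm (A x - y) < eps] `<=` X].
have GF : ProperFilter G.
  split=> [[S [eps [VS eps0] GS]]|].
    have [y [Sy Yy]] := filter_ex (filterI VS VY).
    have ec : 0 < eps%:C%C by rewrite ltcR.
    have [_ [[x /= x1 <-] By]] := Yy _ (nbhsx_ballx y _ ec).
    apply: (GS x); split; first by rewrite normhE lecR in x1.
    by exists y => //; move: By; rewrite -ball_normE /= normhE ltcR hdistC.
  split.
  - by exists setT, 1 => //; split; [exact: filterT|].
  - move=> X1 X2 [S1 [e1 [V1 p1] h1]] [S2 [e2 [V2 p2] h2]].
    exists (S1 `&` S2), (Num.min e1 e2).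
      by split; [exact: filterI|rewrite lt_min p1].
    move=> x [x1 [y [y1 y2] xy]]; split.
      by apply: h1; split => //; exists y => //; apply: lt_le_trans xy _; rewrite ge_min lexx.
    by apply: h2; split => //; exists y => //; apply: lt_le_trans xy _; rewrite ge_min lexx orbT.
  move=> X1 X2 X12 [S [eps hS GS]]; exists S, eps => //.
  exact: subset_trans X12.
have [F [FU GF']] := ultraFilterLemma GF.
have FF : ProperFilter F := @ultra_proper _ _ FU.
have F1 : F [set x | hnm x <= 1].
  by apply: GF'; exists setT, 1; [split; [exact: filterT|]|move=> x []].
have [l hl] := hA F FU F1.
have Vl : V --> l.
  move=> N /nbhs_ballP [eps' /= eps0' NB].
  have eE : eps' = (complex.Re eps')%:C%C by apply: ge0_ReE; exact: ltW.
  set eps := complex.Re eps' in eE.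
  have eps0 : 0 < eps by rewrite -(ltcR 0) -eE.
  have e2 : 0 < eps / 2 by rewrite divr_gt0.
  apply: (filterS NB).
  have [//|nV] := in_ultra_setVsetC (ball l eps') VU.
  have GX : F [set x | hnm x <= 1 /\ exists2 y, (~` ball l eps') y & hnm (A x - y) < eps / 2].
    by apply: GF'; exists (~` ball l eps'), (eps / 2).
  have [x /= [[_ [y yl xy]] xl]] := filter_ex (filterI GX (hl _ e2)).
  exfalso; apply: yl; rewrite -ball_normE /= normhE eE ltcR.
  rewrite (_ : l - y = (A x - y) - (A x - l)); last by rewrite opprB [RHS]addrC addrA subrK.
  apply: le_lt_trans (hnmB _ _) _; lra.
exists l; split => //.
apply: closed_closure => B /Vl VB.
exact: filter_ex (filterI VY VB).
Qed.

End UltraCompact.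

(** * Naimark's dilation *)

Section Naimark.
Variables (R : realType) (H : hilbertType R) (e : nat -> H).
Hypothesis eb : orthonormal_basis e.
Local Notation C := R[i].
Variables (d m : nat) (v : 'I_m.+1 -> 'rV[C]_d).

Lemma bop_onb_eq0 (A : bop H) : (forall k, A (e k) = 0) -> A = 0.
Proof.
move=> h; apply: bopP => x; rewrite zero_bopE; apply: (ip_eq0 (x := A x)) => y.
rewrite adjl (_ : adj A y = 0) ?ip0r //; apply: (onb_eq eb) => k.
by rewrite ip0l ipC -adjl h ip0l conjC0.
Qed.

(** The dilation is diagonal on [H] itself: (m+1)(n+1) basis vectors f(j, c) carry the eigenvalue
    v_j, and all others carry v_0 = 0, which adds no point outside K. With F_j factored through B_j,
    the isometry places the entries of B_j x at the f(j, c). *)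
Lemma naimark (K : set 'rV[C]_d) n (X : 'I_d -> 'M[C]_n.+1) F :
  v ord0 = 0 -> (forall j, K (v j)) -> psd_decomposition v X F ->
  Wmin K (existT _ n X).
Proof.
move=> v0 Kv [Fpsd F1 XF].
have /choice [B FB] : forall j, exists B : 'M[C]_n.+1, F j = mxadj B *m B.
  by move=> j; exact: psd_factor.
pose I := ('I_m.+1 * 'I_n.+1)%type.
pose f (p : I) : H := e (enum_rank p).
have fE p q : inner (f p) (f q) = (p == q)%:R.
  rewrite (onbE eb) -(inj_eq enum_rank_inj) -val_eqE //.
pose N i : bop H := \sum_(p : I) v p.1 0 i *: rank1 (f p) (f p).
have Nf i p : N i (f p) = v p.1 0 i *: f p.
  rewrite sum_bopE (bigD1 p) // scale_bopE rank1E fE eqxx scale1r big1 => [|q qp].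
    exact: addr0.
  by rewrite scale_bopE rank1E fE eq_sym (negPf qp) scale0r scaler0.
have Ne k : exists j : 'I_m.+1, forall i, N i (e k) = v j 0 i *: e k.
  case: (ltnP k #|{: I}|) => [kI|kI].
    exists (enum_val (Ordinal kI)).1 => i.
    have -> : e k = f (enum_val (Ordinal kI)) by rewrite /f enum_valK.
    exact: Nf.
  exists ord0 => i; rewrite v0 mxE scale0r sum_bopE big1 // => p _.
  rewrite scale_bopE rank1E /f (onbE eb) gtn_eqF ?scale0r ?scaler0 //.
  by apply: leq_trans kI; exact: ltn_ord.
pose Ns i : bop H := \sum_(p : I) (v p.1 0 i)^* *: rank1 (f p) (f p).
have Nadj i : is_adjoint (N i) (Ns i).
  move=> x y; rewrite /N /Ns !sum_bopE ip_suml ip_sumr; apply: eq_bigr => p _.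
  rewrite !scale_bopE !rank1E !ipZl !ipZr conjCK.
  by rewrite [inner y _]ipC conjCK; congr (_ * _); exact: mulrC.
have Nsf i p : Ns i (f p) = (v p.1 0 i)^* *: f p.
  rewrite sum_bopE (bigD1 p) // scale_bopE rank1E fE eqxx scale1r big1 => [|q qp].
    exact: addr0.
  by rewrite scale_bopE rank1E fE eq_sym (negPf qp) scale0r scaler0.
have diagM (a b : I -> C) x :
    \sum_p (a p *: rank1 (f p) (f p)) (\sum_q (b q *: rank1 (f q) (f q)) x) =
    \sum_p (a p * b p * inner x (f p)) *: f p.
  apply: eq_bigr => p _; rewrite scale_bopE rank1E ip_suml (bigD1 p) //.
  rewrite scale_bopE rank1E !ipZl fE eqxx mulr1 big1 => [|q qp].
    by rewrite scalerA -mulrA; congr (_ * _ *: _); exact: addr0.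
  by rewrite scale_bopE rank1E !ipZl fE (negPf qp) !mulr0.
exists H, N; split.
- split=> [i|i j].
    exists (Ns i) => //; apply: bopP => x; rewrite !bopME.
    rewrite /N /Ns !sum_bopE !diagM; apply: eq_bigr => p _.
    by rewrite [_^* * _]mulrC.
  apply: bopP => x; rewrite !bopME /N !sum_bopE !diagM; apply: eq_bigr => p _.
  by rewrite [v p.1 0 i * _]mulrC.
- move=> l [chi [chi1 chiP chiM] lE].
  have SN i : cstar_generated N (N i) by move=> S [_]; apply; exists i.
  have SC : cstar_subalgebra (cstar_generated N).
    split.
    - by move=> S [[]].
    - by move=> a A A' hA hA' S hS; have [[_ h _ _ _] _] := hS; apply: h; [exact: hA|exact: hA'].
    - by move=> A A' hA hA' S hS; have [[_ _ h _ _] _] := hS; apply: h; [exact: hA|exact: hA'].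
    - by move=> A A' hA hA' S hS; have [[_ _ _ h _] _] := hS; apply: h hA'; exact: hA.
    move=> A hA S hS; have [[_ _ _ _ h] _] := hS; apply: h => eps /hA [A' hA' AA'].
    by exists A' => //; exact: hA'.
  have [S1 SP SM _ _] := SC.
  apply: contrapT => Kl.
  (* If l differs from every v_j, pick for each j a coordinate where it does. The product of the
     [D j] kills every basis vector, yet the character sends it to a product of nonzero numbers. *)
  have /choice [ix ixP] : forall j, exists i, l 0 i != v j 0 i.
    move=> j; apply/existsP; apply: contraT; rewrite negb_exists => /forallP h.
    exfalso; apply: Kl; rewrite (_ : l = v j) //; apply/rowP => i.
    by apply/eqP; have := h i; rewrite negbK.
  pose D j : bop H := N (ix j) - v j 0 (ix j) *: bop1 H.
  have DE j : D j = (- v j 0 (ix j)) *: bop1 H + N (ix j).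
    by rewrite /D addrC scaleNr.
  have SD j : cstar_generated N (D j) by rewrite DE; exact: SP.
  have chiD j : chi (D j) = l 0 (ix j) - v j 0 (ix j).
    by rewrite DE chiP // chi1 mulr1 -lE addrC.
  pose Pi := \prod_(j : 'I_m.+1) D j.
  have key (s : seq 'I_m.+1) : cstar_generated N (\prod_(j <- s) D j) /\
      chi (\prod_(j <- s) D j) = \prod_(j <- s) (l 0 (ix j) - v j 0 (ix j)).
    elim: s => [|j s [IH1 IH2]]; first by rewrite !big_nil.
    rewrite !big_cons; split; first exact: SM.
    by rewrite [LHS]chiM // chiD IH2.
  have Pe k (s : seq 'I_m.+1) : exists c : 'I_m.+1 -> C, exists j0,
      (\prod_(j <- s) D j) (e k) = (\prod_(j <- s) c j) *: e k /\ c j0 = 0.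
    have [j0 h] := Ne k; exists (fun j => v j0 0 (ix j) - v j 0 (ix j)), j0.
    split; last by rewrite subrr.
    elim: s => [|j s IH]; first by rewrite !big_nil scale1r.
    rewrite !big_cons mul_bopE IH bopZ sub_bopE scale_bopE bop1E h -scalerBl scalerA.
    by rewrite mulrC.
  have Pi0 : Pi = 0.
    apply: bop_onb_eq0 => k; have [c [j0 [-> cj0]]] := Pe k (index_enum 'I_m.+1).
    by rewrite (bigD1 j0) //= cj0 mul0r scale0r.
  have [hS hchi] := key (index_enum 'I_m.+1).
  have chi0 : chi 0 = 0.
    by have := chiP (-1) _ _ S1 S1; rewrite scaleN1r addNr chi1 mulr1 addNr.
  rewrite -/Pi Pi0 chi0 in hchi.
  have /eqP := esym hchi; rewrite prodf_seq_eq0 => /hasP [j _ /=].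
  by rewrite subr_eq0 (negPf (ixP j)).
pose V (x : 'cV[C]_n.+1) : H := \sum_(p : I) (B p.1 *m x) p.2 0 *: f p.
have lV : linear V.
  move=> a x y; rewrite /V scaler_sumr -big_split; apply: eq_bigr => p _ /=.
  by rewrite mulmxDr -scalemxAr !mxE scalerDl scalerA.
pose LV := @GRing.isLinear.Build _ _ _ _ V lV.
pose V' : {linear 'cV[C]_n.+1 -> H} := HB.pack V LV.
pose Vs (y : H) : 'cV[C]_n.+1 :=
  \sum_j mxadj (B j) *m (\col_c inner y (f (j, c))).
have Vf x p : inner (V x) (f p) = (B p.1 *m x) p.2 0.
  rewrite /V ip_suml (bigD1 p) //= ipZl fE eqxx mulr1 big1 ?addr0 // => q qp.
  by rewrite ipZl fE (negPf qp) mulr0.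
have VVs x y : inner (V x) y = dotv x (Vs y).
  rewrite /Vs dotvC dotv_suml rmorph_sum /= /V ip_suml.
  rewrite (eq_bigr (fun p : I => (fun j c => inner ((B j *m x) c 0 *: f (j, c)) y) p.1 p.2)).
    rewrite -(pair_bigA _ (fun j c => inner ((B j *m x) c 0 *: f (j, c)) y)) /=.
    apply: eq_bigr => j _; rewrite -dotvC -dotv_adj /dotv; apply: eq_bigr => c _.
    by rewrite mxE ipZl -ipC.
  by case.
exists V', Vs; split => //.
- move=> x y; rewrite [LHS](VVs x (V y)); congr (dotv _ _); rewrite /Vs.
  rewrite -[RHS]mul1mx -F1 mulmx_suml; apply: eq_bigr => j _.
  rewrite FB -mulmxA; congr (_ *m _); apply/colP => c; rewrite mxE.
  exact: (Vf y (j, c)).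
move=> i x; rewrite /= XF mulmx_suml; apply: eq_bigr => j _.
rewrite FB -scalemxAl -mulmxA scalemxAr; congr (_ *m _); apply/colP => c.
rewrite [LHS]mxE [RHS]mxE -[(B j *m x) c 0]/((B (j, c).1 *m x) (j, c).2 0) -Vf.
have -> : inner (N i (V x)) (f (j, c)) = inner (V x) (Ns i (f (j, c))) by exact: Nadj.
by rewrite Nsf ipZr conjCK.
Qed.

End Naimark.

(** * Reducing subspaces *)

Section OrthogonalProjection.
Variables (R : realType) (H : hilbertType R) (M : closed_subspace H).
Local Notation C := R[i].

Lemma orth_proj_exists : exists Q : bop H, (forall x, csub_set M (Q x)) /\
  forall x y, csub_set M y -> inner (x - Q x) y = 0.
Proof.
have /choice [f fP] : forall x, exists p, csub_set M p /\
    forall y, csub_set M y -> inner (x - p) y = 0.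
  by move=> x; have [p p1 p2] := projection_exists M x; exists p.
have fM x : csub_set M (f x) by have [] := fP x.
have fo x y : csub_set M y -> inner (x - f x) y = 0 by have [_ h] := fP x; exact: h.
have funiq x p : csub_set M p -> (forall y, csub_set M y -> inner (x - p) y = 0) -> f x = p.
  move=> Mp hp; apply/eqP; rewrite -subr_eq0; apply/eqP.
  have Mfp : csub_set M (f x - p) by exact: csubB.
  apply/eqP; rewrite -hsq_eq0 /hsq {1}(_ : f x - p = (x - p) - (x - f x)).
    by rewrite ipBl hp // fo // subrr.
  by rewrite opprB [RHS]addrC addrA subrK.
have lf : linear f.
  move=> a x y; apply: funiq; first exact: csubP.
  move=> z Mz; rewrite opprD addrACA -scalerBr ipDl ipZl !fo //.
  by rewrite mulr0 addr0.
have bf x : hnm (f x) <= 1 * hnm x.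
  rewrite mul1r -(@ler_pXn2r _ 2) ?nnegrE ?hnm_ge0 // !hnm2.
  rewrite -{2}[x](subrK (f x)) hsqD fo // mulr0 addr0 lerDr.
  exact: hsq_ge0.
by exists (mk_bop lf bf); split.
Qed.

Definition orth_proj : bop H := sval (cid orth_proj_exists).

Lemma orth_proj_mem x : csub_set M (orth_proj x).
Proof. by rewrite /orth_proj; case: cid => Q []. Qed.

Lemma orth_proj_orth x y : csub_set M y -> inner (x - orth_proj x) y = 0.
Proof. by rewrite /orth_proj; case: cid => Q [h1 h2] /=; exact: h2. Qed.

Lemma orth_proj_unique x p : csub_set M p ->
  (forall y, csub_set M y -> inner (x - p) y = 0) -> orth_proj x = p.
Proof.
move=> Mp hp; apply/eqP; rewrite -subr_eq0 -hsq_eq0 /hsq.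
have Mfp : csub_set M (orth_proj x - p) by apply: csubB => //; exact: orth_proj_mem.
rewrite {1}(_ : orth_proj x - p = (x - p) - (x - orth_proj x)).
  by rewrite ipBl hp // orth_proj_orth // subrr.
by rewrite opprB [RHS]addrC addrA subrK.
Qed.

Lemma orth_proj_id x : csub_set M x -> orth_proj x = x.
Proof. by move=> Mx; apply: orth_proj_unique => // y _; rewrite subrr ip0l. Qed.

Lemma orth_proj_adj : adj orth_proj = orth_proj.
Proof.
apply: is_adjoint_unique (adjP _) _ => x y.
have Mx := orth_proj_mem x; have My := orth_proj_mem y.
have h1 := orth_proj_orth x My; have h2 := orth_proj_orth y Mx.
move/eqP: h1; rewrite ipBl subr_eq0 => /eqP ->.
move/eqP: h2; rewrite ipBl subr_eq0 => /eqP h2.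
by rewrite ipC h2 -ipC.
Qed.

Lemma orth_proj_comm (A : bop H) : Defs.invariant (csub_set M) A ->
  Defs.invariant (orthogonal_complement (csub_set M)) A ->
  orth_proj * A = A * orth_proj.
Proof.
move=> h1 h2; apply: bopP => x; rewrite !mul_bopE; apply: orth_proj_unique.
  by apply: h1; exact: orth_proj_mem.
move=> y My; rewrite -bopB; apply: h2 My => z Mz; exact: orth_proj_orth.
Qed.

Lemma compress_subproof (A : bop H) :
  (fun x : csub_type M => CSub (mem_set (orth_proj_mem (A x)))) \in @bounded_op R (csub_type M).
Proof.
have [c c0 Ac] := bop_bounded A; have [k k0 Qk] := bop_bounded orth_proj.
apply: (@bounded_op_intro R (csub_type M) _ (k * c)).
  by move=> a x y; apply: val_inj; rewrite /= !(bop_linear A) (bop_linear orth_proj).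
by move=> x; apply: le_trans (Qk (A x)) _; rewrite -mulrA ler_wpM2l.
Qed.

(** A compression rather than a restriction: a reducing subspace is only known to be preserved by
    the tuple, not by each of its positive parts. *)
Definition compress (A : bop H) : bop (csub_type M) := Bop (compress_subproof A).

Lemma compressE A (x : csub_type M) : csub_val (compress A x) = orth_proj (A x).
Proof. by []. Qed.

Lemma compress_ip A (x : csub_type M) :
  inner (compress A x) x = inner (A (csub_val x)) (csub_val x).
Proof.
rewrite -[LHS]/(inner (orth_proj (A (csub_val x))) (csub_val x)) -{1}orth_proj_adj -adjr.
by rewrite orth_proj_id //; exact: (set_mem (csub_valP x)).
Qed.

Lemma csub_bopP (A B : bop (csub_type M)) :
  (forall x, csub_val (A x) = csub_val (B x)) -> A = B.
Proof. by move=> h; apply: bopP => x; apply: val_inj; exact: h. Qed.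

Lemma csub_val_sum I (r : seq I) (F : I -> csub_type M) :
  csub_val (\sum_(i <- r) F i) = \sum_(i <- r) csub_val (F i).
Proof. by elim/big_rec2: _ => [|i x y _ <-]. Qed.

Lemma csub_valZ (a : C) (x : csub_type M) : csub_val (a *: x) = a *: csub_val x.
Proof. by []. Qed.

End OrthogonalProjection.

(** * The model tuple *)

Section Construction.
Variables (R : realType) (H : hilbertType R) (e : nat -> H).
Hypothesis eb : orthonormal_basis e.
Local Notation C := R[i].
Variable m : nat.
Local Notation q := m.+2.
Variables (b : nat -> R) (B : bop H) (xi : H).
Hypothesis Be : forall x k, inner (B x) (e k) = (b k)%:C%C * inner x (e k).
Hypothesis Bbd : forall x, hnm (B x) <= 2^-1 * hnm x.
Hypothesis Btail : forall n x,
  hnm (B x - \sum_(k < n) ((b k)%:C%C * inner x (e k)) *: e k) <= 2^-1 * hnm x * 2^-1 ^+ n.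
Hypothesis b_low : forall k, (k < q)%N -> b k = 0.
Hypothesis b_small : forall k, `|b k| <= 4^-1 * 2^-1 ^+ k.
Hypothesis xi_low : forall k, (k < q)%N -> inner xi (e k) = 0.
Hypothesis xi_high : forall k, (q <= k)%N -> inner xi (e k) = (4^-1 * 2^-1 ^+ k)%:C%C.
Hypothesis xi_bd : hnm xi <= 2^-1.

Lemma diagonal_basis k : B (e k) = (b k)%:C%C *: e k.
Proof.
apply: (onb_eq eb) => l; rewrite Be ipZl !(onbE eb); case: eqVneq => [->//|_].
by rewrite !mulr0.
Qed.

Lemma diagonal_adj : adj B = B.
Proof.
apply: bopP => x; apply: (onb_eq eb) => k.
by rewrite -adjr diagonal_basis ipZr Be; congr (_ * _); exact: conjc_real.
Qed.

(** Index i belongs to the vertex [lift ord0 i]. Squaring [B] makes positivity evident, and both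
    operators vanish on the first q basis vectors, which are reserved for the joint eigenvectors. *)
Definition xpart (i : 'I_q) : bop H :=
  if i == 0%N :> nat then B * B else if i == 1%N :> nat then rank1 xi xi else 0.

Lemma rank1_adj (y : H) : adj (rank1 y y) = rank1 y y.
Proof.
apply: is_adjoint_unique (adjP _) _ => x z.
by rewrite !rank1E ipZl ipZr -ipC mulrC.
Qed.

Lemma zero_adj : adj (0 : bop H) = 0.
Proof. by rewrite -[0 in LHS](scale0r 0) adjZ conjC0 scale0r. Qed.

Lemma xpart_adj i : adj (xpart i) = xpart i.
Proof.
rewrite /xpart; case: eqP => _; first by rewrite mul_adj diagonal_adj.
by case: eqP => _; [exact: rank1_adj|exact: zero_adj].
Qed.

Lemma rank1_ip (y x : H) : inner (rank1 y y x) x = (cabs (inner x y) ^+ 2)%:C%C.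
Proof. by rewrite rank1E ipZl [inner y x]ipC mul_conjE. Qed.

Lemma xpart_pos i : positive_bop (xpart i).
Proof.
rewrite /xpart => x; case: eqP => _.
  by rewrite mul_bopE adjl diagonal_adj ip_ge0.
case: eqP => _; first by rewrite rank1_ip ler0c sqr_ge0.
by rewrite zero_bopE ip0l.
Qed.

(** The constants 1/2 bounding [B] and [xi] are squared. Two such terms leave half of the identity
    for P_0, and 1/4 < 1 later keeps a vertex out of the range of a restriction. *)
Lemma xpart_bound i x : complex.Re (inner (xpart i x) x) <= 4^-1 * hsq x.
Proof.
have x0 := hsq_ge0 x; have h0 := hnm_ge0 x; rewrite /xpart; case: eqP => _.
  rewrite mul_bopE adjl diagonal_adj -/(hsq _) -!hnm2.
  by have := Bbd x; have := hnm_ge0 (B x); nra.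
case: eqP => _; last by rewrite zero_bopE ip0l /= mulr_ge0.
rewrite rank1_ip /= -hnm2.
have h1 := cauchy_schwarz x xi; have h2 := cabs_ge0 (inner x xi).
have h3 : cabs (inner x xi) <= 2^-1 * hnm x.
  by apply: le_trans h1 _; rewrite mulrC ler_wpM2r.
nra.
Qed.

Lemma xpart_low i k : (k < q)%N -> xpart i (e k) = 0.
Proof.
move=> kq; rewrite /xpart; case: eqP => _.
  by rewrite mul_bopE diagonal_basis b_low // scale0r bop0.
by case: eqP => _ //; rewrite rank1E ipC xi_low // conjC0 scale0r.
Qed.

Lemma xpart_basis_small i k : cabs (inner (xpart i (e k)) (e k)) <= 2^-1 ^+ k.
Proof.
have h0 : 0 <= 2^-1 ^+ k :> R by rewrite exprn_ge0.
have h1 : 2^-1 ^+ k <= 1 :> R by rewrite exprn_ile1 // invf_le1 ?ler1n.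
case: (ltnP k q) => kq; first by rewrite xpart_low // ip0l cabs0.
rewrite /xpart; case: eqP => _.
  rewrite mul_bopE adjl diagonal_adj diagonal_basis ipZl ipZr (onbE eb) eqxx mulr1.
  rewrite cabsM cabsC cabsR; have := b_small k; have := normr_ge0 (b k); nra.
case: eqP => _; last by rewrite zero_bopE ip0l cabs0.
rewrite rank1_ip ipC cabsC xi_high // !cabsR.
rewrite [`|_ * _|]ger0_norm ?mulr_ge0 // ger0_norm ?sqr_ge0 //; nra.
Qed.

Lemma diagonal_ultra_compact : ultra_compact B.
Proof.
apply: ultra_compact_limit => eps eps0.
have [N] := @ltr_add_invr R 0 eps eps0; rewrite add0r => hN.
exists (\sum_(k < N.+1) (b k)%:C%C *: rank1 (e k) (e k)).
  by apply: ultra_compact_sum => k; apply: ultra_compactZ; exact: ultra_compact_rank1.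
move=> x; rewrite sum_bopE.
under eq_bigr do rewrite scale_bopE rank1E scalerA.
apply: le_trans (Btail _ _) _; rewrite mulrAC ler_wpM2r ?hnm_ge0 //.
have hp : 2^-1 ^+ N.+1 <= N.+1%:R^-1 :> R.
  by rewrite exprVn lef_pV2 ?posrE ?exprn_gt0 ?ltr0n// -natrX ler_nat ltnW // ltn_expl.
have h0 : 0 <= 2^-1 ^+ N.+1 :> R by rewrite exprn_ge0.
by move: hN hp h0; move: (2^-1 ^+ N.+1) (N.+1%:R^-1) => x1 x2; lra.
Qed.

Lemma xpart_ultra_compact i : ultra_compact (xpart i).
Proof.
rewrite /xpart; case: eqP => _; first exact: ultra_compactM diagonal_ultra_compact.
by case: eqP => _; [exact: ultra_compact_rank1|exact: ultra_compact0].
Qed.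

Definition vpart (i : 'I_q) : bop H := rank1 (e i) (e i) + xpart i.

Definition part (j : 'I_q.+1) : bop H :=
  if unlift ord0 j is Some i then vpart i else 1 - \sum_i vpart i.

Lemma part_lift i : part (lift ord0 i) = vpart i. Proof. by rewrite /part liftK. Qed.
Lemma part0 : part ord0 = 1 - \sum_i vpart i. Proof. by rewrite /part unlift_none. Qed.

Lemma part_sum : \sum_j part j = bop1 H.
Proof.
rewrite big_ord_recl (eq_bigr vpart) => [|i _]; last exact: part_lift.
by rewrite part0 subrK.
Qed.

Lemma vpart_adj i : adj (vpart i) = vpart i.
Proof. by rewrite /vpart adjD rank1_adj xpart_adj. Qed.

Lemma sum_adj I (r : seq I) (F : I -> bop H) :
  adj (\sum_(i <- r) F i) = \sum_(i <- r) adj (F i).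
Proof. by elim/big_rec2: _ => [|i x y _ <-]; rewrite ?zero_adj ?adjD. Qed.

Lemma part_adj j : adj (part j) = part j.
Proof.
rewrite /part; case: unliftP => [i _|_]; first exact: vpart_adj.
rewrite -scaleN1r adjD one_adj adjZ sum_adj rmorphN rmorph1; congr (_ + _ *: _).
by apply: eq_bigr => i _; exact: vpart_adj.
Qed.

Let high x := x - \sum_(k < q) inner x (e k) *: e k.

Let high_orth x k : (k < q)%N -> inner (high x) (e k) = 0.
Proof.
move=> kq; rewrite /high ipBl ip_suml (bigD1 (Ordinal kq)) //= ipZl (onbE eb) eqxx mulr1.
rewrite big1 ?addr0 ?subrr // => i; rewrite -val_eqE ipZl (onbE eb) /= => /negPf ->.
by rewrite mulr0.
Qed.

Let xpart_high i x : inner (xpart i x) x = inner (xpart i (high x)) (high x).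
Proof.
have hx y : xpart i y = xpart i (high y).
  rewrite /high bopB bop_sum big1 ?subr0 // => k _.
  by rewrite bopZ xpart_low ?scaler0.
rewrite hx -[xpart i in LHS]xpart_adj -adjr hx adjr xpart_adj.
by [].
Qed.

Let hsq_high x : inner x x - \sum_(k < q) (cabs (inner x (e k)) ^+ 2)%:C%C =
  inner (high x) (high x).
Proof.
rewrite [in RHS]/high ipBr ip_sumr [X in _ = _ - X]big1 => [|k _]; last first.
  by rewrite ipZr high_orth ?mulr0.
rewrite subr0 /high ipBl ip_suml; congr (_ - _); apply: eq_bigr => k _.
by rewrite ipZl [inner (e k) x]ipC mul_conjE.
Qed.

Lemma part0_ip x : inner (part ord0 x) x =
  inner (high x) (high x) - \sum_i inner (xpart i (high x)) (high x).
Proof.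
rewrite part0 sub_bopE one_bopE sum_bopE ipBl ip_suml -hsq_high -addrA -opprD.
congr (_ - _); rewrite -big_split; apply: eq_bigr => i _.
by rewrite /vpart add_bopE ipDl rank1_ip -xpart_high.
Qed.

Lemma part0_low x : (forall k, (q <= k)%N -> inner x (e k) = 0) -> inner (part ord0 x) x = 0.
Proof.
move=> h; have hx : high x = 0.
  apply: (proj2 eb) => k; case: (ltnP k q) => kq; first exact: high_orth.
  rewrite /high ipBl h // ip_suml big1 ?subrr // => i _.
  by rewrite ipZl (onbE eb) ltn_eqF ?mulr0 // (leq_trans (ltn_ord i)).
by rewrite part0_ip hx ip0l big1 ?subrr // => i _; rewrite bop0 ip0l.
Qed.

Lemma part_pos j : positive_bop (part j).
Proof.
case: (unliftP ord0 j) => [i ->|->] x; last first.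
  rewrite part0_ip hsqE 2!big_ord_recl [X in _ + (_ + X)]big1 => [|i _]; last first.
    have -> : xpart (lift ord0 (lift ord0 i)) = 0 by [].
    by rewrite zero_bopE ip0l.
  rewrite addr0 (ge0_ReE (xpart_pos ord0 _)) (ge0_ReE (xpart_pos (lift ord0 ord0) _)).
  rewrite -rmorphD -rmorphB ler0c /=.
  have := xpart_bound ord0 (high x); have := xpart_bound (lift ord0 ord0) (high x).
  have := hsq_ge0 (high x); lra.
rewrite part_lift add_bopE ipDl addr_ge0 //; last exact: xpart_pos.
by rewrite rank1_ip ler0c sqr_ge0.
Qed.

Lemma part_quarter (i : 'I_q) x : inner x (e i) = 0 ->
  complex.Re (inner (part (lift ord0 i) x) x) <= 4^-1 * hsq x.
Proof.
move=> h; rewrite part_lift add_bopE ipDl rank1_ip h cabs0 expr0n add0r.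
exact: xpart_bound.
Qed.

Lemma vpart_low (i l : 'I_q) : vpart i (e l) = (i == l)%:R *: e l.
Proof.
rewrite add_bopE rank1E xpart_low // addr0 (onbE eb) eq_sym -[i == l]val_eqE /=.
by case: eqVneq => [->|_]; rewrite ?scale0r.
Qed.

Definition model_state (j : 'I_q.+1) (t : nat) : H :=
  if unlift ord0 j is Some i then e i else e (q + t)%N.

Lemma pow2_lim (f : nat -> C) : (forall t, cabs (f t) <= 2^-1 ^+ t) -> uconv nat_ultra f 0.
Proof.
move=> hf; apply: uconv_lim => eps eps0.
have [N] := @ltr_add_invr R 0 eps eps0; rewrite add0r => hN.
exists N.+1 => n Nn; rewrite subr0; apply: le_lt_trans (hf n) (le_lt_trans _ hN).
have h0 : 2^-1 ^+ n <= 2^-1 ^+ N.+1 :> R by rewrite ler_wiXn2l // invf_le1 ?ler1n.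
apply: le_trans h0 _.
by rewrite exprVn lef_pV2 ?posrE ?exprn_gt0 ?ltr0n// -natrX ler_nat ltnW // ltn_expl.
Qed.

(** * The model tuple and its matrix range *)

Variables (d : nat) (v : 'I_q.+1 -> 'rV[C]_d).

Definition model (i : 'I_d) : bop H := \sum_j v j 0 i *: part j.

Hypothesis v0 : v ord0 = 0.

Lemma model_vparts i : model i = \sum_k v (lift ord0 k) 0 i *: vpart k.
Proof.
rewrite /model big_ord_recl v0 mxE scale0r add0r.
by apply: eq_bigr => k _; rewrite part_lift.
Qed.

Lemma model_compact i : compact_op (model i).
Proof.
apply: ultra_compact_op; rewrite model_vparts; apply: ultra_compact_sum => k.
apply: ultra_compactZ; apply: ultra_compactD; first exact: ultra_compact_rank1.
exact: xpart_ultra_compact.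
Qed.

Lemma model_low i (l : 'I_q) : model i (e l) = v (lift ord0 l) 0 i *: e l.
Proof.
rewrite model_vparts sum_bopE (bigD1 l) // scale_bopE vpart_low eqxx scale1r.
rewrite big1 => [|k /negPf kl]; first exact: addr0.
by rewrite scale_bopE vpart_low kl scale0r scaler0.
Qed.

Lemma model_state_lim j i : uconv nat_ultra
  (fun t => inner (model i (model_state j t)) (model_state j t)) (v j 0 i).
Proof.
rewrite /model_state; case: (unliftP ord0 j) => [l ->|->].
  have := uconv_cst nat_ultraP (v (lift ord0 l) 0 i).
  by congr (uconv _ _ _); apply/funext => t; rewrite model_low ipZl (onbE eb) eqxx mulr1.
rewrite v0 mxE.
have lim k : uconv nat_ultra
    (fun t => inner (xpart k (e (q + t)%N)) (e (q + t)%N)) 0.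
  apply: pow2_lim => t; apply: le_trans (xpart_basis_small _ _) _.
  by rewrite ler_wiXn2l ?leq_addl // invf_le1 ?ler1n.
have := uconv_sum nat_ultraP (index_enum 'I_q) (fun k =>
  uconvZ nat_ultraP (v (lift ord0 k) 0 i) (lim k)).
rewrite big1 => [|k _]; last by rewrite mulr0.
congr (uconv _ _ _); apply/funext => t; rewrite model_vparts sum_bopE ip_suml.
apply: eq_bigr => k _; rewrite scale_bopE ipZl add_bopE rank1E (onbE eb) gtn_eqF ?scale0r ?add0r //.
by apply: leq_trans (ltn_ord k) _; exact: leq_addr.
Qed.

Lemma decomposition_Wmin (K : set 'rV[C]_d) j : K = hull v ->
  Wmin K (existT _ 0%N (fun i => const_mx (v j 0 i))).
Proof.
move=> KE; apply: (naimark eb (v := v) (F := fun l => ((l == j)%:R)%:M)) => //.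
  by move=> l; rewrite KE; exact: hull_mem.
split.
- move=> l u; rewrite mul_scalar_mx dotvZl mulr_ge0 ?ler0n ?dotv_ge0 //.
- rewrite (bigD1 j) //= eqxx big1 ?addr0 // => l /negPf ->.
  by rewrite raddf0.
move=> i; rewrite (bigD1 j) //= eqxx big1 ?addr0 => [|l /negPf ->].
  by apply/matrixP => a c; rewrite !ord1 !mxE eqxx mulr1n mulr1.
by rewrite raddf0 scaler0.
Qed.

(** The space [L] is left free so that the inclusion also covers compressions to a reducing
    subspace. *)
Lemma model_range_sub (K : set 'rV[C]_d) (L : hilbertType R) (P : 'I_q.+1 -> bop L)
    (S : 'I_d -> bop L) : K = hull v ->
  (forall j, positive_bop (P j)) -> \sum_j P j = bop1 L ->
  (forall i, S i = \sum_j v j 0 i *: P j) -> matrix_range S `<=` Wmin K.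
Proof.
move=> KE P0 P1 SP [n X] /(ucp_decomposition P0 P1 SP) [psi _ XF].
by apply: (naimark eb _ _ XF) => // j; rewrite KE; exact: hull_mem.
Qed.

Lemma model_range (K : set 'rV[C]_d) : K = hull v -> matrix_range model = Wmin K.
Proof.
move=> KE; apply/seteqP; split.
  by apply: model_range_sub KE _ part_sum _ => //; exact: part_pos.
move=> [n X] XK; have [|F XF] := @Wmin_decomposition _ _ _ v K n X _ XK.
  by rewrite KE => z [t [t0 t1] zE]; exists t.
apply: (states_range XF (f := model_state)) => [j t|j i]; last exact: model_state_lim.
by rewrite /model_state; case: unlift => [i|]; exact: (onb_hnm eb).
Qed.

(** * Real functionals of the tuple and their eigenvalues *)

Hypothesis vext : extreme_family v.

Let i1 : 'I_q.+1 := lift ord0 ord0.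
Let i2 : 'I_q.+1 := lift ord0 (lift ord0 ord0).

(** Built from [T] alone, so reducing projections and unitary equivalences pass to it; on the model
    it becomes a real combination of the positive parts. *)
Definition functional_op (c : 'rV[C]_d) (T : 'I_d -> bop H) : bop H :=
  (2^-1 : C) *: (\sum_i c 0 i *: T i + adj (\sum_i c 0 i *: T i)).

Lemma functional_model c : functional_op c model = \sum_j (refun c (v j))%:C%C *: part j.
Proof.
have e1 : \sum_i c 0 i *: model i = \sum_j (\sum_i c 0 i * v j 0 i) *: part j.
  rewrite /model; under eq_bigr do rewrite scaler_sumr.
  rewrite exchange_big; apply: eq_bigr => j _; rewrite scaler_suml.
  by apply: eq_bigr => i _; rewrite scalerA.
rewrite /functional_op e1 sum_adj -big_split scaler_sumr; apply: eq_bigr => j _ /=.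
rewrite adjZ part_adj -scalerDl scalerA /refun; congr (_ *: _).
case: (\sum_i _) => x y; apply/eqP; rewrite eq_complex.
rewrite -[2^-1](_ : (2^-1 : R)%:C%C = _); last by rewrite fmorphV rmorph_nat.
by apply/andP; split; apply/eqP => /=; lra.
Qed.

Lemma functional_low c (l : 'I_q) :
  functional_op c model (e l) = (refun c (v (lift ord0 l)))%:C%C *: e l.
Proof.
rewrite functional_model sum_bopE big_ord_recl (bigD1 l) // !scale_bopE part_lift vpart_low eqxx.
rewrite scale1r big1 => [|k /negPf kl]; last first.
  by rewrite scale_bopE part_lift vpart_low kl scale0r scaler0.
rewrite v0 (_ : refun c 0 = 0); last first.
  by rewrite /refun big1 // => i _; rewrite mxE mulr0.
by rewrite scale0r add0r; exact: addr0.
Qed.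

Lemma functional_high c k : (q <= k)%N -> functional_op c model (e k) =
  (refun c (v i1))%:C%C *: B (B (e k)) +
  (refun c (v i2))%:C%C *: (inner (e k) xi *: xi).
Proof.
move=> qk; rewrite functional_model sum_bopE 3!big_ord_recl [X in _ + (_ + (_ + X))]big1.
  rewrite v0 (_ : refun c 0 = 0); last first.
    by rewrite /refun big1 // => i _; rewrite mxE mulr0.
  rewrite !scale_bopE scale0r add0r addr0 !part_lift.
  have kl (l : 'I_q) : (k == l)%N = false.
    by apply/gtn_eqF; exact: leq_trans qk.
  congr (_ *: _ + _ *: _).
    by rewrite add_bopE rank1E (onbE eb) kl scale0r add0r.
  by rewrite add_bopE rank1E (onbE eb) kl scale0r add0r /xpart /= rank1E.
move=> i _; rewrite scale_bopE part_lift add_bopE rank1E (onbE eb) gtn_eqF ?scale0r.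
  have -> : xpart (lift ord0 (lift ord0 i)) = 0 by [].
  by rewrite zero_bopE addr0 scaler0.
by apply: leq_trans qk; exact: ltn_ord.
Qed.

Hypothesis b_high : forall k, (q <= k)%N -> 0 < b k.
Hypothesis b_inj : forall k l, (q <= k)%N -> (q <= l)%N -> b k = b l -> k = l.

Variables c1 c2 : 'rV[C]_d.
Hypothesis c1v1 : refun c1 (v i1) = 1.
Hypothesis c1v2 : refun c1 (v i2) = 0.
Hypothesis c2v1 : refun c2 (v i1) = 0.
Hypothesis c2v2 : refun c2 (v i2) = 1.
Hypothesis b_avoid : forall k (l : 'I_q), (q <= k)%N -> b k ^+ 2 <> refun c1 (v (lift ord0 l)).

Definition spectral_value (k : nat) : R :=
  if insub k is Some l then refun c1 (v (lift ord0 (l : 'I_q))) else b k ^+ 2.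

Lemma spectral_value_high k : (q <= k)%N -> spectral_value k = b k ^+ 2.
Proof. by move=> qk; rewrite /spectral_value insubF // ltnNge qk. Qed.

Lemma functional_diag k : functional_op c1 model (e k) = (spectral_value k)%:C%C *: e k.
Proof.
case: (ltnP k q) => kq.
  rewrite /spectral_value insubT /=.
  exact: (functional_low c1 (Ordinal kq)).
rewrite spectral_value_high // functional_high // c1v1 c1v2 scale0r addr0 scale1r.
by rewrite !diagonal_basis bopZ diagonal_basis scalerA -rmorphM -expr2.
Qed.

Lemma functional_adj c T : adj (functional_op c T) = functional_op c T.
Proof. by rewrite /functional_op adjZ conj_half adjD adjK addrC. Qed.

(** [b_avoid] separates the squares b_k^2 from the values at the vertices. Two vertices may share a
    value of [c1], hence the restriction to q <= k. *)
Lemma spectral_value_simple k l : (q <= k)%N -> spectral_value l = spectral_value k -> l = k.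
Proof.
move=> qk; rewrite (spectral_value_high qk); case: (ltnP l q) => lq.
  by rewrite /spectral_value insubT /= => /esym h; have := b_avoid qk h.
rewrite spectral_value_high // => /eqP; rewrite eqrXn2 ?ltW ?b_high //.
by move=> /eqP; exact: b_inj.
Qed.

Lemma functional_eigenvalue (a : R) z : z != 0 ->
  functional_op c1 model z = a%:C%C *: z -> exists k, a = spectral_value k.
Proof.
move=> z0 hz; have [k hk] : exists k, inner z (e k) != 0.
  apply: contrapT => /forallNP h; move/eqP: z0; apply; apply: (proj2 eb) => k.
  by apply/eqP/negPn/negP; exact: h.
exists k; have h := congr1 (fun y => inner y (e k)) hz.
rewrite ipZl (adjl (functional_op _ _)) functional_adj functional_diag ipZr in h.
rewrite (_ : _^* = (spectral_value k)%:C%C) in h; last exact: conjc_real.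
exact/esym/complexI/(mulIf hk).
Qed.

(** * Subspaces reducing the model tuple *)

Section Reducing.
Variables (M : closed_subspace H) (red : reducing model M).
Let Q := orth_proj M.

Let Q_model i : Q * model i = model i * Q.
Proof. exact: orth_proj_comm (reducing_inv red i) (reducing_orth red i). Qed.

Let Q_sa : adj Q = Q. Proof. exact: orth_proj_adj. Qed.

Let Q_functional c : Q * functional_op c model = functional_op c model * Q.
Proof.
have h : Q * (\sum_i c 0 i *: model i) = (\sum_i c 0 i *: model i) * Q.
  rewrite mulr_sumr mulr_suml; apply: eq_bigr => i _.
  by rewrite -scale_bopAr -scale_bopAl Q_model.
rewrite /functional_op -scale_bopAr -scale_bopAl mulrDr mulrDl h; congr (_ *: (_ + _)).
by rewrite -{1}Q_sa -!mul_adj -h mul_adj Q_sa.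
Qed.

Let Q_high k : (q <= k)%N -> exists r, Q (e k) = r *: e k.
Proof.
move=> qk; exists (inner (Q (e k)) (e k)); apply: (onb_eq eb) => l.
rewrite ipZl (onbE eb); case: eqVneq => [<-|kl]; first by rewrite mulr1.
rewrite mulr0.
have h := congr1 (fun A : bop H => inner (A (e k)) (e l)) (Q_functional c1).
rewrite !mul_bopE functional_diag (bopZ Q) ipZl in h.
rewrite (adjl (functional_op _ _)) functional_adj functional_diag ipZr in h.
rewrite (_ : _^* = (spectral_value l)%:C%C) in h; last exact: conjc_real.
apply/eqP; apply: contraT => n0.
have /complexI h2 := mulIf n0 h.
by move: kl; rewrite (spectral_value_simple qk (esym h2)) eqxx.
Qed.

(** The functional for [c2] sends e_k to a nonzero multiple of xi, so commutation transfers the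
    eigenvalue of [Q] from e_k to xi; all e_k with q <= k thus share it. *)
Let Q_xi k r : (q <= k)%N -> Q (e k) = r *: e k -> Q xi = r *: xi.
Proof.
move=> qk hr.
have h := congr1 (fun A : bop H => A (e k)) (Q_functional c2).
rewrite !mul_bopE hr (bopZ (functional_op _ _)) functional_high // in h.
rewrite c2v1 c2v2 scale0r add0r scale1r (bopZ Q) in h.
have n0 : inner (e k) xi != 0.
  rewrite ipC xi_high // conjC_eq0 -cabs_eq0 cabsR normr_eq0.
  by rewrite mulf_neq0 // ?expf_neq0 ?invr_eq0 ?pnatr_eq0.
by move: h; rewrite scalerA mulrC -scalerA => /(scalerI n0).
Qed.

Let xi_neq0 : xi != 0.
Proof.
apply/eqP => h; have := xi_high (leqnn q); rewrite h ip0l => /esym /complexI/eqP.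
by rewrite mulf_eq0 expf_eq0 !invr_eq0 !pnatr_eq0.
Qed.

(** As [c1] need not separate all vertices, the whole tuple is used: a nonzero entry of [Q] between
    two low basis vectors would make their vertices agree in every coordinate, against
    extremality. *)
Let Q_low (l : 'I_q) : exists r, Q (e l) = r *: e l.
Proof.
exists (inner (Q (e l)) (e l)); apply: (onb_eq eb) => k.
rewrite ipZl (onbE eb); case: eqVneq => [<-|kl]; first by rewrite mulr1.
rewrite mulr0; case: (ltnP k q) => kq; last first.
  have [r hr] := Q_high kq.
  by rewrite -Q_sa -adjr hr ipZr (onbE eb) (negPf kl) mulr0.
pose k' := Ordinal kq.
apply/eqP; apply: contraT => n0.
have vkl : v (lift ord0 k') = v (lift ord0 l).
  apply/rowP => i.
  have h := congr1 (fun A : bop H => inner (A (e l)) (e k')) (Q_model i).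
  have ad : adj (model i) (e k') = (v (lift ord0 k') 0 i)^* *: e k'.
    rewrite /model sum_adj sum_bopE big_ord_recl v0 mxE scale0r zero_adj zero_bopE add0r.
    rewrite (bigD1 k') // adjZ part_adj scale_bopE part_lift vpart_low eqxx scale1r.
    rewrite big1 => [|p /negPf pk]; first exact: addr0.
    by rewrite adjZ part_adj scale_bopE part_lift vpart_low pk scale0r scaler0.
  rewrite !mul_bopE model_low bopZ ipZl (adjl (model i)) ad ipZr conjCK in h.
  exact/esym/(mulIf n0).
have wt : weights (fun j : 'I_q.+1 => (j == lift ord0 l)%:R : C).
  split=> [j|]; first by rewrite ler0n.
  by rewrite (bigD1 (lift ord0 l)) //= eqxx big1 ?addr0 // => j /negPf ->.
have vb : v (lift ord0 k') = barycenter v (fun j => (j == lift ord0 l)%:R).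
  rewrite vkl /barycenter (bigD1 (lift ord0 l)) //= eqxx scale1r big1 ?addr0 // => j /negPf ->.
  by rewrite scale0r.
have := vext wt vb; rewrite (inj_eq lift_inj) -val_eqE /= eq_sym (negPf kl) => /eqP.
by rewrite eq_sym oner_eq0.
Qed.

Let Q_basis k : Q (e k) = e k \/ Q (e k) = 0.
Proof.
have [r hr] : exists r, Q (e k) = r *: e k.
  case: (ltnP k q) => kq; last exact: Q_high.
  exact: (Q_low (Ordinal kq)).
have e0 : e k != 0 by rewrite -hnm_eq0 (onb_hnm eb) oner_eq0.
have : Q (Q (e k)) = Q (e k) by apply: orth_proj_id; exact: orth_proj_mem.
rewrite hr bopZ hr scalerA => /eqP; rewrite -subr_eq0 -scalerBl scaler_eq0 (negPf e0) orbF.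
rewrite -{3}[r]mulr1 -mulrBr mulf_eq0 subr_eq0 => /orP[/eqP ->|/eqP ->].
  by right; rewrite scale0r.
by left; rewrite scale1r.
Qed.

Let Q_tail k l : (q <= k)%N -> (q <= l)%N -> Q (e k) = 0 -> Q (e l) = 0.
Proof.
move=> qk ql h; have Qxi : Q xi = 0.
  by rewrite (Q_xi (r := 0) qk) ?scale0r.
have [hl|//] := Q_basis l.
have := Q_xi (r := 1) ql; rewrite scale1r => /(_ hl); rewrite Qxi scale1r => /esym/eqP.
by rewrite (negPf xi_neq0).
Qed.

Let Q_orth k x : csub_set M x -> Q (e k) = 0 -> inner x (e k) = 0.
Proof. by move=> Mx h; rewrite -(orth_proj_id Mx) adjl Q_sa h ip0r. Qed.

(** If a low basis vector is lost, its positive part keeps only the extra operator. If a later one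
    is lost, all of them are, and P_0 vanishes on what remains. *)
Lemma reducing_missing : csub_set M <> setT -> exists j, forall x, csub_set M x ->
  complex.Re (inner (part j x) x) <= 4^-1 * hsq x.
Proof.
move=> MT; have [k hk] : exists k, Q (e k) = 0.
  apply: contrapT => /forallNP h; apply: MT; apply/seteqP; split => // x _.
  suff -> : x = Q x by exact: orth_proj_mem.
  have Q1 : Q - 1 = 0.
    apply: (bop_onb_eq0 eb) => k; rewrite sub_bopE one_bopE.
    by have [->|/h//] := Q_basis k; rewrite subrr.
  have := congr1 (fun A : bop H => A x) Q1.
  by rewrite sub_bopE one_bopE zero_bopE => /eqP; rewrite subr_eq0 => /eqP.
case: (ltnP k q) => kq.
  exists (lift ord0 (Ordinal kq)) => x Mx; apply: part_quarter.
  exact: (@Q_orth k).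
exists ord0 => x Mx; rewrite part0_low /= ?mulr_ge0 ?hsq_ge0 // => l ql.
by apply: Q_orth => //; exact: Q_tail hk.
Qed.

Lemma restr_model i : restr (reducing_inv red i) = \sum_j v j 0 i *: compress M (part j).
Proof.
apply: csub_bopP => x; rewrite sum_bopE csub_val_sum.
under eq_bigr do rewrite scale_bopE csub_valZ compressE.
rewrite -[LHS]/(model i (csub_val x)).
have Mx : csub_set M (model i (csub_val x)).
  by apply: (reducing_inv red i); exact: (set_mem (csub_valP x)).
rewrite -[LHS](orth_proj_id Mx) /model sum_bopE bop_sum; apply: eq_bigr => j _.
by rewrite scale_bopE bopZ.
Qed.

Lemma compress_part_sum : \sum_j compress M (part j) = bop1 (csub_type M).
Proof.
apply: csub_bopP => x; rewrite sum_bopE csub_val_sum.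
under eq_bigr do rewrite compressE.
rewrite -bop_sum -sum_bopE part_sum bop1E bop1E orth_proj_id //.
exact: (set_mem (csub_valP x)).
Qed.

Lemma compress_part_pos j : positive_bop (compress M (part j)).
Proof. by move=> x; rewrite compress_ip; exact: part_pos. Qed.

(** Were v_j, as a point at level 1, in the range of the restriction, extremality would force the
    weight of P_j to be 1, whereas the bound 1/4 passes through the UCP map. *)
Lemma reducing_range : csub_set M <> setT ->
  matrix_range (fun i => restr (reducing_inv red i)) `<` matrix_range model.
Proof.
move=> MT; rewrite (model_range (erefl (hull v))); split.
  apply: (model_range_sub (erefl _) compress_part_pos compress_part_sum).
  exact: restr_model.
have [j hj] := reducing_missing MT.
move=> /(_ _ (decomposition_Wmin j (erefl (hull v)))).
move=> /(ucp_decomposition compress_part_pos compress_part_sum restr_model).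
move=> [psi hpsi [F0 F1 XF]].
have psd00 (A : 'M[C]_1) : psd A -> 0 <= A 0 0 by move=> hA; rewrite -mx_dotv_delta.
have tj : psi (compress M (part j)) 0 0 = 1.
  apply: (vext (t := fun l => psi (compress M (part l)) 0 0)).
    split=> [l|]; first exact: psd00.
    by have := congr1 (fun A : 'M[C]_1 => A 0 0) F1; rewrite summxE mxE eqxx.
  apply/rowP => i; have := congr1 (fun A : 'M[C]_1 => A 0 0) (XF i).
  rewrite !mxE !summxE => ->; apply: eq_bigr => l _.
  by rewrite !mxE mulrC.
have half : positive_bop ((4^-1 : C) *: bop1 (csub_type M) - compress M (part j)).
  move=> x; rewrite sub_bopE scale_bopE bop1E ipBl ipZl compress_ip hsqE.
  have -> : (4^-1 : C) = (4^-1 : R)%:C%C by rewrite fmorphV rmorph_nat.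
  rewrite (ge0_ReE (part_pos _ _)) -rmorphM -rmorphB ler0c subr_ge0.
  by apply: hj; exact: (set_mem (csub_valP x)).
have := psd00 _ (ucp_psd hpsi half).
rewrite linearB linearZ /= (proj1 hpsi) !mxE eqxx tj mulr1.
have -> : (4^-1 : C) = (4^-1 : R)%:C%C by rewrite fmorphV rmorph_nat.
by rewrite -(rmorph1 (real_complex R)) -rmorphB ler0c; lra.
Qed.

End Reducing.

Lemma model_minimal : minimal model.
Proof. by move=> M red; exact: reducing_range. Qed.

End Construction.

(** * Uncountably many classes *)

Section Equivalence.
Variables (R : realType) (H : hilbertType R) (d : nat).
Implicit Types (S T : 'I_d -> bop H).

Lemma unitarily_equivalent_refl T : unitarily_equivalent T T.
Proof.
exists (bop1 H), (bop1 H); split=> [|i]; last exact: bopP.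
by split; [move=> x y|exact: bopP|exact: bopP].
Qed.

(** Conjugation by a unitary commutes with adjoints and linear combinations, so the eigenvalues of
    [functional_op c] are invariants of the class. *)
Lemma unitarily_equivalent_eigen S T c (a : R[i]) y : unitarily_equivalent S T ->
  y != 0 -> functional_op c S y = a *: y ->
  exists2 z, z != 0 & functional_op c T z = a *: z.
Proof.
move=> [U [Us [[UUs U1 U2] ST]]] y0 hy.
have adU : adj U = Us by exact: is_adjoint_unique (adjP U) UUs.
have adUs : adj Us = U by rewrite -adU adjK.
have SE : \sum_i c 0 i *: S i = Us * (\sum_i c 0 i *: T i) * U.
  rewrite mulr_sumr mulr_suml; apply: eq_bigr => i _.
  by rewrite -scale_bopAr -scale_bopAl ST !bopM_mul mulrA.
have DE : functional_op c S = Us * functional_op c T * U.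
  rewrite /functional_op SE -scale_bopAr -scale_bopAl mulrDr mulrDl; congr (_ *: (_ + _)).
  by rewrite !mul_adj adU adUs mulrA.
exists (U y).
  apply: contraNneq y0 => h.
  by rewrite -[y]/(bop1 H y) -U2 bopME h bop0.
have UUs1 x : U (Us x) = x by rewrite -bopME U1.
by have := congr1 U hy; rewrite DE !mul_bopE UUs1 bopZ.
Qed.

End Equivalence.

Section Uncountable.
Variable R : realType.

Lemma itv_uncountable (x y : R) : x < y -> ~ countable [set` `]x, y[].
Proof.
move=> xy /countable_lebesgue_measure0; rewrite lebesgue_measure_itv /= lte_fin xy.
by move=> /eqP; rewrite -EFinB eqe subr_eq0 gt_eqF.
Qed.

(** The minimum of [x] and the positive values of [g]. Only positive values are watched, as the
    numbers to be kept apart from them are squares of positive reals. *)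
Lemma positive_gap n (g : 'I_n -> R) (x : R) : 0 < x ->
  exists2 y, 0 < y <= x & forall i, 0 < g i -> y <= g i.
Proof.
move=> x0; pose y := \big[Num.min/x]_(i | 0 < g i) g i.
exists y => [|i gi]; last by rewrite /y (bigD1 i) //= ge_min lexx.
apply/andP; split; first by rewrite /y; elim/big_ind: _ => // a b a0 b0; rewrite lt_min a0.
rewrite /y; elim/big_rec: _ => // i a _ ax; by rewrite ge_min ax orbT.
Qed.

End Uncountable.

(** * The eigenvalue sequence and its free parameter *)

Section EigenvalueSequence.
Variables (R : realType) (q : nat) (dl : R).
Hypotheses (dl0 : 0 < dl) (dl_le : dl <= 4^-1 * 2^-1 ^+ q).

(** The parameter s will lie in ]dl/2, dl[ while all later entries are at most dl/2, so s can be
    recognized as the only entry above dl/2. *)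
Definition eigen_seq (s : R) (k : nat) : R :=
  if (k < q)%N then 0 else if k == q then s else dl * 2^-1 ^+ k.+1.

Let half_pow k : 0 < 2^-1 ^+ k :> R. Proof. by rewrite exprn_gt0. Qed.

Let half_pow1 k : 2^-1 ^+ k <= 1 :> R.
Proof. by rewrite exprn_ile1 // invf_le1 ?ler1n. Qed.

Lemma eigen_gap_le : dl <= 4^-1.
Proof. by apply: le_trans dl_le _; have := half_pow1 q; lra. Qed.

Lemma eigen_seq_low s k : (k < q)%N -> eigen_seq s k = 0.
Proof. by rewrite /eigen_seq => ->. Qed.

Lemma eigen_seq_base s : eigen_seq s q = s.
Proof. by rewrite /eigen_seq ltnn eqxx. Qed.

Lemma eigen_seq_above s k : (q < k)%N -> eigen_seq s k = dl * 2^-1 ^+ k.+1.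
Proof. by move=> qk; rewrite /eigen_seq ltnNge (ltnW qk) /= gtn_eqF. Qed.

Let above_half k : dl * 2^-1 ^+ k.+1 <= dl / 2.
Proof.
rewrite exprS mulrA ler_piMr ?half_pow1 // ltW // divr_gt0 //.
Qed.

Lemma eigen_seq_eq s t k : (q <= k)%N -> dl / 2 < t -> eigen_seq s k = t -> k = q.
Proof.
rewrite leq_eqVlt => /predU1P[-> //|qk] ht; rewrite eigen_seq_above // => h.
by have := above_half k; rewrite h leNgt ht.
Qed.

Variable s : R.
Hypotheses (s_gt : dl / 2 < s) (s_lt : s < dl).

Lemma eigen_seq_gt0 k : (q <= k)%N -> 0 < eigen_seq s k.
Proof.
rewrite leq_eqVlt => /predU1P[<-|qk]; last by rewrite eigen_seq_above // mulr_gt0.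
by rewrite eigen_seq_base (lt_trans _ s_gt) // divr_gt0.
Qed.

Lemma eigen_seq_lt k : (q <= k)%N -> eigen_seq s k < dl.
Proof.
rewrite leq_eqVlt => /predU1P[<-|qk]; first by rewrite eigen_seq_base.
rewrite eigen_seq_above //; apply: le_lt_trans (above_half k) _.
by rewrite ltr_pdivrMr // ltr_pMr // ltr1n.
Qed.

Lemma eigen_seq_small k : `|eigen_seq s k| <= 4^-1 * 2^-1 ^+ k.
Proof.
case: (ltnP k q) => kq.
  by rewrite eigen_seq_low // normr0 mulr_ge0 // ltW.
rewrite gtr0_norm ?eigen_seq_gt0 //; move: kq; rewrite leq_eqVlt => /predU1P[<-|qk].
  by rewrite eigen_seq_base (le_trans (ltW s_lt)).
rewrite eigen_seq_above // ler_pM ?(ltW dl0) ?(ltW (half_pow _)) ?eigen_gap_le //.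
by rewrite exprS ler_piMl ?invf_le1 ?ler1n // ltW.
Qed.

Lemma eigen_seq_inj k l : (q <= k)%N -> (q <= l)%N -> eigen_seq s k = eigen_seq s l -> k = l.
Proof.
move=> qk ql; move: (qk) (ql); rewrite leq_eqVlt => /predU1P[<-|qk'].
  by rewrite eigen_seq_base => _ /esym /(eigen_seq_eq ql s_gt).
rewrite leq_eqVlt => /predU1P[<-|ql']; first by rewrite eigen_seq_base => /(eigen_seq_eq qk s_gt).
rewrite !eigen_seq_above // => /(mulfI (lt0r_neq0 dl0)) h.
have n1 : (2^-1 : R) != 1 by rewrite invr_eq1 (eqr_nat _ 2 1).
have p0 : 0 < (2^-1 : R) by [].
by have := ieexprIn p0 n1 h; case.
Qed.

(** From 0 < b < dl <= 1/4 follows b^2 < dl, which lies below every positive value allowed by the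
    gap. *)
Lemma eigen_seq_avoid k (g : R) : (0 < g -> dl <= g) -> (q <= k)%N -> eigen_seq s k ^+ 2 <> g.
Proof.
move=> hg qk h; have b0 := eigen_seq_gt0 qk; have b1 := eigen_seq_lt qk.
have g0 : 0 < g by rewrite -h exprn_gt0.
move: (hg g0) b0 b1 eigen_gap_le; rewrite -h; move: (eigen_seq s k) => {h g0 hg qk} b.
nra.
Qed.

End EigenvalueSequence.

Theorem corollary3p15 (R : realType) (d : nat) (K : set 'rV[R[i]]_d)
    (H : hilbertType R)
    (K_polyhedron : polyhedron K)
    (K_three_vertices : (`I_3 #<= vertices K)%card)
    (K_vertex0 : vertices K 0)
    (H_separable : separable_space H)
    (H_infinite : infinite_dimensional H) :
  exists F : set ('I_d -> bop H),
    [/\ ~ countable F,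
        (forall S T, F S -> F T -> S <> T -> ~ unitarily_equivalent S T) &
        forall T, F T ->
          [/\ (forall i, compact_op (T i)),
              matrix_range T = Wmin K &
              minimal T]].
Proof.
have [m [v [v0 KE vext]]] := polyhedron_extreme_family K_polyhedron K_three_vertices K_vertex0.
have [e eb] := orthonormal_basis_exists H_separable H_infinite.
pose q := m.+2.
pose i1 : 'I_q.+1 := lift ord0 ord0.
pose i2 : 'I_q.+1 := lift ord0 (lift ord0 ord0).
(* Functionals dual to v_1 and v_2 exist because neither vertex is a real multiple of the other. *)
have [c1 [c11 c12]] : exists c, refun c (v i1) = 1 /\ refun c (v i2) = 0.
  by apply: dual_functional => r; exact: extreme_no_multiple.
have [c2 [c22 c21]] : exists c, refun c (v i2) = 1 /\ refun c (v i1) = 0.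
  by apply: dual_functional => r; exact: extreme_no_multiple.
have gap0 : 0 < 4^-1 * 2^-1 ^+ q :> R by rewrite mulr_gt0 // exprn_gt0.
(* [dl] respects both the cap imposed by the decay of the eigenvalues and every positive value of
   [c1] at a vertex. *)
have [dl /andP[dl0 dl_le] dlg] :=
  positive_gap (fun l : 'I_q => refun c1 (v (lift ord0 l))) gap0.
have [xi [xi_e xi_bd _]] : exists xi, [/\ forall k, inner xi (e k) =
      (if (k < q)%N then 0 else (4^-1 * 2^-1 ^+ k)%:C%C), hnm xi <= 2 * (4^-1 : R) &
    forall n, hnm (xi - \sum_(k < n)
      (if (k < q)%N then 0 else (4^-1 * 2^-1 ^+ k)%:C%C) *: e k) <= 2 * (4^-1 : R) * 2^-1 ^+ n].
  apply: (series_exists eb) => k; have h0 : 0 <= 4^-1 * 2^-1 ^+ k :> R.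
    by rewrite mulr_ge0 // exprn_ge0.
  by case: ifP => _; rewrite ?cabs0 // cabsR ger0_norm.
have half : 2 * (4^-1 : R) = 2^-1 by field.
rewrite half in xi_bd.
have xi_low k : (k < q)%N -> inner xi (e k) = 0 by move=> kq; rewrite xi_e kq.
have xi_high k : (q <= k)%N -> inner xi (e k) = (4^-1 * 2^-1 ^+ k)%:C%C.
  by move=> kq; rewrite xi_e ltnNge kq.
pose J : set R := [set` `]dl / 2, dl[].
(* Outside [J] any operator will do; the default makes [B] a total function of s. *)
have /choice [B BP] : forall s, exists B : bop H, J s ->
    [/\ forall x k, inner (B x) (e k) = (eigen_seq q dl s k)%:C%C * inner x (e k),
    forall x, hnm (B x) <= 2^-1 * hnm x & forall n x,
    hnm (B x - \sum_(k < n) ((eigen_seq q dl s k)%:C%C * inner x (e k)) *: e k) <=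
      2^-1 * hnm x * 2^-1 ^+ n].
  move=> s; have [Js|] := pselect (J s); last by exists 0.
  move: Js; rewrite /J /= in_itv /= => /andP[s1 s2].
  have [B] := diagonal_exists eb (eigen_seq_small dl0 dl_le s1 s2).
  by rewrite half; exists B.
pose T s := model e (B s) xi v.
have eig s t : J s -> J t -> unitarily_equivalent (T s) (T t) -> s = t.
  move=> Js Jt st; have [Bs _ _] := BP s Js; have [Bt _ _] := BP t Jt.
  move: (Js) (Jt); rewrite /J /= !in_itv /= => /andP[s1 s2] /andP[t1 t2].
  have low k : (k < q)%N -> eigen_seq q dl s k = 0 by exact: eigen_seq_low.
  have low' k : (k < q)%N -> eigen_seq q dl t k = 0 by exact: eigen_seq_low.
  have eq0 : e q != 0 by rewrite -hnm_eq0 (onb_hnm eb) oner_eq0.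
  have hs := functional_diag eb Bs low xi_low v0 c11 c12 q.
  have [z z0 hz] := unitarily_equivalent_eigen st eq0 hs.
  (* s^2 is the eigenvalue of the first tuple at e_q, hence a spectral value of the second. The gap
     rules out low indices, and s > dl/2 leaves only index q, where the value is t^2. *)
  have [k] := functional_eigenvalue eb Bt low' xi_low v0 c11 c12 z0 hz.
  rewrite spectral_value_high // eigen_seq_base; case: (ltnP k q) => kq.
    rewrite /spectral_value insubT => h.
    have := @eigen_seq_avoid R q dl dl0 dl_le s s1 s2 q _ (dlg (Ordinal kq)) (leqnn q).
    by rewrite eigen_seq_base h.
  rewrite spectral_value_high // => /eqP; rewrite eqrXn2 //; last 2 first.
  - by rewrite ltW // (lt_trans _ s1) // divr_gt0.
  - by rewrite ltW // (eigen_seq_gt0 dl0 t1).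
  move=> /eqP h; have kE := eigen_seq_eq dl0 kq s1 (esym h).
  by rewrite h kE eigen_seq_base.
exists (T @` J); split.
- have Tinj : {in J &, injective T}.
    move=> s t /set_mem Js /set_mem Jt Tst; apply: eig => //.
    rewrite Tst; exact: unitarily_equivalent_refl.
  rewrite (eq_countable (inj_card_eq Tinj)); apply: itv_uncountable.
  by rewrite ltr_pdivrMr // ltr_pMr // ltr1n.
- move=> _ _ [s Js <-] [t Jt <-] nst st; apply: nst.
  by rewrite (eig s t).
move=> _ [s Js <-]; have [Bs Bbd Btail] := BP s Js.
move: (Js); rewrite /J /= in_itv /= => /andP[s1 s2].
have low k : (k < q)%N -> eigen_seq q dl s k = 0 by exact: eigen_seq_low.
have small := eigen_seq_small dl0 dl_le s1 s2.
have high k : (q <= k)%N -> 0 < eigen_seq q dl s k by exact: eigen_seq_gt0.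
split=> [i||].
- exact: (model_compact xi Btail v0).
- exact: (model_range eb Bs Bbd low small xi_low xi_high xi_bd v0 KE).
have avoid k (l : 'I_q) : (q <= k)%N -> eigen_seq q dl s k ^+ 2 <> refun c1 (v (lift ord0 l)).
  exact: (eigen_seq_avoid dl0 dl_le s1 s2 (dlg l)).
exact: (model_minimal eb Bs Bbd low small xi_low xi_high xi_bd v0 vext high
  (eigen_seq_inj dl0 s1) c11 c12 c21 c22 avoid).
Qed.
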